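(* Suppose $M \subset \mathbb{C}^{n+1}$, $n \geq 2$, is a real-analytic submanifold of real codimension two that is CR singular at $p \in M$, with the CR singularity at $p$ being $A$-nondegenerate and not the exceptional case. Assume that $M$ is non-minimal at all CR points. Let $\varphi \colon M \to \mathbb{C}$ be a real-analytic function that is CR at the CR points of $M$. Then there exists a holomorphic function $\Phi$ defined in a neighborhood $U$ of $p$ in $\mathbb{C}^{n+1}$ such that $\Phi|_{U \cap M} = \varphi|_{U \cap M}$.
   Context: Coordinates on $\mathbb{C}^{n+1}=\mathbb{C}^n\times\mathbb{C}$ are $(z,w)$. All submanifolds are embedded. For a real submanifold $M \subset \mathbb{C}^{n+1}$ let $T^c_pM = T_pM \cap J(T_pM)$ ($J$ the complex structure) and $\mathbb{C} \otimes T^c_pM = T^{1,0}_pM \oplus T^{0,1}_pM$. $M$ is CR at $p$ if $\dim T^{0,1}_qM$ is constant for $q \in M$ near $p$ (this complex dimension is the CR dimension); otherwise $M$ is CR singular at $p$ and $p$ is a CR singularity. A smooth function on $M$ is CR at CR points if it is annihilated by all vectors in $T^{0,1}_qM$ at all CR points $q$. If $M$ is $2n$-dimensional with a CR singularity at $p$, then after a translation and rotation taking $p$ to $0$, $M$ is given near $0$ by $w = A(z,\bar z) + B(z,z) + \overline{C(z,z)} + O(\|z\|^3)$, with $A$ sesquilinear and $B, C$ bilinear. The CR singularity is $A$-nondegenerate if the matrix of $A$ is nonsingular. Exceptional case ($n=2$ only): the CR singularity $p$ of $M\subset \mathbb{C}^3$ is the exceptional case if in suitable local holomorphic coordinates $(z_1,z_2,w)$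 vanishing at $p$, $M$ can be put into the form $w = |z_1|^2 - |z_2|^2 + \lambda(z_1^2 + \bar z_1^2) + \lambda (z_2^2 + \bar z_2^2) + O(\|z\|^3)$ with $\lambda \geq \frac12$. A real-analytic CR submanifold is non-minimal at $q$ if it contains through $q$ a proper CR submanifold (one of lower dimension) of the same CR dimension. *)

(* Defs.v *)
From HB Require Import structures.
From mathcomp Require Import all_boot all_order all_algebra finmap.
From mathcomp Require Import complex.
From mathcomp Require Import all_classical all_reals all_analysis.

Set Implicit Arguments.
Unset Strict Implicit.
Unset Printing Implicit Defensive.

Import Order.TTheory GRing.Theory Num.Theory.
Import numFieldNormedType.Exports.

Local Open Scope classical_set_scope.
Local Open Scope complex_scope.
Local Open Scope sesquilinear_scope.
Local Open Scope ring_scope.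

(* MathComp-Analysis puts a norm and a topology on variables of type
   [numClosedFieldType] but not on [R[i]]; these are the ones of [R[i]^o], so
   that [differentiable] on ['rV[R[i]]_n] is complex differentiability. *)
HB.instance Definition _ (R : rcfType) := NormedModule.copy R[i] R[i]^o.

(* Unconditional (hence absolute) summability of [f] with sum [l]. *)
Definition has_sum (R : realType) (I : choiceType) (f : I -> R) (l : R) : Prop :=
  forall e : R, 0 < e -> exists A : {fset I}, forall B : {fset I},
    (A `<=` B)%fset -> `|\sum_(a <- B) f a - l| < e.

Definition analytic_at (R : realType) (m : nat) (f : 'rV[R]_m -> R)
    (a : 'rV[R]_m) : Prop :=
  exists (c : {ffun 'I_m -> nat} -> R) (r : R), 0 < r /\
    forall x : 'rV[R]_m, (forall i, `|x 0 i - a 0 i| < r) ->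
      has_sum (fun k : {ffun 'I_m -> nat} =>
                 c k * \prod_(i < m) (x 0 i - a 0 i) ^+ k i) (f x).

(* C^oo near [a]: all iterated directional derivatives are differentiable. *)
Definition smooth_at (R : realType) (m : nat) (f : 'rV[R]_m -> R)
    (a : 'rV[R]_m) : Prop :=
  \forall x \near a, forall vs : seq 'rV[R]_m,
    differentiable (foldr (fun v g => 'D_v g) f vs) x.

Definition holomorphic_on (R : realType) (n : nat) (W : normedModType R[i])
    (U : set 'rV[R[i]]_n) (F : 'rV[R[i]]_n -> W) : Prop :=
  forall x, U x -> differentiable F x.

(* The underlying real coordinates (Re z, Im z) of z in C^n. *)
Definition realify (R : realType) (n : nat) (z : 'rV[R[i]]_n) : 'rV[R]_(n + n) :=
  row_mx (map_mx (@complex.Re R) z) (map_mx (@complex.Im R) z).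

(* The complex structure (x, y) |-> (- y, x), acting on row vectors. *)
Definition Jmx (K : pzRingType) (n : nat) : 'M[K]_(n + n) :=
  block_mx 0 1%:M (- 1%:M) 0.

(* Embedded real submanifold of C^n of codimension [k], of the regularity class
   given by [reg] (either [analytic_at] or [smooth_at]): near each of its
   points it is the zero set of [k] functions with independent differentials. *)
Definition submanifold (R : realType) (n : nat)
    (reg : ('rV[R]_(n + n) -> R) -> 'rV[R]_(n + n) -> Prop) (k : nat)
    (M : set 'rV[R[i]]_n) : Prop :=
  forall p, M p -> exists r : 'I_k -> 'rV[R]_(n + n) -> R,
    [/\ forall i, reg (r i) (realify p),
        row_free (\matrix_(i < k, j < n + n)
                    'D_(delta_mx 0 j) (r i) (realify p)) &
        \forall x \near p, M x <-> forall i, r i (realify x) = 0].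

Definition curve_in (R : realType) (n : nat) (M : set 'rV[R[i]]_n)
    (p : 'rV[R[i]]_n) (v : 'rV[R]_(n + n)) (g : R -> 'rV[R[i]]_n) : Prop :=
  [/\ g 0 = p, \forall t \near (0 : R), M (g t) &
      is_derive (0 : R) 1 (fun t => realify (g t)) v].

Definition tangent (R : realType) (n : nat) (M : set 'rV[R[i]]_n)
    (p : 'rV[R[i]]_n) : set 'rV[R]_(n + n) :=
  [set v | exists g, curve_in M p v g].

Definition ctangent (R : realType) (n : nat) (M : set 'rV[R[i]]_n)
    (p : 'rV[R[i]]_n) : set 'rV[R]_(n + n) :=
  tangent M p `&` [set u *m Jmx R n | u in tangent M p].

(* T^{0,1}_p M: the (- i)-eigenspace of J in the complexification of T^c_p M.
   A complexified vector is given by its coordinates with respect to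
   d/dx_1, ..., d/dx_n, d/dy_1, ..., d/dy_n. *)
Definition T01 (R : realType) (n : nat) (M : set 'rV[R[i]]_n)
    (p : 'rV[R[i]]_n) : set 'rV[R[i]]_(n + n) :=
  [set L | [/\ ctangent M p (map_mx (@complex.Re R) L),
               ctangent M p (map_mx (@complex.Im R) L) &
               L *m Jmx R[i] n = - 'i *: L]].

Definition has_dim (K : fieldType) (m : nat) (S : set 'rV[K]_m) (d : nat) : Prop :=
  exists B : 'M[K]_(d, m), row_free B /\ forall v, S v <-> (v <= B)%MS.

Definition CR_at (R : realType) (n : nat) (M : set 'rV[R[i]]_n)
    (p : 'rV[R[i]]_n) : Prop :=
  M p /\ exists d, \forall q \near p, M q -> has_dim (T01 M q) d.

Definition CR_singular (R : realType) (n : nat) (M : set 'rV[R[i]]_n)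
    (p : 'rV[R[i]]_n) : Prop :=
  M p /\ ~ CR_at M p.

(* [k] is the codimension of [M]; [d] is the common CR dimension. *)
Definition nonminimal (R : realType) (n : nat) (k : nat)
    (M : set 'rV[R[i]]_n) (q : 'rV[R[i]]_n) : Prop :=
  exists (k' d : nat) (N : set 'rV[R[i]]_n),
    [/\ (k < k')%N, submanifold (@smooth_at R (n + n)) k' N, N q, N `<=` M &
        has_dim (T01 M q) d /\ forall x, N x -> has_dim (T01 N x) d].

(* Functions on [M] are represented by functions on the ambient space, of which
   only the values on [M] matter. *)
Definition analytic_on (R : realType) (n : nat) (M : set 'rV[R[i]]_n)
    (f : 'rV[R[i]]_n -> R[i]) : Prop :=
  forall q, M q -> exists g h : 'rV[R]_(n + n) -> R,
    [/\ analytic_at g (realify q), analytic_at h (realify q) &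
        \forall x \near q, M x -> f x = g (realify x) +i* h (realify x)].

Definition cderive (R : realType) (f : R -> R[i]) (t : R) : R[i] :=
  derive1 (fun s => complex.Re (f s)) t +i* derive1 (fun s => complex.Im (f s)) t.

(* For L = X + iY, Lf = Xf + i Yf, where Xf is the derivative of f along any
   curve in M with velocity X. *)
Definition CR_function (R : realType) (n : nat) (M : set 'rV[R[i]]_n)
    (f : 'rV[R[i]]_n -> R[i]) : Prop :=
  forall q, CR_at M q -> forall L, T01 M q L -> forall g h : R -> 'rV[R[i]]_n,
    curve_in M q (map_mx (@complex.Re R) L) g ->
    curve_in M q (map_mx (@complex.Im R) L) h ->
    cderive (f \o g) 0 + 'i * cderive (f \o h) 0 = 0.

(* A point of C^{n+1} is (z, w), w being its last coordinate. *)
Definition zpart (R : realType) (n : nat) (x : 'rV[R[i]]_n.+1) : 'rV[R[i]]_n :=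
  col' ord_max x.
Definition wpart (R : realType) (n : nat) (x : 'rV[R[i]]_n.+1) : R[i] :=
  x 0 ord_max.

(* Near 0, [S] is given by w = Q(z) + O(|z|^3). *)
Definition given_by (R : realType) (n : nat) (S : set 'rV[R[i]]_n.+1)
    (Q : 'rV[R[i]]_n -> R[i]) : Prop :=
  exists rho : 'rV[R[i]]_n -> R[i],
    (\forall x \near (0 : 'rV[R[i]]_n.+1), S x <-> wpart x = rho (zpart x)) /\
    exists K : R, \forall z \near (0 : 'rV[R[i]]_n),
      `|rho z - Q z| <= K%:C * `|z| ^+ 3.

Definition A_nondegenerate (R : realType) (n : nat) (M : set 'rV[R[i]]_n.+1)
    (p : 'rV[R[i]]_n.+1) : Prop :=
  exists (U : 'M[R[i]]_n.+1) (A B C : 'M[R[i]]_n),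
    [/\ U \is unitarymx, A \in unitmx &
        given_by [set (x - p) *m U | x in M]
          (fun z => (z *m A *m z ^t* + z *m B *m z^T) 0 0
                    + ((z *m C *m z^T) 0 0)^*)].

Definition exceptional3 (R : realType) (M : set 'rV[R[i]]_3)
    (p : 'rV[R[i]]_3) : Prop :=
  exists (F G : 'rV[R[i]]_3 -> 'rV[R[i]]_3) (U V : set 'rV[R[i]]_3) (l : R),
    [/\ [/\ open U, U p, open V & F p = 0],
        holomorphic_on U F /\ holomorphic_on V G,
        (forall x, U x -> V (F x) /\ G (F x) = x) /\
        (forall y, V y -> U (G y) /\ F (G y) = y),
        2^-1 <= l &
        given_by [set F x | x in M `&` U]
          (fun z : 'rV[R[i]]_2 =>
             `|z 0 0| ^+ 2 - `|z 0 1| ^+ 2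
             + l%:C * (z 0 0 ^+ 2 + (z 0 0)^* ^+ 2)
             + l%:C * (z 0 1 ^+ 2 + (z 0 1)^* ^+ 2))].

Definition exceptional (R : realType) (n : nat) :
    set 'rV[R[i]]_n.+1 -> 'rV[R[i]]_n.+1 -> Prop :=
  match n with
  | 2 => @exceptional3 R
  | _ => fun _ _ => False
  end.

(* Main.v *)
Require Import Defs.
From HB Require Import structures.
From mathcomp Require Import all_boot all_order all_algebra complex.
From mathcomp Require Import all_classical all_reals all_analysis.
From mathcomp Require Import finmap ring lra.
Import numFieldNormedType.Exports.
Import Order.TTheory GRing.Theory Num.Theory.
Local Open Scope classical_set_scope.
Local Open Scope complex_scope.
Local Open Scope ring_scope.
Set Implicit Arguments.
Unset Strict Implicit.
Unset Printing Implicit Defensive.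

(** Near [p], [M] is the graph [w = rho (z, zeta)], [zeta = z^*], of a power series,
    and [phi = phic (z, zeta)] on [M].  At the real points [zeta = z^*] where
    [d_zeta rho] does not vanish, [M] is CR of dimension [n - 1] and the
    Cauchy-Riemann equations say that [d_zeta phic] is proportional to
    [d_zeta rho]; by the identity theorem this holds at all [(z, zeta)].
    Nondegeneracy of [A] makes the entries of [d_zeta rho] independent coordinates
    up to higher order, so for [n >= 2] one can divide: [d_zeta phic = phi_1 d_zeta rho]
    with [phi_1] holomorphic.  Comparing mixed derivatives, [phi_1] satisfies the
    same hypothesis, hence [d_zeta phi_k = phi_(k+1) d_zeta rho] for all [k], and
    [Phi (z, w) = \sum_k phi_k (z, 0) (w - rho (z, 0)) ^+ k / k!] converges near [0]
    because each division costs a factor [O(k)] on a polydisc of fixed size.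
    Taylor's formula along [t |-> (z, t zeta)] gives [Phi (z, rho) = phic]. *)

(** * Modulus and limits of complex numbers *)

(** Two obstacles shape the proof. [A_nondegenerate] gives the graph function only as some function
    with a cubic error, so its analyticity is recovered from the two real defining equations: they
    are complexified in independent variables [z], [zeta], [w], [omega], solved for [w] and [omega],
    and the solution is matched with the given graph at the points where [zeta] is the conjugate of
    [z]. The second obstacle is to control infinitely many divisions. Series are measured by the
    weighted sum of their coefficients, not by the supremum: this norm is submultiplicative, and
    removing a factor [x i] divides it by exactly [s i] with no loss of radius. Division by a small
    perturbation of [x i] is then a Neumann series, and radius is lost only in differentiating.
    Spending equal gaps over N steps costs order [N ^ N], which is [N!] up to a geometric factor and
    is absorbed by the [1 / k!] in [Phi]. One divisor leaves a remainder independent of one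
    coordinate; a second divisor, transverse to the first, forces that remainder to vanish, and this
    is where [2 <= n] enters. *)

Section Modulus.
Variable R : realType.
Implicit Types z w : R[i].

(** The norm of [R[i]] takes its values in [R[i]], whose order is partial. Estimates are carried out
    on its real part, where [lra] and [nra] apply. *)
Definition cmod z : R := complex.Re `|z|.

Lemma cmodE z : (cmod z)%:C = `|z|.
Proof. by rewrite /cmod normc_def. Qed.

Lemma cmod_ge0 z : 0 <= cmod z.
Proof. by rewrite -lecR cmodE normr_ge0. Qed.

Lemma cmod0 : cmod (0 : R[i]) = 0.
Proof. by apply: complexI; rewrite cmodE normr0. Qed.

Lemma cmod1 : cmod (1 : R[i]) = 1.
Proof. by apply: complexI; rewrite cmodE normr1. Qed.

Lemma cmodN z : cmod (- z) = cmod z.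
Proof. by rewrite /cmod normrN. Qed.

Lemma cmodB z w : cmod (z - w) = cmod (w - z).
Proof. by rewrite -cmodN opprB. Qed.

Lemma cmodM z w : cmod (z * w) = cmod z * cmod w.
Proof. by apply: complexI; rewrite cmodE normrM rmorphM /= !cmodE. Qed.

Lemma cmodX z n : cmod (z ^+ n) = cmod z ^+ n.
Proof. by elim: n => [|n IH]; rewrite ?cmod1 // !exprS cmodM IH. Qed.

Lemma cmodV z : cmod z^-1 = (cmod z)^-1.
Proof. by apply: complexI; rewrite fmorphV /= !cmodE normfV. Qed.

Lemma cmodD z w : cmod (z + w) <= cmod z + cmod w.
Proof. by rewrite -lecR rmorphD /= !cmodE ler_normD. Qed.

Lemma cmod_le_add z w a b : cmod z <= a -> cmod w <= b -> cmod (z + w) <= a + b.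
Proof. by move=> ha hb; apply: le_trans (cmodD _ _) _; apply: lerD. Qed.

Lemma cmod_le_sub z w a b : cmod z <= a -> cmod w <= b -> cmod (z - w) <= a + b.
Proof. by move=> ha hb; apply: cmod_le_add; rewrite ?cmodN. Qed.

Lemma cmod_eq0 z : (cmod z == 0) = (z == 0).
Proof.
apply/eqP/eqP => [h|->]; last exact: cmod0.
by apply/eqP; rewrite -normr_eq0 -cmodE h.
Qed.

Lemma cmod_gt0 z : (0 < cmod z) = (z != 0).
Proof. by rewrite lt_def cmod_eq0 cmod_ge0 andbT. Qed.

Lemma cmodR (x : R) : cmod x%:C = `|x|.
Proof.
rewrite /cmod normc_def /=.
by rewrite expr0n /= addr0 sqrtr_sqr.
Qed.

Lemma cmod_nat n : cmod (n%:R : R[i]) = n%:R.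
Proof. by rewrite /cmod normr_nat -(rmorph_nat (real_complex R)). Qed.

Lemma cmod_sum (I : Type) (s : seq I) (P : pred I) (F : I -> R[i]) :
  cmod (\sum_(i <- s | P i) F i) <= \sum_(i <- s | P i) cmod (F i).
Proof.
elim/big_rec2: _ => [|i x y _ h]; first by rewrite cmod0.
by apply: le_trans (cmodD _ _) _; rewrite lerD2l.
Qed.

Lemma cmod_conj z : cmod z^* = cmod z.
Proof. by case: z => a b; rewrite /cmod !normc_def /= sqrrN. Qed.

Lemma Re_le_cmod z : `|complex.Re z| <= cmod z.
Proof.
rewrite /cmod normc_def /= -sqrtr_sqr ler_wsqrtr // lerDl.
exact: sqr_ge0.
Qed.

Lemma Im_le_cmod z : `|complex.Im z| <= cmod z.
Proof.
rewrite /cmod normc_def /= -sqrtr_sqr ler_wsqrtr // lerDr.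
exact: sqr_ge0.
Qed.

Lemma cmodi : cmod ('i : R[i]) = 1.
Proof. by rewrite /cmod normc_def /= expr0n expr1n /= add0r sqrtr1. Qed.

Lemma cmod_le_ReIm z : cmod z <= `|complex.Re z| + `|complex.Im z|.
Proof.
rewrite {1}(complexE z); apply: cmod_le_add; first by rewrite cmodR.
by rewrite cmodM cmodi mul1r cmodR.
Qed.

Lemma cmod_le0 z : (forall e : R, 0 < e -> cmod z <= e) -> z = 0.
Proof.
move=> h; apply/eqP; rewrite -cmod_eq0 eq_le cmod_ge0 andbT.
by apply/ler_addgt0Pr => e e0; rewrite add0r h.
Qed.

Lemma cconjM z w : (z * w)^* = z^* * w^*.
Proof. exact: rmorphM. Qed.

Lemma cconjD z w : (z + w)^* = z^* + w^*.
Proof. exact: rmorphD. Qed.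

Lemma cconjR (x : R) : (x%:C)^* = x%:C :> R[i].
Proof. exact: conjc_real. Qed.

Lemma cconji : ('i : R[i])^* = - 'i.
Proof. by apply/eqP; rewrite eq_complex /= oppr0 !eqxx. Qed.

Lemma i_neq0 : ('i : R[i]) != 0.
Proof. by rewrite -cmod_eq0 cmodi oner_eq0. Qed.

Lemma mulii : ('i : R[i]) * 'i = -1.
Proof. by rewrite -expr2 sqr_i. Qed.

Definition clim (u : nat -> R[i]) (l : R[i]) : Prop :=
  forall e : R, 0 < e -> exists N, forall n, (N <= n)%N -> cmod (u n - l) <= e.

Lemma clim_unique u l l' : clim u l -> clim u l' -> l = l'.
Proof.
move=> h h'; apply/eqP; rewrite -subr_eq0; apply/eqP/cmod_le0 => e e0.
have e2 : 0 < e / 2 by apply: divr_gt0.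
have [N hN] := h _ e2; have [N' hN'] := h' _ e2.
have -> : l - l' = (u (maxn N N') - l') - (u (maxn N N') - l) by ring.
rewrite (splitr e); apply: cmod_le_sub; [apply: hN'; exact: leq_maxr|].
by apply: hN; exact: leq_maxl.
Qed.

Lemma clim_cst l : clim (fun=> l) l.
Proof. by move=> e e0; exists 0%N => n _; rewrite subrr cmod0 ltW. Qed.

Lemma eq_clim u v l : u =1 v -> clim u l -> clim v l.
Proof. by move=> /funext ->. Qed.

Lemma clim_lin a b u v l m :
  clim u l -> clim v m -> clim (fun n => a * u n + b * v n) (a * l + b * m).
Proof.
move=> hu hv e e0.
have k0 : 0 < cmod a + cmod b + 1.
  by rewrite ltr_wpDl ?addr_ge0 ?cmod_ge0.
have e2 : 0 < e / (cmod a + cmod b + 1) by apply: divr_gt0.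
have [N hN] := hu _ e2; have [N' hN'] := hv _ e2.
exists (maxn N N') => n; rewrite geq_max => /andP[h1 h2].
have -> : a * u n + b * v n - (a * l + b * m) = a * (u n - l) + b * (v n - m).
  by ring.
apply: le_trans (cmodD _ _) _; rewrite !cmodM.
have := ler_wpM2l (cmod_ge0 a) (hN _ h1).
have := ler_wpM2l (cmod_ge0 b) (hN' _ h2).
have : (cmod a + cmod b) * (e / (cmod a + cmod b + 1)) <= e.
  rewrite mulrA ler_pdivrMr // mulrC ler_pM2l //; lra.
lra.
Qed.

Lemma climD u v l m : clim u l -> clim v m -> clim (fun n => u n + v n) (l + m).
Proof.
move=> hu hv; have := clim_lin 1 1 hu hv; rewrite !mul1r.
by apply: eq_clim => n; rewrite !mul1r.
Qed.

Lemma climM a u l : clim u l -> clim (fun n => a * u n) (a * l).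
Proof.
move=> hu; have := clim_lin a 0 hu hu; rewrite mul0r addr0.
by apply: eq_clim => n; rewrite mul0r addr0.
Qed.

Lemma clim_bound u l b :
  clim u l -> (forall n, cmod (u n) <= b) -> cmod l <= b.
Proof.
move=> hu hb; apply/ler_addgt0Pr => e /hu [N /(_ N (leqnn _)) h].
have -> : l = u N - (u N - l) by ring.
exact: cmod_le_sub.
Qed.

Lemma clim_le u l (v : nat -> R) :
  (forall n, cmod (u n - l) <= v n) -> v @ \oo --> (0 : R) -> clim u l.
Proof.
move=> h hv e e0.
have /cvgrPdist_le/(_ _ e0) [N _ hN] := hv.
exists N => n /hN /=; rewrite sub0r normrN => hh.
by apply: le_trans (h n) (le_trans (ler_norm _) hh).
Qed.

Lemma cseries_cvg (f : nat -> R[i]) (B : nat -> R) (b : R) :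
  (forall j, cmod (f j) <= B j) -> (forall N, \sum_(j < N) B j <= b) ->
  exists l, clim (fun N => \sum_(j < N) f j) l.
Proof.
move=> hf hB.
have B0 j : 0 <= B j by apply: le_trans (hf j); exact: cmod_ge0.
have cvgB : cvgn (series B).
  apply: nondecreasing_is_cvgn; first exact: nondecreasing_series.
  by exists b => _ [N _ <-]; rewrite /series /= big_mkord.
have key (g : nat -> R) : (forall j, `|g j| <= B j) -> cvgn (series g).
  move=> hg; apply: normed_cvg.
  by apply: (series_le_cvg _ B0 hg cvgB) => n /=; exact: normr_ge0.
have c1 : cvgn (series (fun j => complex.Re (f j))).
  by apply: key => j; apply: le_trans (Re_le_cmod _) (hf j).
have c2 : cvgn (series (fun j => complex.Im (f j))).
  by apply: key => j; apply: le_trans (Im_le_cmod _) (hf j).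
exists (limn (series (fun j => complex.Re (f j))) +i*
        limn (series (fun j => complex.Im (f j)))) => e e0.
have e2 : 0 < e / 2 by apply: divr_gt0.
move/cvgrPdist_le/(_ _ e2): c1 => [N1 _ h1].
move/cvgrPdist_le/(_ _ e2): c2 => [N2 _ h2].
exists (maxn N1 N2) => n; rewrite geq_max => /andP[n1 n2].
apply: le_trans (cmod_le_ReIm _) _; rewrite (splitr e).
have hs : \sum_(j < n) f j = (series (fun j => complex.Re (f j)) n) +i*
   (series (fun j => complex.Im (f j)) n).
  rewrite /series /= !big_mkord.
  elim: n {n1 n2} => [|n IH]; first by rewrite !big_ord0.
  by rewrite !big_ord_recr /= IH; case: (f n).
rewrite hs /= distrC.
by apply: lerD; [exact: h1|rewrite distrC; exact: h2].
Qed.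

Lemma clim_shift u l k : clim u l -> clim (fun n => u (k + n)%N) l.
Proof.
move=> h e /h[N hN]; exists N => n hn; apply: hN.
exact: leq_trans hn (leq_addl _ _).
Qed.

End Modulus.

(** * Absolutely convergent power series *)

Definition pdisc (R : realType) (I : Type) (s : I -> R) (x : I -> R[i]) : Prop :=
  forall i, cmod (x i) <= s i.

(* [ps s f B]: on the polydisc of radii [s], [f] is a power series whose coefficients
   satisfy [\sum_k |c_k| s ^ k <= B]. *)
Inductive ps (R : realType) (I : Type) (s : I -> R) :
    ((I -> R[i]) -> R[i]) -> R -> Prop :=
| ps_cst c : ps s (fun=> c) (cmod c)
| ps_mulX i f B : ps s f B -> ps s (fun x => x i * f x) (s i * B)
| ps_sum f (B : nat -> R) F (b : R) : (forall j : nat, ps s (f j) (B j)) ->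
    (forall N, \sum_(j < N) B j <= b) ->
    (forall x, pdisc s x -> clim (fun N => \sum_(j < N) f j x) (F x)) ->
    ps s F b.

Section PowerSeries.
Variables (R : realType) (I : Type) (s : I -> R).
Hypothesis s_ge0 : forall i, 0 <= s i.
Implicit Types (f g : (I -> R[i]) -> R[i]) (x : I -> R[i]).

Lemma ps_bound f B x : ps s f B -> pdisc s x -> cmod (f x) <= B.
Proof.
move=> hf hx; elim: hf => {f B} [c|i f B _ IH|f B F b _ IH hB hF] //.
  by rewrite cmodM; apply: ler_pM; rewrite ?cmod_ge0.
apply: (clim_bound (hF _ hx)) => N.
apply: le_trans (cmod_sum _ _ _) _; apply: le_trans (hB N).
by apply: ler_sum => j _; apply: IH.
Qed.

Lemma pdisc0 : pdisc s (fun=> 0).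
Proof. by move=> i; rewrite cmod0. Qed.

Lemma ps_ge0 f B : ps s f B -> 0 <= B.
Proof. by move=> /ps_bound /(_ pdisc0); apply: le_trans; exact: cmod_ge0. Qed.

(** [ps_sum] constrains the sum only on the polydisc and allows a bound above the total, so a series
    with one nonzero term absorbs both a weaker bound and a change of the function outside the
    polydisc. *)
Lemma ps_le f g B B' : ps s f B -> B <= B' ->
  (forall x, pdisc s x -> g x = f x) -> ps s g B'.
Proof.
move=> hf hB hg.
apply: (@ps_sum R I s (fun j => if j is 0%N then f else fun=> 0)
  (fun j => if j is 0%N then B else 0)) => [[|j]//|N|x hx].
- by rewrite -[X in ps _ _ X](cmod0 R); exact: ps_cst.
- case: N => [|N]; first by rewrite big_ord0 (le_trans (ps_ge0 hf)).
  by rewrite big_ord_recl big1 ?addr0.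
- rewrite (hg _ hx) => e e0; exists 1%N => -[//|n] _.
  by rewrite big_ord_recl big1 ?addr0 ?subrr ?cmod0 ?ltW.
Qed.

Lemma ps_cstW c B : cmod c <= B -> ps s (fun=> c) B.
Proof. by move=> h; apply: ps_le (ps_cst s c) h _. Qed.

Lemma ps_X i : ps s (fun x => x i) (s i).
Proof.
apply: ps_le (ps_mulX i (ps_cst s 1)) _ _; first by rewrite cmod1 mulr1.
by move=> x _; rewrite mulr1.
Qed.

Lemma ps_add f g A B : ps s f A -> ps s g B -> ps s (fun x => f x + g x) (A + B).
Proof.
move=> hf hg.
apply: (@ps_sum R I s
  (fun j => match j with 0%N => f | 1%N => g | _ => fun=> 0 end)
  (fun j => match j with 0%N => A | 1%N => B | _ => 0 end)) => [[|[|j]]//|N|x hx].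
- by rewrite -[X in ps _ _ X](cmod0 R); exact: ps_cst.
- have := ps_ge0 hf; have := ps_ge0 hg; case: N => [|[|N]] h1 h2.
  + by rewrite big_ord0 addr_ge0.
  + by rewrite big_ord_recl big_ord0 addr0 lerDl.
  + by rewrite !big_ord_recl /= big1 ?addr0.
- move=> e e0; exists 2%N => -[//|[//|n]] _.
  by rewrite !big_ord_recl /= big1 ?addr0 ?subrr ?cmod0 ?ltW.
Qed.

Lemma ps_scale c f B : ps s f B -> ps s (fun x => c * f x) (cmod c * B).
Proof.
elim=> {f B} [c'|i f B _ IH|f B F b _ IH hB hF].
- by rewrite -cmodM; exact: ps_cst.
- apply: ps_le (ps_mulX i IH) _ _; first by rewrite mulrCA.
  by move=> x _; rewrite mulrCA.
- apply: (ps_sum IH) => [N|x hx].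
    by rewrite -mulr_sumr ler_wpM2l ?cmod_ge0.
  by apply: eq_clim (climM c (hF _ hx)) => N; rewrite mulr_sumr.
Qed.

Lemma ps_opp f B : ps s f B -> ps s (fun x => - f x) B.
Proof.
move=> /(ps_scale (-1)); rewrite cmodN cmod1 mul1r => h.
by apply: ps_le h _ _ => // x _; rewrite mulN1r.
Qed.

Lemma ps_sub f g A B : ps s f A -> ps s g B -> ps s (fun x => f x - g x) (A + B).
Proof. by move=> hf /ps_opp; exact: ps_add. Qed.

(** Induction on the derivation of the first factor: only multiplications by a constant and by a
    coordinate occur, and no Cauchy product is formed. *)
Lemma ps_mul f g A B : ps s f A -> ps s g B -> ps s (fun x => f x * g x) (A * B).
Proof.
move=> hf hg; elim: hf => {f A} [c|i f A _ IH|f A F b _ IH hA hF].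
- exact: ps_scale.
- apply: ps_le (ps_mulX i IH) _ _; first by rewrite mulrA.
  by move=> x _; rewrite mulrA.
- apply: (ps_sum IH) => [N|x hx].
    by rewrite -mulr_suml ler_wpM2r // (ps_ge0 hg).
  apply: (@eq_clim _ (fun N => g x * \sum_(j < N) f j x)).
    by move=> N; rewrite mulrC mulr_suml.
  by rewrite mulrC; apply: climM; exact: hF.
Qed.

Lemma ps_exp f B n : ps s f B -> ps s (fun x => f x ^+ n) (B ^+ n).
Proof.
move=> hf; elim: n => [|n IH].
  by apply: ps_le (ps_cst s 1) _ _; rewrite ?cmod1.
apply: ps_le (ps_mul hf IH) _ _; first by rewrite exprS.
by move=> x _; rewrite exprS.
Qed.

Lemma ps_bigsum (J : Type) (r : seq J) (F : J -> _) (B : J -> R) :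
  (forall j, ps s (F j) (B j)) ->
  ps s (fun x => \sum_(j <- r) F j x) (\sum_(j <- r) B j).
Proof.
move=> h; elim: r => [|j r IH].
  by rewrite big_nil; apply: ps_le (ps_cst s 0) _ _; rewrite ?cmod0 // => x _;
     rewrite big_nil.
rewrite big_cons; apply: ps_le (ps_add (h j) IH) _ _ => // x _.
by rewrite big_cons.
Qed.

Lemma ps_series (f : nat -> (I -> R[i]) -> R[i]) (B : nat -> R) b :
  (forall j, ps s (f j) (B j)) -> (forall N, \sum_(j < N) B j <= b) ->
  exists F, ps s F b /\
    forall x, pdisc s x -> clim (fun N => \sum_(j < N) f j x) (F x).
Proof.
move=> hf hB.
have /choice[F hF] (x : I -> R[i]) : exists l, pdisc s x ->
    clim (fun N => \sum_(j < N) f j x) l.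
  have [hx|hx] := pselect (pdisc s x); last by exists 0.
  have [l hl] := cseries_cvg (fun j => ps_bound (hf j) hx) hB.
  by exists l.
by exists F; split; [exact: ps_sum hF|exact: hF].
Qed.

End PowerSeries.

(** A monomial of weight [r ^ k] becomes a product of functions of norm at most [r j], so the
    coefficient norm does not grow. Freezing, duplicating and adjoining variables are all
    instances. *)
Lemma ps_comp (R : realType) (I J : Type) (s : I -> R) (r : J -> R)
    (f : (J -> R[i]) -> R[i]) (h : (I -> R[i]) -> J -> R[i]) B :
  (forall i, 0 <= s i) -> (forall j, 0 <= r j) -> ps r f B ->
  (forall j, ps s (fun x => h x j) (r j)) -> ps s (fun x => f (h x)) B.
Proof.
move=> s0 r0 hf hh; elim: hf => {f B} [c|j f B _ IH|f B F b _ IH hB hF].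
- exact: ps_cst.
- exact: ps_mul.
- apply: (ps_sum IH hB) => x hx; apply: hF => j. exact: (ps_bound (hh j) hx).
Qed.

Lemma ps_radii (R : realType) (I : Type) (s s' : I -> R) f B :
  (forall i, 0 <= s' i) -> (forall i, s' i <= s i) -> ps s f B -> ps s' f B.
Proof.
move=> h0 hs hf.
apply: (ps_comp (h := fun x => x) h0 _ hf) => j; first exact: le_trans (hs j).
by apply: (ps_le h0 (ps_X h0 j) (hs j)).
Qed.

Definition upd (I : eqType) (T : Type) (x : I -> T) (i : I) (t : T) : I -> T :=
  fun j => if j == i then t else x j.

Lemma upd_id (I : eqType) T (x : I -> T) i : upd x i (x i) = x.
Proof. by apply/funext => j; rewrite /upd; case: eqP => // ->. Qed.

Lemma upd_eq (I : eqType) T (x : I -> T) i t : upd x i t i = t.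
Proof. by rewrite /upd eqxx. Qed.

Lemma upd_upd (I : eqType) T (x : I -> T) i t t' :
  upd (upd x i t) i t' = upd x i t'.
Proof. by apply/funext => j; rewrite /upd; case: eqP. Qed.

(** * Quotients by a coordinate and their uniqueness *)

Section Quotient.
Variables (R : realType) (I : eqType) (s : I -> R).
Hypothesis s_gt0 : forall i, 0 < s i.
Implicit Types (f g : (I -> R[i]) -> R[i]) (x : I -> R[i]).

Let s_ge0 i : 0 <= s i. Proof. exact: ltW. Qed.

Lemma pdisc_upd x i t : pdisc s x -> cmod t <= s i -> pdisc s (upd x i t).
Proof. by move=> hx ht j; rewrite /upd; case: eqP => // ->. Qed.

(** Each monomial containing [x i] loses one such factor, hence the exact gain [1 / s i] on the same
    polydisc. Cauchy's estimates are derived from this. *)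
Lemma ps_quot f B i : ps s f B ->
  exists q, ps s q (B / s i) /\
    forall x, pdisc s x -> f x = f (upd x i 0) + x i * q x.
Proof.
elim=> {f B} [c|k f B hf [q [hq Hq]]|f B F b hf IH hB hF].
- exists (fun=> 0); split; last by move=> x _; rewrite mulr0 addr0.
  by apply: ps_cstW => //; rewrite cmod0 divr_ge0 ?cmod_ge0.
- have [->|ki] := eqVneq k i.
    exists f; split; first by rewrite mulrAC divff ?mul1r ?gt_eqF.
    by move=> x _; rewrite upd_eq mul0r add0r.
  exists (fun x => x k * q x); split; first by rewrite -mulrA; exact: ps_mulX.
  move=> x /Hq ->; have -> : upd x i 0 k = x k by rewrite /upd (negPf ki).
  by ring.
- have /choice[q hq] j : exists q, ps s q (B j / s i) /\
    forall x, pdisc s x -> f j x = f j (upd x i 0) + x i * q x by exact: IH.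
  have [N|Q [hQ HQ]] := ps_series (b := b / s i) (fun j => proj1 (hq j)).
    by rewrite -mulr_suml ler_wpM2r ?invr_ge0.
  exists Q; split=> // x hx.
  have hx0 : pdisc s (upd x i 0) by apply: pdisc_upd; rewrite ?cmod0.
  apply: (clim_unique (hF x hx)).
  apply: eq_clim (climD (hF _ hx0) (climM (x i) (HQ _ hx))) => N.
  rewrite mulr_sumr -big_split; apply: eq_bigr => j _ /=.
  by rewrite -(proj2 (hq j)).
Qed.

Lemma ps_lip0 f B i x t : ps s f B -> pdisc s x -> cmod t <= s i ->
  cmod (f (upd x i t) - f (upd x i 0)) <= cmod t * (B / s i).
Proof.
move=> /(ps_quot i)[q [hq Hq]] hx ht.
have hxt := pdisc_upd hx ht.
rewrite (Hq _ hxt) upd_eq upd_upd addrAC subrr add0r cmodM.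
by rewrite ler_wpM2l ?cmod_ge0 // (ps_bound hq).
Qed.

(** Where [x i] is nonzero the factor cancels. Elsewhere [x i] is moved to a small real [t], and the
    Lipschitz bound [ps_lip0] carries the equality to [t = 0]. *)
Lemma ps_cancelX f g B B' i : ps s f B -> ps s g B' ->
  (forall x, pdisc s x -> x i * f x = x i * g x) ->
  forall x, pdisc s x -> f x = g x.
Proof.
move=> hf hg h x hx; have hd := ps_sub s_ge0 hf hg.
apply/eqP; rewrite -subr_eq0; apply/eqP.
have [xi0|xi0] := eqVneq (x i) 0; last first.
  by apply: (mulfI xi0); rewrite mulr0 mulrBr (h _ hx) subrr.
have -> : x = upd x i 0 by rewrite -xi0 upd_id.
apply: cmod_le0 => e e0.
set b := (B + B') / s i in hd.
have b0 : 0 <= b by rewrite divr_ge0 ?(ps_ge0 s_ge0 hd).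
pose t : R := Num.min (s i) (e / (b + 1)).
have t0 : 0 < t by rewrite lt_min s_gt0 divr_gt0 // ltr_wpDl.
have ht : cmod t%:C <= s i.
  by rewrite cmodR gtr0_norm // ge_min lexx.
have /= := ps_lip0 hd hx ht.
have -> : f (upd x i t%:C) = g (upd x i t%:C).
  have t0' : (t%:C : R[i]) != 0 by rewrite -cmod_eq0 cmodR normr_eq0 gt_eqF.
  by apply: (mulfI t0'); have := h _ (pdisc_upd hx ht); rewrite upd_eq.
rewrite subrr sub0r cmodN cmodR gtr0_norm // => /le_trans; apply.
have : t * (b + 1) <= e.
  by rewrite -ler_pdivlMr ?ltr_wpDl // ge_min lexx orbT.
rewrite -/b; nra.
Qed.

(** By cancellation [g] agrees with the quotient from [ps_quot], so its unspecified bound is traded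
    for the sharp one. *)
Lemma ps_divX f g B i : ps s f B -> (exists B', ps s g B') ->
  (forall x, pdisc s x -> f x = x i * g x) -> ps s g (B / s i).
Proof.
move=> hf [B' hg] h; have [q [hq Hq]] := ps_quot i hf.
apply: (ps_le s_ge0 hq (lexx _)) => x hx.
have [B'' hq'] : exists B'', ps s q B'' by exists (B / s i).
apply: (ps_cancelX (i := i) hg hq') hx => {}x hx.
rewrite -h // Hq // h; last by apply: pdisc_upd; rewrite ?cmod0.
by rewrite upd_eq mul0r add0r.
Qed.

(** The pattern of the uniqueness proofs: when the equation satisfied by [f] turns any bound into
    half of it, the modulus of [f] is at most [B / 2 ^ k] for every [k]. *)
Lemma ps_halving f B : ps s f B -> (forall B, ps s f B -> ps s f (B / 2)) ->
  forall x, pdisc s x -> f x = 0.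
Proof.
move=> hf h x hx.
have hk k : ps s f (B * 2^-1 ^+ k).
  elim: k => [|k IH]; first by rewrite mulr1.
  by rewrite exprSr mulrA; apply: h.
apply: cmod_le0 => e e0.
have : (fun k => B * 2^-1 ^+ k) @ \oo --> (0 : R).
  rewrite -(mulr0 B); apply: cvgM; first exact: cvg_cst.
  by apply: cvg_expr; rewrite gtr0_norm // invf_lt1 // ltr1n.
move=> /cvgrPdist_le/(_ _ e0) [N _ /(_ N (leqnn _))] /=.
rewrite sub0r normrN => hN.
by apply: le_trans (ps_bound (hk N) hx) (le_trans (ler_norm _) hN).
Qed.

(** Here [x i * d = - e * d], and dividing by [x i] returns [d] with the bound
    [s i / 2 * B / s i = B / 2]. *)
Lemma ps_unit_uniq e d B i : ps s e (s i / 2) -> ps s d B ->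
  (forall x, pdisc s x -> (x i + e x) * d x = 0) ->
  forall x, pdisc s x -> d x = 0.
Proof.
move=> he hd h; apply: (ps_halving hd) => {hd} {}B hd.
have := ps_opp s_ge0 (ps_mul s_ge0 he hd).
move=> /(ps_divX (g := d) (i := i)) hh.
have -> : B / 2 = s i / 2 * B / s i by field; rewrite gt_eqF.
apply: hh; first by exists B.
by move=> x /h; rewrite mulrDl => /eqP; rewrite addr_eq0 => /eqP ->.
Qed.

End Quotient.

(** * Division and derivatives *)

Section Division.
Variables (R : realType) (I : eqType) (s : I -> R).
Hypothesis s_gt0 : forall i, 0 < s i.
Implicit Types (f g e : (I -> R[i]) -> R[i]) (x : I -> R[i]).

Let s_ge0 i : 0 <= s i. Proof. exact: ltW. Qed.

Lemma sum_half_le (c : R) N : 0 <= c -> \sum_(j < N) c * 2^-1 ^+ j <= 2 * c.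
Proof.
move=> c0; suff -> : \sum_(j < N) c * 2^-1 ^+ j = 2 * c * (1 - 2^-1 ^+ N).
  rewrite ler_piMr ?mulr_ge0 // lerBlDr lerDl exprn_ge0 //.
elim: N => [|N IH]; first by rewrite big_ord0 expr0 subrr mulr0.
by rewrite big_ord_recr /= IH exprS; field.
Qed.

(* Weierstrass division by [x i + e x]: the right-hand side is the remainder, which
   does not depend on [x i]. *)
Lemma ps_wdiv f e B i : ps s f B -> ps s e (s i / 2) ->
  exists q, ps s q (2 * (B / s i)) /\ forall x, pdisc s x ->
    f x - (x i + e x) * q x =
    f (upd x i 0) - (upd x i 0 i + e (upd x i 0)) * q (upd x i 0).
Proof.
move=> hf he; pose b k := B / s i * 2^-1 ^+ k.
have /choice[T hT] (kq : nat * ((I -> R[i]) -> R[i])) : exists q',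
    ps s kq.2 (b kq.1) -> ps s q' (b kq.1.+1) /\ forall x, pdisc s x ->
      - (e x * kq.2 x) = - (e (upd x i 0) * kq.2 (upd x i 0)) + x i * q' x.
  case: kq => k q /=; have [hq|hq] := pselect (ps s q (b k)); last first.
    by exists (fun=> 0).
  have [q' [hq' Hq']] := ps_quot s_gt0 i (ps_opp s_ge0 (ps_mul s_ge0 he hq)).
  exists q' => _; split => //; apply: (ps_le s_ge0 hq') => //.
  suff -> : s i / 2 * b k / s i = b k.+1 by [].
  by rewrite /b exprS; field; rewrite gt_eqF.
have [q0 [hq0 Hq0]] := ps_quot s_gt0 i hf.
(* Neumann series: [Q k.+1] is the quotient of [- e * Q k] by [x i]. The bounds halve at each step,
   and the sum of the [Q k] is the sought quotient by [x i + e]. *)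
pose Q := fix Q k := if k is k'.+1 then T (k', Q k') else q0.
have hQ k : ps s (Q k) (b k).
  elim: k => [|k IH]; first by rewrite /b expr0 mulr1.
  exact: (proj1 (hT (k, Q k) IH)).
have HQ k := proj2 (hT (k, Q k) (hQ k)).
have [N|q [hq Hq]] := ps_series (b := 2 * (B / s i)) hQ.
  by apply: sum_half_le; apply: divr_ge0 => //; exact: ps_ge0 hf.
exists q; split=> // x hx.
have hx0 : pdisc s (upd x i 0) by apply: pdisc_upd; rewrite ?cmod0.
pose x0 := upd x i 0.
pose r N y := f y + (- (y i + e y)) * \sum_(j < N) Q j y.
have hr y : pdisc s y -> clim (r ^~ y) (f y - (y i + e y) * q y).
  move=> hy; rewrite -mulNr; apply: climD; first exact: clim_cst.
  by apply: climM; exact: Hq.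
have hr' : clim (fun N => r N x + (-1) * r N x0)
    (f x - (x i + e x) * q x - (f x0 - (x0 i + e x0) * q x0)).
  rewrite -[- (f x0 - _)]mulN1r; apply: climD; first exact: hr.
  by apply: climM; exact: hr.
apply/eqP; rewrite -subr_eq0; apply/eqP; apply: (clim_unique hr').
apply: (@clim_le _ _ _ (fun k => s i * b k)) => [N|]; last first.
  rewrite -(mulr0 (s i)); apply: cvgM; first exact: cvg_cst.
  rewrite -(mulr0 (B / s i)); apply: cvgM; first exact: cvg_cst.
  by apply: cvg_expr; rewrite gtr0_norm // invf_lt1 // ltr1n.
(* By telescoping, the truncated remainders at [x] and at [x0] differ by a single term, which tends
   to 0. *)
have -> : r N x + (-1) * r N x0 = x i * Q N x.
  rewrite /r /x0 upd_eq; elim: N => [|N IH].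
    by rewrite !big_ord0 !mulr0 !addr0 (Hq0 _ hx) /=; ring.
  rewrite !big_ord_recr /=.
  transitivity (x i * Q N x - (x i * Q N x) - e x * Q N x
    + e (upd x i 0) * Q N (upd x i 0)); first by rewrite -{1}IH; ring.
  by move: (HQ N _ hx) => /= hN; rewrite subrr sub0r hN; ring.
rewrite subr0 cmodM; apply: ler_pM; rewrite ?cmod_ge0 //.
exact: (ps_bound (hQ N)).
Qed.

(** Equating the values of [h] at [x] and at [upd x i 0] shows that [x i * g x] is minus the
    increment of [e * g] between these points. So [g] is minus the quotient of [e * g] by [x i], and
    its bound halves. *)
Lemma ps_wuniq h e g B i : ps s e (s i / 2) -> ps s g B ->
  (forall x, pdisc s x -> h x = (x i + e x) * g x) ->
  (forall x, pdisc s x -> h x = h (upd x i 0)) ->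
  forall x, pdisc s x -> h x = 0.
Proof.
move=> he hg hh hi x hx.
suff g0 : forall x, pdisc s x -> g x = 0 by rewrite hh // g0 // mulr0.
apply: (ps_halving hg) => {hx}{x} {B hg} B hg.
have := ps_mul s_ge0 he hg => /(ps_quot s_gt0 i)[q [hq Hq]].
have {}hq := ps_opp s_ge0 hq.
have hE x : pdisc s x -> g x = - q x.
  apply: (ps_cancelX s_gt0 (i := i) hg hq) => {}x hx.
  have hx0 : pdisc s (upd x i 0) by apply: pdisc_upd; rewrite ?cmod0.
  have := Hq _ hx; have := hi _ hx; rewrite hh // hh // upd_eq.
  rewrite mulrDl add0r => h1 h2.
  have -> : x i * g x = e (upd x i 0) * g (upd x i 0) - e x * g x.
    by rewrite -h1; ring.
  by rewrite h2; ring.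
apply: (ps_le s_ge0 hq) => //.
suff -> : s i / 2 * B / s i = B / 2 by [].
by field; rewrite gt_eqF.
Qed.

(** Divide [f1] and [e2] by [x i + e1], with remainders [r] and [r'] independent of [x i]. The
    hypothesis makes [(x j + r') * r] a multiple of [x i + e1]; being independent of [x i], it
    vanishes, and so does [r] because [x j + r'] is not a zero divisor. *)
Lemma ps_div f1 f2 e1 e2 B B2 i j : i != j ->
  ps s e1 (s i / 2) -> ps s e2 (s j / 8) -> ps s f1 B -> ps s f2 B2 ->
  (forall x, pdisc s x -> f1 x * (x j + e2 x) = f2 x * (x i + e1 x)) ->
  exists q, ps s q (2 * (B / s i)) /\
    forall x, pdisc s x -> f1 x = (x i + e1 x) * q x.
Proof.
move=> ij he1 he2 hf1 hf2 hE.
have [q [hq Hq]] := ps_wdiv hf1 he1.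
have [q2 [hq2 Hq2]] := ps_wdiv he2 he1.
exists q; split=> // x hx; apply/eqP; rewrite -subr_eq0; apply/eqP.
move: x hx; pose r x := f1 x - (x i + e1 x) * q x.
pose r' x := e2 x - (x i + e1 x) * q2 x.
have hu := ps_add s_ge0 (ps_X s_ge0 i) he1.
have hr := ps_sub s_ge0 hf1 (ps_mul s_ge0 hu hq).
(* The origin of the 8: [s j / 8 + (3 / 2 * s i) * (2 * (s j / 8) / s i) = s j / 2], exactly what
   [ps_unit_uniq] tolerates. *)
have hr' : ps s r' (s j / 2).
  apply: (ps_le s_ge0 (ps_sub s_ge0 he2 (ps_mul s_ge0 hu hq2))) => //.
  by rewrite le_eqVlt; apply/orP; left; apply/eqP; field; rewrite gt_eqF.
apply: (@ps_unit_uniq _ _ _ s_gt0 r' r _ j hr' hr) => x hx.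
have huj := ps_add s_ge0 (ps_X s_ge0 j) he2.
have hG := ps_sub s_ge0 (ps_sub s_ge0 hf2 (ps_mul s_ge0 huj hq))
  (ps_mul s_ge0 hq2 hr).
apply: (ps_wuniq (h := fun x => (x j + r' x) * r x) he1 hG) hx => {}x hx.
  have := hE _ hx; rewrite /r /r' => h.
  transitivity (f1 x * (x j + e2 x) - (x j + e2 x) * (x i + e1 x) * q x
    - (x i + e1 x) * q2 x * (f1 x - (x i + e1 x) * q x)); first by ring.
  by rewrite h; ring.
have hxj : upd x i 0 j = x j by rewrite /upd eq_sym (negPf ij).
have h1 : r' x = r' (upd x i 0) by exact: Hq2.
have h2 : r x = r (upd x i 0) by exact: Hq.
by rewrite hxj -h1 -h2.
Qed.

End Division.

(** * Complex gradients, Cauchy's estimate and mixed derivatives *)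

Section Gradient.
Variables (R : realType) (I : finType).
Implicit Types (f g : (I -> R[i]) -> R[i]) (x h a : I -> R[i]).

Lemma fin_pos_lb (T : finType) (s : T -> R) : (forall i, 0 < s i) ->
  exists d : R, 0 < d /\ forall i, d <= s i.
Proof.
move=> s0.
suff [d [d0 hd]] : exists d, 0 < d /\ forall i, i \in enum T -> d <= s i.
  by exists d; split=> // i; apply: hd; rewrite mem_enum.
elim: (enum T) => [|k l [d [d0 hd]]]; first by exists 1.
exists (Num.min d (s k)); split; first by rewrite lt_min d0 s0.
move=> i; rewrite inE => /orP[/eqP ->|/hd h]; first by rewrite ge_min lexx orbT.
by rewrite ge_min h.
Qed.

(** The coordinates are set to zero one after the other, each contributing one quotient. Iterating
    this on the [q j] gives Taylor expansions of higher order. *)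
Lemma ps_taylor1 (s : I -> R) f B : (forall i, 0 < s i) -> ps s f B ->
  exists q : I -> _, (forall j, ps s (q j) (B / s j)) /\
    forall x, pdisc s x -> f x = f (fun=> 0) + \sum_j x j * q j x.
Proof.
move=> s0 hf; have sge i : 0 <= s i by exact: ltW.
pose z (l : seq I) (x : I -> R[i]) := fun j => if j \in l then 0 else x j.
suff [q [hq Hq]] : exists q : I -> _, (forall j, ps s (q j) (B / s j)) /\
    forall x, pdisc s x ->
      f x = f (z (enum I) x) + \sum_(j <- enum I) x j * q j x.
  exists q; split=> // x /Hq ->; rewrite big_enum; congr (f _ + _).
  by apply/funext => j; rewrite /z mem_enum.
elim: (enum I) (enum_uniq I) => [_|j l IH /= /andP[jl /IH [q [hq Hq]]]].
  exists (fun _ _ => 0); split=> [j|x _]; last by rewrite big_nil addr0.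
  by apply: ps_cstW => //; rewrite cmod0 divr_ge0 // (ps_ge0 sge hf).
have hg : ps s (fun x => f (z l x)) B.
  apply: (ps_comp (h := z l) sge sge hf) => k; rewrite /z.
  by case: (k \in l); [apply: ps_cstW; rewrite ?cmod0|exact: ps_X].
have [q' [hq' Hq']] := ps_quot s0 j hg.
exists (upd q j q'); split=> [k|x hx].
  by rewrite /upd; case: eqP => // ->.
rewrite Hq // big_cons upd_eq Hq' // -!addrA; congr (f _ + _).
  by apply/funext => k; rewrite /z /upd inE; case: (k == j); case: (k \in l).
congr (_ + _); rewrite !big_seq; apply: eq_bigr => k kl.
by rewrite /upd; case: eqP => // kj; rewrite -kj kl in jl.
Qed.

(** Differentiability with a quadratic error, which power series satisfy inside their polydisc and
    which turns sum, product and chain rules into explicit inequalities. The size of [h] enters as a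
    separate bound [m] on its coordinates. *)
Definition is_grad f x a : Prop :=
  exists K d : R, 0 < d /\ forall h m, 0 <= m -> m <= d -> (forall j, cmod (h j) <= m) ->
    cmod (f (fun j => x j + h j) - f x - \sum_j h j * a j) <= K * m ^+ 2.

(** Total, with default 0, so that [pd j f] is again a function of [x] and can be differentiated in
    turn. *)
Definition grad f x : I -> R[i] :=
  if pselect (exists a, is_grad f x a) is left h then projT1 (cid h) else fun=> 0.

Definition pd (j : I) f : (I -> R[i]) -> R[i] := fun x => grad f x j.

Definition unitv (j : I) (t : R[i]) : I -> R[i] := fun k => if k == j then t else 0.

Lemma cmod_unitv j t k : cmod (unitv j t k) <= cmod t.
Proof. by rewrite /unitv; case: eqP; rewrite ?cmod0 ?cmod_ge0. Qed.

Lemma sum_unitv j t (a : I -> R[i]) : \sum_k unitv j t k * a k = t * a j.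
Proof.
rewrite (bigD1 j) //= /unitv eqxx big1 ?addr0 // => k /negPf ->.
by rewrite mul0r.
Qed.

Lemma is_grad_dir f x a j b (C d : R) : 0 < d -> is_grad f x a ->
  (forall t, cmod t <= d ->
    cmod (f (fun k => x k + unitv j t k) - f x - t * b) <= C * cmod t ^+ 2) ->
  a j = b.
Proof.
move=> d0 [K [d' [d'0 H]]] H'.
have C0 : 0 <= C.
  have := le_trans (cmod_ge0 _) (H' d%:C _); rewrite cmodR gtr0_norm // lexx.
  by move=> /(_ isT); rewrite pmulr_lge0 // exprn_gt0.
have K0 : 0 <= K.
  have := le_trans (cmod_ge0 _) (H (fun=> 0) d' (ltW d'0) (lexx _) _); rewrite cmod0.
  by move=> /(_ (fun=> ltW d'0)); rewrite pmulr_lge0 // exprn_gt0.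
apply/eqP; rewrite -subr_eq0; apply/eqP; apply: cmod_le0 => e e0.
pose t := Num.min (Num.min d d') (e / (K + C + 1)).
have k0 : 0 < K + C + 1 by rewrite ltr_wpDl ?addr_ge0.
have t0 : 0 < t by rewrite !lt_min d0 d'0 divr_gt0.
have td : t <= d by rewrite !ge_min lexx.
have td' : t <= d' by rewrite !ge_min lexx orbT.
have ht : cmod (t%:C : R[i]) = t by rewrite cmodR gtr0_norm.
have h1 := H (unitv j t%:C) t (ltW t0) td' _.
have {}h1 : cmod (f (fun k => x k + unitv j t%:C k) - f x - t%:C * a j) <= K * t ^+ 2.
  by rewrite -(sum_unitv j t%:C a); apply: h1 => k; rewrite -{2}ht cmod_unitv.
have h2 := H' t%:C; rewrite ht in h2; have {}h2 := h2 td.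
have : cmod (t%:C * (a j - b)) <= K * t ^+ 2 + C * t ^+ 2.
  set F := f (fun k => x k + unitv j t%:C k) - f x in h1 h2.
  have -> : t%:C * (a j - b) = (F - t%:C * b) - (F - t%:C * a j) by ring.
  by rewrite [leRHS]addrC; apply: cmod_le_sub.
rewrite cmodM ht -mulrDl expr2 mulrCA ler_pM2l // => /le_trans; apply.
have : t * (K + C + 1) <= e by rewrite -ler_pdivlMr // ge_min lexx orbT.
nra.
Qed.

Lemma is_grad_uniq f x a b : is_grad f x a -> is_grad f x b -> a = b.
Proof.
move=> ha [K [d [d0 H]]]; apply/funext => j.
apply: (is_grad_dir (C := K) (d := d) _ ha) => // t ht.
by rewrite -(sum_unitv j t b); apply: H; rewrite ?cmod_ge0 // => k; exact: cmod_unitv.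
Qed.

Lemma gradE f x a : is_grad f x a -> grad f x = a.
Proof.
move=> ha; rewrite /grad; case: pselect => [h|[]]; last by exists a.
exact: is_grad_uniq (projT2 (cid h)) ha.
Qed.

Lemma is_grad_near f g x a (d : R) : 0 < d ->
  (forall h, (forall j, cmod (h j) <= d) ->
    f (fun j => x j + h j) = g (fun j => x j + h j)) ->
  is_grad f x a -> is_grad g x a.
Proof.
move=> d0 E [K [d' [d'0 H]]]; exists K, (Num.min d d'); split.
  by rewrite lt_min d0.
move=> h m m0; rewrite le_min => /andP[md md'] hm.
have Ex : f x = g x.
  have := E (fun=> 0) (fun=> _); rewrite cmod0 => /(_ (fun=> ltW d0)).
  by have -> : (fun j => x j + 0) = x by apply/funext => j; rewrite addr0.
rewrite -E -?Ex; first exact: H.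
by move=> j; apply: le_trans (hm j) md.
Qed.

Lemma is_grad_cst c x : is_grad (fun=> c) x (fun=> 0).
Proof.
exists 0, 1; split=> // h m _ _ _.
by rewrite subrr sub0r cmodN big1 ?cmod0 ?mul0r // => j _; rewrite mulr0.
Qed.

Lemma is_grad_X i x : is_grad (fun x => x i) x (unitv i 1).
Proof.
exists 0, 1; split=> // h m _ _ _.
have -> : \sum_j h j * unitv i 1 j = h i.
  by rewrite (eq_bigr _ (fun j _ => mulrC _ _)) sum_unitv mul1r.
have -> : x i + h i - x i - h i = 0 by ring.
by rewrite cmod0 mul0r.
Qed.

Lemma is_grad_lip f x a : is_grad f x a -> exists L d : R,
  [/\ 0 < d, 0 <= L & forall h m, 0 <= m -> m <= d ->
    (forall j, cmod (h j) <= m) ->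
    cmod (f (fun j => x j + h j) - f x) <= L * m].
Proof.
move=> [K [d [d0 H]]].
have K0 : 0 <= K.
  have := le_trans (cmod_ge0 _) (H (fun=> 0) d (ltW d0) (lexx _) _); rewrite cmod0.
  by move=> /(_ (fun=> ltW d0)); rewrite pmulr_lge0 // exprn_gt0.
have A0 : 0 <= \sum_j cmod (a j) by apply: sumr_ge0 => j _; exact: cmod_ge0.
exists (K * d + \sum_j cmod (a j)), d; split=> //.
  by rewrite addr_ge0 // mulr_ge0 // ltW.
move=> h m m0 md hm.
set S := \sum_j h j * a j.
have -> : f (fun j => x j + h j) - f x = (f (fun j => x j + h j) - f x - S) + S.
  by ring.
rewrite mulrDl; apply: cmod_le_add.
  apply: le_trans (H h m m0 md hm) _; rewrite expr2 mulrA ler_wpM2r //.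
  by rewrite ler_wpM2l.
apply: le_trans (cmod_sum _ _ _) _; rewrite mulr_suml; apply: ler_sum => j _.
by rewrite cmodM mulrC ler_wpM2l // cmod_ge0.
Qed.

Lemma is_grad_lin c c' f g x a b : is_grad f x a -> is_grad g x b ->
  is_grad (fun y => c * f y + c' * g y) x (fun j => c * a j + c' * b j).
Proof.
move=> [K [d [d0 H]]] [K' [d' [d'0 H']]].
exists (cmod c * K + cmod c' * K'), (Num.min d d'); split.
  by rewrite lt_min d0.
move=> h m m0; rewrite le_min => /andP[md md'] hm.
have -> : \sum_j h j * (c * a j + c' * b j) =
    c * (\sum_j h j * a j) + c' * (\sum_j h j * b j).
  by rewrite !mulr_sumr -big_split; apply: eq_bigr => j _ /=; ring.
set fh := f _; set gh := g _; set S := \sum_j _; set S' := \sum_j _.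
have -> : c * fh + c' * gh - (c * f x + c' * g x) - (c * S + c' * S') =
   c * (fh - f x - S) + c' * (gh - g x - S') by ring.
rewrite mulrDl; apply: cmod_le_add; rewrite cmodM -mulrA ler_wpM2l ?cmod_ge0 //.
  exact: H.
exact: H'.
Qed.

Lemma is_gradD f g x a b : is_grad f x a -> is_grad g x b ->
  is_grad (fun y => f y + g y) x (fun j => a j + b j).
Proof.
move=> hf hg; have := is_grad_lin 1 1 hf hg.
congr is_grad; apply/funext => y; first by rewrite !mul1r.
by rewrite !mul1r.
Qed.

Lemma is_gradZ c f x a : is_grad f x a ->
  is_grad (fun y => c * f y) x (fun j => c * a j).
Proof.
move=> hf; have := is_grad_lin c 0 hf hf.
by congr is_grad; apply/funext => y; rewrite mul0r addr0.
Qed.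

Lemma is_grad_sum (T : Type) (r : seq T) (F : T -> _) x (a : T -> I -> R[i]) :
  (forall k, is_grad (F k) x (a k)) ->
  is_grad (fun y => \sum_(k <- r) F k y) x (fun j => \sum_(k <- r) a k j).
Proof.
move=> h; elim: r => [|k r IH].
  have := is_grad_cst 0 x.
  by congr is_grad; apply/funext => y; rewrite big_nil.
by have := is_gradD (h k) IH; congr is_grad; apply/funext => y; rewrite big_cons.
Qed.

Lemma is_gradM f g x a b : is_grad f x a -> is_grad g x b ->
  is_grad (fun y => f y * g y) x (fun j => a j * g x + f x * b j).
Proof.
move=> hf hg; have [L [d1 [d10 L0 HL]]] := is_grad_lip hf.
have [L' [d2 [d20 L'0 HL']]] := is_grad_lip hg.
have [K [d [d0 H]]] := hf; have [K' [d' [d'0 H']]] := hg.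
exists (cmod (g x) * K + cmod (f x) * K' + L * L').
exists (Num.min (Num.min d d') (Num.min d1 d2)); split.
  by rewrite !lt_min d0 d'0 d10.
move=> h m m0; rewrite !le_min => /andP[/andP[md md'] /andP[md1 md2]] hm.
have -> : \sum_j h j * (a j * g x + f x * b j) =
    g x * (\sum_j h j * a j) + f x * (\sum_j h j * b j).
  by rewrite !mulr_sumr -big_split; apply: eq_bigr => j _ /=; ring.
have := HL _ _ m0 md1 hm; have := HL' _ _ m0 md2 hm.
have := H _ _ m0 md hm; have := H' _ _ m0 md' hm.
set fh := f _; set gh := g _; set S := \sum_j _; set S' := \sum_j _.
move=> h1 h2 h3 h4.
have -> : fh * gh - f x * g x - (g x * S' + f x * S) =
   g x * (fh - f x - S') + f x * (gh - g x - S) + (fh - f x) * (gh - g x) by ring.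
rewrite [leRHS]mulrDl [X in _ <= X + _]mulrDl; apply: cmod_le_add; last first.
  have -> : L * L' * m ^+ 2 = (L * m) * (L' * m) by ring.
  by rewrite cmodM ler_pM ?cmod_ge0.
by apply: cmod_le_add; rewrite cmodM -mulrA ler_wpM2l ?cmod_ge0.
Qed.

(** Recentred at [x], [f] is a power series on the polydisc whose radius is the gap between [s'] and
    [s]. Two applications of [ps_taylor1] exhibit the quadratic error. *)
Lemma ps_grad (s s' : I -> R) f B x : (forall i, s' i < s i) -> ps s f B ->
  pdisc s' x -> is_grad f x (grad f x).
Proof.
move=> ss hf hx; suff [a ha] : exists a, is_grad f x a by rewrite (gradE ha).
have [d [d0 hd]] := @fin_pos_lb I (fun i => s i - s' i) (fun i => ltac:(by rewrite subr_gt0)).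
have s'0 i : 0 <= s' i by apply: le_trans (hx i); exact: cmod_ge0.
have s0 i : 0 <= s i by apply: le_trans (ltW (ss i)).
pose r (_ : I) := d.
have r0 i : 0 <= r i by exact: ltW.
have hg : ps r (fun h => f (fun j => x j + h j)) B.
  apply: (ps_comp (h := fun h j => x j + h j) r0 s0 hf) => j.
  apply: (ps_le r0 (ps_add r0 (ps_cstW r0 (hx j)) (ps_X r0 j))) => //.
  by rewrite /r; have := hd j; lra.
have [q [hq Hq]] := ps_taylor1 (fun=> d0) hg.
have /choice[q2 hq2] j := ps_taylor1 (fun=> d0) (hq j).
exists (fun j => q j (fun=> 0)).
exists (\sum_(j : I) \sum_(k : I) B / d / d), d; split=> // h m m0 md hm.
have hh : pdisc r h by move=> j; apply: le_trans (hm j) md.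
have -> : f (fun j => x j + h j) - f x - \sum_j h j * q j (fun=> 0) =
    \sum_j \sum_k h j * (h k * q2 j k h).
  rewrite Hq //; have -> : (fun j => x j + 0) = x.
    by apply/funext => j; rewrite addr0.
  rewrite [f x + _]addrC addrK -sumrB; apply: eq_bigr => j _.
  by rewrite (proj2 (hq2 j)) // mulrDr [_ + h j * _]addrC addrK mulr_sumr.
apply: le_trans (cmod_sum _ _ _) _; rewrite mulr_suml; apply: ler_sum => j _.
apply: le_trans (cmod_sum _ _ _) _; rewrite mulr_suml; apply: ler_sum => k _.
rewrite !cmodM [leRHS]mulrC expr2 -[leRHS]mulrA.
apply: ler_pM; rewrite ?mulr_ge0 ?cmod_ge0 //.
apply: ler_pM; rewrite ?cmod_ge0 //.
exact: (ps_bound (proj1 (hq2 j) k)).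
Qed.

Lemma eq_pd (s s' : I -> R) f g j : (forall i, s' i < s i) ->
  (exists B, ps s f B) -> (forall x, pdisc s x -> f x = g x) ->
  forall x, pdisc s' x -> pd j f x = pd j g x.
Proof.
move=> ss [B hf] E x hx; have ha := ps_grad ss hf hx.
have [d [d0 hd]] := @fin_pos_lb I (fun i => s i - s' i)
  (fun i => ltac:(by rewrite subr_gt0)).
rewrite /pd; congr (_ j); apply/esym/gradE; apply: (is_grad_near d0 _ ha) => h hh.
apply: E => k; have := hx k; have := hh k; have := hd k; have := cmodD (x k) (h k).
lra.
Qed.

(** Cauchy's estimate. An extra variable [None] of radius [tau] is added to coordinate [j]; the
    derivative is the quotient of the increment by that variable, read at 0, whence the bound
    [B / tau]. *)
Lemma ps_pd (s s' : I -> R) f B j (tau : R) :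
  (forall i, 0 < s' i) -> (forall i, s' i < s i) -> 0 < tau ->
  s' j + tau <= s j -> ps s f B -> ps s' (pd j f) (B / tau).
Proof.
move=> s'0 ss tau0 hj hf.
have sge i : 0 <= s i by apply: ltW; apply: lt_trans (ss i).
have s'ge i : 0 <= s' i by exact: ltW.
pose r (o : option I) := if o is Some i then s' i else tau.
have r0 o : 0 < r o by case: o => /=.
have rge o : 0 <= r o by exact: ltW.
pose F y := f (fun k => y (Some k) + unitv j (y None) k).
have hF : ps r F B.
  apply: (ps_comp (h := fun y k => y (Some k) + unitv j (y None) k) rge sge hf) => k.
  rewrite /unitv; case: eqP => [->|_].
    exact: (ps_le rge (ps_add rge (ps_X rge (Some j)) (ps_X rge None))).
  by apply: (ps_le rge (ps_X rge (Some k)) (ltW (ss k))) => y _; rewrite addr0.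
have [q [hq Hq]] := ps_quot r0 None hF.
pose ext (x : I -> R[i]) t (o : option I) := if o is Some k then x k else t.
have hext x t : pdisc s' x -> cmod t <= tau -> pdisc r (ext x t).
  by move=> hx ht o; case: o => [k|] /=; [exact: hx|].
have uext x t : upd (ext x t) None 0 = ext x 0.
  by apply/funext => -[k|].
pose g x := q (ext x 0).
have hg : ps s' g (B / tau).
  apply: (ps_comp (h := fun x => ext x 0) s'ge rge hq) => -[k|] /=.
    exact: ps_X.
  by apply: ps_cstW => //; rewrite cmod0 ltW.
apply: (ps_le s'ge hg) => // x hx.
apply: (is_grad_dir (C := B / tau / tau) tau0 (ps_grad ss hf hx)) => t ht.
have hxt := hext x t hx ht.
have E : F (ext x t) = f (fun k => x k + unitv j t k) by [].
have E0 : F (ext x 0) = f x.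
  rewrite /F; congr (f _); apply/funext => k; rewrite /= /unitv.
  by case: eqP; rewrite addr0.
rewrite -E -E0 Hq // uext /= /g [F _ + _]addrC addrK -mulrBr cmodM.
rewrite expr2 mulrCA ler_wpM2l ?cmod_ge0 // mulrC.
have := ps_lip0 r0 (i := None) hq hxt ht; rewrite uext.
by have -> : upd (ext x t) None t = ext x t by apply/funext => -[].
Qed.

(** Each iterated derivative is the value at 0 of the quotient of a mixed second difference by the
    product of the two increments. Exchanging the increments identifies the two differences, hence
    the two quotients. *)
Lemma pd_comm (s s' : I -> R) f B j k : (forall i, 0 < s' i) ->
  (forall i, s' i < s i) -> ps s f B ->
  forall x, pdisc s' x -> pd j (pd k f) x = pd k (pd j f) x.
Proof.
move=> s'0 ss hf x hx.
have sge i : 0 <= s i by apply: ltW; apply: lt_trans (ss i).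
have [d0 [d00 hd0]] := @fin_pos_lb I (fun i => s i - s' i)
  (fun i => ltac:(by rewrite subr_gt0)).
pose d := d0 / 4; have d0' : 0 < d by rewrite divr_gt0.
pose r (_ : bool) := d; have r0 b : 0 < r b by [].
have rge b : 0 <= r b by exact: ltW.
pose sh j k t t' : I -> R[i] := fun l => x l + unitv j t l + unitv k t' l.
pose s2 i := s' i + d0 / 2.
have s20 i : 0 < s2 i by rewrite addr_gt0 // divr_gt0.
have ss2 i : s2 i < s i by have := hd0 i; rewrite /s2; lra.
have hsh j' k' t t' : cmod t <= d -> cmod t' <= d -> pdisc s2 (sh j' k' t t').
  move=> ht ht' l; rewrite /sh /s2.
  have := hx l; have := cmod_unitv j' t l; have := cmod_unitv k' t' l.
  have := cmodD (x l + unitv j' t l) (unitv k' t' l).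
  have := cmodD (x l) (unitv j' t l); rewrite /d in ht ht'; lra.
have key j' k' : exists q C, [/\ ps r q C,
    forall y, pdisc r y -> f (sh j' k' (y true) (y false)) - f (sh j' k' 0 (y false))
      - f (sh j' k' (y true) 0) + f (sh j' k' 0 0) = y true * (y false * q y) &
    q (fun=> 0) = pd k' (pd j' f) x].
  pose F y := f (sh j' k' (y true) (y false)).
  have hF : ps r F B.
    apply: (ps_comp (h := fun y => sh j' k' (y true) (y false)) rge sge hf) => l.
    rewrite /sh; have h1 b i : ps r (fun y => unitv i (y b) l) d.
      rewrite /unitv; case: (l == i); first exact: ps_X.
      by apply: ps_cstW => //; rewrite cmod0 ltW.
    apply: (ps_le rge (ps_add rge (ps_add rge (ps_cstW rge (hx l)) (h1 true j')) (h1 false k'))) => //.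
    by have := hd0 l; rewrite /d; lra.
  have [q1 [hq1 Hq1]] := ps_quot r0 true hF.
  have [q2 [hq2 Hq2]] := ps_quot r0 false hq1.
  exists q2, (B / d / d); split=> // [y hy|].
    have hy0 : pdisc r (upd y false 0) by apply: pdisc_upd; rewrite ?cmod0.
    have := Hq1 _ hy; have := Hq1 _ hy0; have := Hq2 _ hy.
    rewrite /F !upd_eq /= => h1 h2 h3.
    have e1 : upd (upd y true 0) true = upd y true.
      by apply/funext => t; rewrite upd_upd.
    move: h2 h3; rewrite /upd /= => h2 h3.
    rewrite h2 h3 h1 /upd /=; ring.
  have hpd : ps s2 (pd j' f) (B / d).
    apply: (ps_pd (s := s)) => //; have := hd0 j'; rewrite /s2 /d; lra.
  have s's2 i : s' i < s2 i by rewrite /s2 ltrDl divr_gt0.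
  apply/esym; apply: (is_grad_dir (C := B / d / d / d) d0' (ps_grad s's2 hpd hx)) => t ht.
  pose y t : bool -> R[i] := fun b => if b then 0 else t.
  have hy t' : cmod t' <= d -> pdisc r (y t') by move=> h b; case: b => //=; rewrite cmod0 ltW.
  have E t' : cmod t' <= d -> pd j' f (fun l => x l + unitv k' t' l) = q1 (y t').
    move=> ht'.
    have hx' : pdisc s2 (fun l => x l + unitv k' t' l).
      have := hsh j' k' 0 t'; rewrite cmod0 => /(_ (ltW d0') ht').
      by congr (pdisc s2 _); apply/funext => l; rewrite /sh /unitv; case: eqP; rewrite addr0.
    apply: (is_grad_dir (C := B / d / d) d0' (ps_grad ss2 hf hx')) => u hu.
    pose z := upd (y t') true u.
    have hz : pdisc r z by apply: pdisc_upd => //; exact: hy.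
    have h1 := Hq1 _ hz.
    have e1 : F z = f (fun l => x l + unitv k' t' l + unitv j' u l).
      by rewrite /F; congr (f _); apply/funext => l; rewrite /sh /z /upd /=; ring.
    have zy : upd z true 0 = y t' by apply/funext => -[].
    have e2 : F (upd z true 0) = f (fun l => x l + unitv k' t' l).
      by rewrite zy /F; congr (f _); apply/funext => l; rewrite /sh /= /unitv; case: eqP; rewrite addr0.
    rewrite -e1 -e2 h1 [F _ + _]addrC addrK {1}/z upd_eq -mulrBr cmodM.
    rewrite expr2 mulrCA ler_wpM2l ?cmod_ge0 // mulrC.
    have := ps_lip0 r0 (i := true) hq1 (hy _ ht') hu.
    by rewrite -/z; have -> : upd (y t') true 0 = y t' by apply/funext => -[].
  have E0 := E 0; rewrite cmod0 in E0.
  have {}E0 : pd j' f x = q1 (y 0).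
    rewrite -(E0 (ltW d0')); congr (pd j' f _); apply/funext => l.
    by rewrite /unitv; case: eqP; rewrite addr0.
  rewrite E // E0; have hyt := hy _ ht.
  have := Hq2 _ hyt.
  have -> : upd (y t) false 0 = y 0 by apply/funext => -[].
  move=> ->; rewrite [q1 _ + _]addrC addrK /= -mulrBr cmodM.
  rewrite expr2 mulrCA ler_wpM2l ?cmod_ge0 // mulrC.
  have := ps_lip0 r0 (i := false) hq2 hyt ht.
  have -> : upd (y t) false t = y t by apply/funext => -[].
  by have -> : upd (y t) false 0 = (fun=> 0) by apply/funext => -[].
have [q [C [hq Hq <-]]] := key k j.
have [q' [C' [hq' Hq' <-]]] := key j k.
have hq'2 : ps r (fun y => q' (fun b => y (~~ b))) C'.
  by apply: (ps_comp (h := fun y b => y (~~ b)) rge rge hq') => b; exact: ps_X.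
rewrite -[LHS]/((fun y => q y) (fun=> 0)) -[RHS]/((fun y => q' (fun b => y (~~ b))) (fun=> 0)).
apply: (ps_cancelX r0 (i := false) hq hq'2); last exact: pdisc0.
apply: (ps_cancelX r0 (i := true) (ps_mul rge (ps_X rge false) hq)
  (ps_mul rge (ps_X rge false) hq'2)) => y hy.
rewrite -Hq //.
have hy' : pdisc r (fun b => y (~~ b)) by move=> b; exact: hy.
rewrite mulrCA -(Hq' _ hy') /=.
have E t t' : sh j k t t' = sh k j t' t.
  by apply/funext => l; rewrite /sh; ring.
by rewrite !E; ring.
Qed.

End Gradient.

(** * Identity theorem on real points and fixed points *)

Section Identity.
Variable R : realType.

(** Every successive quotient by [t] vanishes at the nonzero real points, hence at 0 by continuity,
    so one can divide again. With [g = t ^ k * q] and [q] bounded by [B / s i ^ k], the value at [t]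
    is at most [B] times the k-th power of a ratio below 1. *)
Lemma ps_vanish_line (I : eqType) (s : I -> R) f B x i :
  (forall i, 0 < s i) -> ps s f B -> pdisc s x ->
  (forall t : R, `|t| < s i -> f (upd x i t%:C) = 0) ->
  forall t, cmod t < s i -> f (upd x i t) = 0.
Proof.
move=> s0 hf hx h0 t ht.
have sge i' : 0 <= s i' by exact: ltW.
pose r (_ : unit) := s i; have r0 u : 0 < r u by exact: s0.
have rge u : 0 <= r u by exact: ltW.
pose c (t : R[i]) (_ : unit) := t.
pose g y := f (upd x i (y tt)).
have hg : ps r g B.
  apply: (ps_comp (h := fun y => upd x i (y tt)) rge sge hf) => k.
  rewrite /upd; case: eqP => [->|_]; first exact: (ps_X rge tt).
  by apply: ps_cstW.
have key k : exists q, [/\ ps r q (B / s i ^+ k),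
    forall y, pdisc r y -> g y = y tt ^+ k * q y &
    forall t : R, `|t| < s i -> t != 0 -> q (c t%:C) = 0].
  elim: k => [|k [q [hq Hq q0]]].
    exists g; split=> [|y _|t' h' _]; rewrite ?expr0 ?divr1 ?mul1r //.
    by rewrite /g /c h0.
  have [q' [hq' Hq']] := ps_quot r0 tt hq.
  have cu (y : unit -> R[i]) z : upd y tt z = c z by apply/funext => -[].
  have qz : q (c 0) = 0.
    apply: cmod_le0 => e e0; set b := B / s i ^+ k / s i in hq'.
    have b0 : 0 <= b by exact: ps_ge0 hq'.
    pose u : R := Num.min (s i / 2) (e / (b + 1)).
    have u0 : 0 < u by rewrite lt_min !divr_gt0 // ltr_wpDl.
    have us : u < s i by have := s0 i; rewrite /u gt_min; lra.
    have := ps_lip0 r0 (i := tt) (x := c 0) (t := u%:C) hq.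
    rewrite !cu q0 ?gtr0_norm ?gt_eqF // sub0r cmodN cmodR gtr0_norm //.
    move=> h; apply: le_trans (h _ (ltW us)) _; first by move=> ?; rewrite cmod0.
    have : u * (b + 1) <= e.
      by rewrite -ler_pdivlMr ?ltr_wpDl // ge_min lexx orbT.
    rewrite -/b; nra.
  exists q'; split=> [|y hy|t' h' t0].
  - by rewrite exprSr invfM mulrA.
  - by rewrite Hq // Hq' // cu qz add0r exprSr mulrA.
  - have ct : pdisc r (c t'%:C) by move=> ?; rewrite cmodR ltW.
    have := Hq' _ ct; rewrite cu qz add0r q0 // => /esym/eqP.
    rewrite mulf_eq0 => /orP[|/eqP //].
    by rewrite -cmod_eq0 cmodR normr_eq0 (negPf t0).
have hc : pdisc r (c t) by move=> ?; exact: ltW.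
rewrite -[LHS]/(g (c t)); apply: cmod_le0 => e e0.
have : (fun k => B * (cmod t / s i) ^+ k) @ \oo --> (0 : R).
  rewrite -(mulr0 B); apply: cvgM; first exact: cvg_cst.
  apply: cvg_expr; rewrite ger0_norm ?divr_ge0 ?cmod_ge0 //.
  by rewrite ltr_pdivrMr // mul1r.
move=> /cvgrPdist_le/(_ _ e0) [k _ /(_ k (leqnn _))] /=.
rewrite sub0r normrN => hk; have [q [hq Hq _]] := key k.
rewrite Hq // cmodM cmodX; apply: le_trans (le_trans (ler_norm _) hk).
rewrite expr_div_n mulrCA ler_wpM2l ?exprn_ge0 ?cmod_ge0 //.
exact: (ps_bound hq hc).
Qed.

Lemma ps_real_vanish (I : finType) (s : I -> R) f B :
  (forall i, 0 < s i) -> ps s f B ->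
  (forall y : I -> R, (forall i, `|y i| < s i) -> f (fun i => (y i)%:C) = 0) ->
  forall x, (forall i, cmod (x i) < s i) -> f x = 0.
Proof.
move=> s0 hf h.
(* The coordinates in [l] may already be complex, the others are still real; each step of the
   induction frees one coordinate. *)
suff H (l : seq I) x : (forall i, cmod (x i) < s i) ->
    (forall i, i \notin l -> x i = (complex.Re (x i))%:C) -> f x = 0.
  by move=> x hx; apply: (H (enum I)) => // i; rewrite mem_enum.
elim: l x => [x hx hr|j l IH x hx hr].
  have -> : x = (fun i => (complex.Re (x i))%:C) by apply/funext => i; exact: hr.
  by apply: h => i; apply: le_lt_trans (Re_le_cmod _) (hx i).
rewrite -(upd_id x j); apply: (ps_vanish_line s0 hf) => // [i|t ht].
  exact: ltW.
apply: IH => i; rewrite /upd; case: eqP => [->|/eqP ij] //.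
- by rewrite cmodR.
- by move=> il; apply: hr; rewrite inE negb_or ij.
Qed.

Definition rpt (n : nat) (z : 'I_n -> R[i]) (i : 'I_n + 'I_n) : R[i] :=
  match i with inl k => z k | inr k => (z k)^* end.

(** The linear change [(a + 'i * b, a - 'i * b)] carries real points to the points [rpt z]. Staying
    within [d] allows [a] and [b] the radius [d / 2] each, hence the loss. *)
Lemma ps_conj_vanish n (d : R) (f : ('I_n + 'I_n -> R[i]) -> R[i]) B :
  0 < d -> ps (fun=> d) f B ->
  (forall z : 'I_n -> R[i], (forall k, cmod (z k) < d) -> f (rpt z) = 0) ->
  forall x, (forall i, cmod (x i) < d / 2) -> f x = 0.
Proof.
move=> d0 hf h.
pose L (y : 'I_n + 'I_n -> R[i]) i := match i with
  | inl k => y (inl k) + 'i * y (inr k) | inr k => y (inl k) - 'i * y (inr k) end.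
pose r (_ : 'I_n + 'I_n) := d / 2.
have r0 i : 0 < r i by rewrite divr_gt0.
have rge i : 0 <= r i by exact: ltW.
have hg : ps r (fun y => f (L y)) B.
  apply: (ps_comp (h := L) rge _ hf) => [i|i]; first exact: ltW.
  have hb k : ps r (fun y => 'i * y (inr k)) (d / 2).
    by have := ps_scale rge 'i (ps_X rge (inr k)); rewrite cmodi mul1r.
  rewrite (splitr d); case: i => k.
    exact: (ps_add rge (ps_X rge (inl k)) (hb k)).
  exact: (ps_sub rge (ps_X rge (inl k)) (hb k)).
have H := ps_real_vanish r0 hg _.
move=> x hx.
pose y (i : 'I_n + 'I_n) := match i with
  | inl k => (x (inl k) + x (inr k)) / 2
  | inr k => - 'i * (x (inl k) - x (inr k)) / 2 end.
have -> : x = L y.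
  have i2 : ('i * 'i : R[i]) = -1 by rewrite -expr2 sqr_i.
  apply/funext => -[k|k]; rewrite /L /y.
    transitivity ((x (inl k) + x (inr k)) / 2 - ('i * 'i) * (x (inl k) - x (inr k)) / 2).
      by rewrite i2; field.
    by ring.
  transitivity ((x (inl k) + x (inr k)) / 2 + ('i * 'i) * (x (inl k) - x (inr k)) / 2).
    by rewrite i2; field.
  by ring.
have c2 : cmod (2 : R[i])^-1 = 2^-1 by rewrite cmodV cmod_nat.
apply: H => [u hu|i].
  pose z k := (u (inl k))%:C + 'i * (u (inr k))%:C.
  have -> : L (fun i => (u i)%:C) = rpt z.
    apply/funext => -[k|k] //=.
    by apply/eqP; rewrite eq_complex /=; apply/andP; split; apply/eqP; ring.
  apply: h => k; apply: le_lt_trans (cmodD _ _) _.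
  rewrite cmodM cmodi mul1r !cmodR (splitr d).
  by apply: ltrD; apply: hu.
case: i => k; rewrite /y /r.
  rewrite cmodM c2 ltr_pM2r //.
  by apply: le_lt_trans (cmodD _ _) _; rewrite (splitr d) ltrD.
rewrite mulNr mulNr cmodN -mulrA cmodM cmodi mul1r cmodM c2 ltr_pM2r //.
by apply: le_lt_trans (cmodD _ _) _; rewrite cmodN (splitr d) ltrD.
Qed.

End Identity.

(** * Analytic fixed points by contraction in the coefficient norm *)

Section FixedPoint.
Variable R : realType.

(** The segment from [h'] to [h] is parametrised by an extra variable of radius [tau = d / (2 * e)],
    the largest with [d / 2 + tau * e <= d]. Since [1 <= tau], the quotient by that variable may be
    read at 1, where it is the difference, with bound [B / tau]. *)
Lemma ps_lip (I J : eqType) (s : I -> R) (d e : R) (f : (J -> R[i]) -> R[i]) B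
    (h h' : (I -> R[i]) -> J -> R[i]) :
  (forall i, 0 < s i) -> 0 < e -> e <= d / 2 -> ps (fun=> d) f B ->
  (forall j, ps s (fun x => h' x j) (d / 2)) ->
  (forall j, ps s (fun x => h x j - h' x j) e) ->
  ps s (fun x => f (h x) - f (h' x)) (B * (2 * e / d)).
Proof.
move=> s0 e0 ed hf hh' hd; have sge i : 0 <= s i by exact: ltW.
have d0 : 0 < d by lra.
pose tau := d / (2 * e).
have tau0 : 0 < tau by rewrite divr_gt0 ?mulr_gt0.
pose r (o : option I) := if o is Some i then s i else tau.
have r0 o : 0 < r o by case: o => /=.
have rge o : 0 <= r o by exact: ltW.
pose ext (t : R[i]) (x : I -> R[i]) (o : option I) := if o is Some i then x i else t.
pose F (y : option I -> R[i]) := f (fun j => h' (fun i => y (Some i)) j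
   + y None * (h (fun i => y (Some i)) j - h' (fun i => y (Some i)) j)).
have lift_ps g C : ps s g C -> ps r (fun y => g (fun i => y (Some i))) C.
  move=> hg; apply: (ps_comp (h := fun y i => y (Some i)) rge sge hg) => i.
  exact: (ps_X rge (Some i)).
have hF : ps r F B.
  apply: (ps_comp (h := fun y j => h' (fun i => y (Some i)) j
   + y None * (h (fun i => y (Some i)) j - h' (fun i => y (Some i)) j)) rge _ hf).
    by move=> _; exact: ltW.
  move=> j; apply: (ps_le rge (ps_add rge (lift_ps _ _ (hh' j))
    (ps_mul rge (ps_X rge None) (lift_ps _ _ (hd j))))) => //.
  by rewrite /r /tau le_eqVlt; apply/orP; left; apply/eqP; field; rewrite gt_eqF.
have [q [hq Hq]] := ps_quot r0 None hF.
have hq1 : ps s (fun x => q (ext 1 x)) (B / tau).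
  apply: (ps_comp (h := ext 1) sge rge hq) => -[i|]; first exact: ps_X.
  apply: ps_cstW => //; rewrite cmod1 /r /tau ler_pdivlMr ?mulr_gt0 //; lra.
apply: (ps_le sge hq1) => [|x hx].
  by rewrite /tau le_eqVlt; apply/orP; left; apply/eqP; field; rewrite !gt_eqF.
have hx1 : pdisc r (ext 1 x).
  move=> [i|]; first exact: hx.
  by rewrite cmod1 /r /tau ler_pdivlMr ?mulr_gt0 //; lra.
have -> : f (h x) = F (ext 1 x).
  by congr (f _); apply/funext => j; rewrite /= mul1r addrC subrK.
have -> : f (h' x) = F (upd (ext 1 x) None 0).
  by congr (f _); apply/funext => j; rewrite /= upd_eq mul0r addr0.
by rewrite Hq // [F _ + _]addrC addrK mul1r.
Qed.

Definition jn (I T : Type) (x : I -> R[i]) (a : T -> R[i]) (k : I + T) : R[i] :=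
  match k with inl i => x i | inr b => a b end.

Section Solve.
Variables (I T : eqType) (N : T -> (I + T -> R[i]) -> R[i]) (d eta : R).
Hypotheses (d0 : 0 < d) (eta0 : 0 < eta) (etad : eta <= d / 8).
Hypothesis hN : forall b, ps (fun=> d) (N b) eta.

Let s (_ : I) := d / 2.
Let s0 i : 0 < s i. Proof. by rewrite divr_gt0. Qed.
Let sge i : 0 <= s i. Proof. exact: ltW. Qed.

Lemma fix_lip (h h' : (I -> R[i]) -> T -> R[i]) (e : R) b : 0 < e -> e <= d / 2 ->
  (forall b, ps s (fun x => h' x b) (d / 2)) ->
  (forall b, ps s (fun x => h x b - h' x b) e) ->
  ps s (fun x => N b (jn x (h x)) - N b (jn x (h' x))) (e / 2).
Proof.
have [d_gt0 eta_gt0 eta_le] := And3 d0 eta0 etad.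
move=> e0 ed hh' hd.
have H := ps_lip (h := fun x => jn x (h x)) (h' := fun x => jn x (h' x)) s0 e0 ed (hN b).
have {}H : ps s (fun x => N b (jn x (h x)) - N b (jn x (h' x))) (eta * (2 * e / d)).
  apply: H => -[i|c] //=; first exact: ps_X.
  by apply: (ps_le sge (ps_cstW sge (c := 0) (B := e) _)) => [|//|x _];
     rewrite ?subrr ?cmod0 ?ltW.
apply: (ps_le sge H) => //.
have : eta / d <= 1 / 8 by rewrite ler_pdivrMr //; lra.
have -> : eta * (2 * e / d) = eta / d * (2 * e) by field; rewrite gt_eqF.
nra.
Qed.

Lemma fix_lip_pt x (a a' : T -> R[i]) (e : R) b : pdisc s x -> 0 < e -> e <= d / 2 ->
  (forall b, cmod (a' b) <= d / 2) -> (forall b, cmod (a b - a' b) <= e) ->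
  cmod (N b (jn x a) - N b (jn x a')) <= e / 2.
Proof.
have [d_gt0 eta_gt0 eta_le] := And3 d0 eta0 etad.
move=> hx e0 ed ha' hd.
have := fix_lip (h := fun=> a) (h' := fun=> a') b e0 ed.
move=> /(_ (fun b => ps_cstW sge (ha' b)) (fun b => ps_cstW sge (hd b))).
by move=> /ps_bound; apply.
Qed.

(** Iteration from 0. Since [eta <= d / 8], substitution into [N] at least halves distances in the
    coefficient norm, so the limit is again a power series. *)
Lemma ps_fixpoint : exists g : T -> (I -> R[i]) -> R[i],
  (forall b, ps s (g b) (2 * eta)) /\
  forall x, pdisc s x -> forall b, g b x = N b (jn x (g ^~ x)).
Proof.
have [d_gt0 eta_gt0 eta_le] := And3 d0 eta0 etad.
pose G := fix G k : (I -> R[i]) -> T -> R[i] :=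
  if k is k'.+1 then fun x b => N b (jn x (G k' x)) else fun _ _ => 0.
have hG k b : ps s (fun x => G k x b) eta.
  elim: k b => [|k IH] b; first by apply: ps_cstW => //; rewrite cmod0 ltW.
  apply: (ps_comp (h := fun x => jn x (G k x)) sge _ (hN b)) => [_|]; first exact: ltW.
  move=> [i|c] /=.
    by apply: (ps_le sge (ps_X sge i)) => //; rewrite /s; lra.
  by apply: (ps_le sge (IH c)) => //; lra.
have hD k b : ps s (fun x => G k.+1 x b - G k x b) (eta * 2^-1 ^+ k).
  elim: k b => [|k IH] b.
    apply: (ps_le sge (hG 1%N b)) => [|x _]; rewrite ?expr0 ?mulr1 //=.
    by rewrite subr0.
  rewrite exprSr mulrA; apply: (fix_lip (h := G k.+1) (h' := G k)) => //.
  - by rewrite mulr_gt0 // exprn_gt0 // invr_gt0.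
  - have : (2^-1 : R) ^+ k <= 1 by rewrite exprn_ile1 ?invr_ge0 // invf_le1 // ler1n.
    nra.
  - by move=> c; apply: (ps_le sge (hG k c)) => //; lra.
have /choice[g hg] b : exists g, ps s g (2 * eta) /\
    forall x, pdisc s x -> clim (fun n => G n x b) (g x).
  have [n|g [h1 h2]] := ps_series (b := 2 * eta) (hD ^~ b).
    by apply: sum_half_le; exact: ltW.
  exists g; split=> // x /h2; apply: eq_clim => n.
  elim: n => [|n IH]; first by rewrite big_ord0.
  by rewrite big_ord_recr /= IH addrC subrK.
exists g; split=> [b|x hx b]; first exact: (proj1 (hg b)).
have hgx c := proj2 (hg c) x hx.
(* The tail bound makes the convergence uniform in [b]. *)
have tail n c : cmod (G n x c - g c x) <= 2 * (eta * 2^-1 ^+ n).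
  have := clim_bound (u := fun m => G n x c - G (n + m)%N x c) (l := G n x c - g c x).
  apply.
    have := climD (clim_cst (G n x c)) (climM (-1) (clim_shift n (hgx c))).
    by rewrite mulN1r; apply: eq_clim => m; rewrite mulN1r.
  move=> m; apply: le_trans (sum_half_le m _); last first.
    by rewrite mulr_ge0 ?exprn_ge0 ?invr_ge0 // ltW.
  elim: m => [|m IH]; first by rewrite addn0 subrr cmod0 big_ord0.
  rewrite big_ord_recr /= addnS.
  have -> : G n x c - G (n + m).+1 x c =
     (G n x c - G (n + m)%N x c) - (G (n + m).+1 x c - G (n + m)%N x c) by ring.
  apply: cmod_le_sub IH _; rewrite -mulrA -exprD.
  exact: (ps_bound (hD (n + m)%N c) hx).
apply: (clim_unique (hgx b)) => e e0.
have : (fun k => eta * 2^-1 ^+ k) @ \oo --> (0 : R).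
  rewrite -(mulr0 eta); apply: cvgM; first exact: cvg_cst.
  by apply: cvg_expr; rewrite gtr0_norm // invf_lt1 // ltr1n.
move=> /cvgrPdist_le/(_ _ e0) [M _ hM]; exists M.+1 => -[//|n] nM.
have := hM n nM; rewrite sub0r normrN => he.
apply: le_trans (le_trans (ler_norm _) he).
have pos : 0 < eta * 2^-1 ^+ n by rewrite mulr_gt0 // exprn_gt0 // invr_gt0.
have le1 : (2^-1 : R) ^+ n <= 1 by rewrite exprn_ile1 ?invr_ge0 // invf_le1 // ler1n.
have -> : eta * 2^-1 ^+ n = 2 * (eta * 2^-1 ^+ n) / 2 by field.
apply: fix_lip_pt => //; first by rewrite mulr_gt0.
  by nra.
move=> c; apply: le_trans (ps_bound (proj1 (hg c)) hx) _; lra.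
Qed.

(** Stated at a single point, with plain values [a] and [a']: it will match a graph not yet known to
    be analytic with the power series solution. *)
Lemma fixpoint_uniq (x : I -> R[i]) (a a' : T -> R[i]) : pdisc s x ->
  (forall b, cmod (a b) <= d / 4) -> (forall b, cmod (a' b) <= d / 4) ->
  (forall b, a b = N b (jn x a)) -> (forall b, a' b = N b (jn x a')) ->
  a = a'.
Proof.
have [d_gt0 eta_gt0 eta_le] := And3 d0 eta0 etad.
move=> hx ha ha' Ha Ha'; apply/funext => b.
apply/eqP; rewrite -subr_eq0; apply/eqP; apply: cmod_le0 => e e0.
have H k c : cmod (a c - a' c) <= d / 2 * 2^-1 ^+ k.
  elim: k c => [|k IH] c.
    have := cmod_le_sub (ha c) (ha' c); rewrite expr0; lra.
  rewrite Ha Ha' exprSr mulrA; apply: fix_lip_pt => //.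
  - by rewrite mulr_gt0 ?divr_gt0 // exprn_gt0 // invr_gt0.
  - have : (2^-1 : R) ^+ k <= 1 by rewrite exprn_ile1 ?invr_ge0 // invf_le1 // ler1n.
    nra.
  - by move=> c'; have := ha' c'; lra.
have : (fun k => d / 2 * 2^-1 ^+ k) @ \oo --> (0 : R).
  rewrite -(mulr0 (d / 2)); apply: cvgM; first exact: cvg_cst.
  by apply: cvg_expr; rewrite gtr0_norm // invf_lt1 // ltr1n.
move=> /cvgrPdist_le/(_ _ e0) [k _ /(_ k (leqnn _))] /=.
rewrite sub0r normrN => hk.
exact: le_trans (H k b) (le_trans (ler_norm _) hk).
Qed.

End Solve.
End FixedPoint.

(** * Velocities of curves *)

Section Velocity.
Variable R : realType.

Definition has_vel (c : R -> R[i]) (t : R) (v : R[i]) : Prop :=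
  forall e : R, 0 < e -> exists d : R, 0 < d /\ forall h : R, `|h| <= d ->
    cmod (c (t + h) - c t - h%:C * v) <= e * `|h|.

Lemma has_vel_grad (I : finType) (f : (I -> R[i]) -> R[i]) (y : R -> I -> R[i])
    t v a : is_grad f (y t) a -> (forall j, has_vel (y ^~ j) t (v j)) ->
  has_vel (fun u => f (y u)) t (\sum_j v j * a j).
Proof.
move=> [K [d [d0 Hf]]] hv e e0.
pose A := \sum_j cmod (a j); pose V := \sum_j cmod (v j) + 1.
have A0 : 0 <= A by apply: sumr_ge0 => j _; exact: cmod_ge0.
have V0 : 0 < V by rewrite ltr_wpDl // sumr_ge0 // => j _; exact: cmod_ge0.
have K0 : 0 <= K.
  have := le_trans (cmod_ge0 _) (Hf (fun=> 0) d (ltW d0) (lexx _) _); rewrite cmod0.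
  by move=> /(_ (fun=> ltW d0)); rewrite pmulr_lge0 // exprn_gt0.
pose e' := Num.min 1 (e / 2 / (A + 1)).
have A1 : 0 < A + 1 by rewrite ltr_wpDl.
have e'0 : 0 < e' by rewrite lt_min ltr01 !divr_gt0.
have e'1 : e' <= 1 by rewrite ge_min lexx.
have e'A : e' * A <= e / 2.
  have : e' * (A + 1) <= e / 2 by rewrite -ler_pdivlMr // ge_min lexx orbT.
  nra.
have /choice[D hD] j : exists d, 0 < d /\ forall h : R, `|h| <= d ->
    cmod (y (t + h) j - y t j - h%:C * v j) <= e' * `|h| by exact: hv.
have [d1 [d10 hd1]] := fin_pos_lb (fun j => proj1 (hD j)).
have KV0 : 0 < K * V ^+ 2 + 1 by rewrite ltr_wpDl // mulr_ge0 // exprn_ge0 // ltW.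
exists (Num.min d1 (Num.min (d / V) (e / 2 / (K * V ^+ 2 + 1)))); split.
  by rewrite !lt_min d10 !divr_gt0.
move=> h; rewrite !le_min => /andP[h1 /andP[h2 h3]].
pose dy j := y (t + h) j - y t j.
have hj j : cmod (dy j - h%:C * v j) <= e' * `|h|.
  by apply: (proj2 (hD j)); apply: le_trans h1 (hd1 j).
have vV j : cmod (v j) + 1 <= V.
  rewrite lerD2r (bigD1 j) //= lerDl; apply: sumr_ge0 => k _; exact: cmod_ge0.
have hdy j : cmod (dy j) <= V * `|h|.
  have -> : dy j = (dy j - h%:C * v j) + h%:C * v j by rewrite subrK.
  apply: le_trans (cmod_le_add (hj j) (lexx _)) _.
  rewrite cmodM cmodR.
  have -> : e' * `|h| + `|h| * cmod (v j) = (e' + cmod (v j)) * `|h| by ring.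
  rewrite ler_wpM2r //.
  by have := vV j; lra.
have Vh : V * `|h| <= d by move: h2; rewrite ler_pdivlMr // mulrC.
have Vh0 : 0 <= V * `|h| by rewrite mulr_ge0 // ltW.
have hmain := Hf dy (V * `|h|) Vh0 Vh hdy.
have E : (fun j => y t j + dy j) = y (t + h).
  by apply/funext => j; rewrite /dy addrC subrK.
rewrite E in hmain.
have -> : f (y (t + h)) - f (y t) - h%:C * (\sum_j v j * a j) =
   (f (y (t + h)) - f (y t) - \sum_j dy j * a j)
   + \sum_j (dy j - h%:C * v j) * a j.
  rewrite mulr_sumr.
  have -> : \sum_j (dy j - h%:C * v j) * a j =
     \sum_j dy j * a j - \sum_j h%:C * (v j * a j).
    by rewrite -sumrB; apply: eq_bigr => j _; ring.
  by ring.
have -> : e * `|h| = e / 2 * `|h| + e / 2 * `|h| by field.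
apply: cmod_le_add.
  apply: le_trans hmain _; rewrite exprMn expr2 mulrA mulrA ler_wpM2r //.
  have : `|h| * (K * V ^+ 2 + 1) <= e / 2 by rewrite -ler_pdivlMr.
  have := normr_ge0 h; nra.
apply: le_trans (cmod_sum _ _ _) _.
apply: (@le_trans _ _ (\sum_j (e' * `|h|) * cmod (a j))).
  by apply: ler_sum => j _; rewrite cmodM ler_wpM2r ?cmod_ge0.
rewrite -mulr_sumr -/A mulrAC ler_wpM2r //.
Qed.

Lemma has_velM k c t v : has_vel c t v -> has_vel (fun u => k * c u) t (k * v).
Proof.
move=> h e e0.
have k1 : 0 < cmod k + 1 by rewrite ltr_wpDl ?cmod_ge0.
have [d [d0 H]] := h _ (divr_gt0 e0 k1).
exists d; split=> // u /H hu.
have -> : k * c (t + u) - k * c t - u%:C * (k * v) =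
   k * (c (t + u) - c t - u%:C * v) by ring.
rewrite cmodM; apply: le_trans (ler_wpM2l (cmod_ge0 k) hu) _.
rewrite mulrA ler_wpM2r // mulrA ler_pdivrMr // mulrC ler_wpM2l ?ltW //; lra.
Qed.

Lemma has_velD c c' t v v' : has_vel c t v -> has_vel c' t v' ->
  has_vel (fun u => c u + c' u) t (v + v').
Proof.
move=> h h' e e0; have e2 : 0 < e / 2 by rewrite divr_gt0.
have [d [d0 H]] := h _ e2; have [d' [d'0 H']] := h' _ e2.
exists (Num.min d d'); split; first by rewrite lt_min d0.
move=> u; rewrite le_min => /andP[/H hu /H' hu'].
have -> : c (t + u) + c' (t + u) - (c t + c' t) - u%:C * (v + v') =
   (c (t + u) - c t - u%:C * v) + (c' (t + u) - c' t - u%:C * v') by ring.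
by rewrite (splitr e) mulrDl; apply: cmod_le_add.
Qed.

Lemma has_vel_cst a t : has_vel (fun=> a) t 0.
Proof.
move=> e e0; exists 1; split=> // h _.
by rewrite subrr mulr0 subrr cmod0 mulr_ge0 // ltW.
Qed.

Lemma has_vel_id t : has_vel (fun u => u%:C) t 1.
Proof.
move=> e e0; exists 1; split=> // h _.
have -> : (t + h)%:C - t%:C - h%:C * 1 = 0 :> R[i] by rewrite rmorphD /=; ring.
by rewrite cmod0 mulr_ge0 // ltW.
Qed.

Lemma has_vel_affine a v t : has_vel (fun u => a + u%:C * v) t v.
Proof.
rewrite -[X in has_vel _ _ X]add0r; apply: has_velD; first exact: has_vel_cst.
have := has_velM v (has_vel_id t); rewrite mulr1.
by congr has_vel; apply/funext => u; rewrite mulrC.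
Qed.

Lemma has_vel_sum (T : Type) (r : seq T) (c : T -> R -> R[i]) t v :
  (forall k, has_vel (c k) t (v k)) ->
  has_vel (fun u => \sum_(k <- r) c k u) t (\sum_(k <- r) v k).
Proof.
move=> h; elim: r => [|k r IH].
  rewrite big_nil; have := has_vel_cst 0 t.
  by congr has_vel; apply/funext => u; rewrite big_nil.
rewrite big_cons; have := has_velD (h k) IH.
by congr has_vel; apply/funext => u; rewrite big_cons.
Qed.

Lemma has_vel_conj c t v : has_vel c t v -> has_vel (fun u => (c u)^*) t v^*.
Proof.
move=> h e /h [d [d0 H]]; exists d; split=> // u /H hu.
have -> : (c (t + u))^* - (c t)^* - u%:C * v^* =
   (c (t + u) - c t - u%:C * v)^*.
  by rewrite -{1}(conjc_real u) -rmorphM -!rmorphB.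
by rewrite cmod_conj.
Qed.

Lemma has_vel_near c c' t v (d : R) : 0 < d ->
  (forall h : R, `|h| <= d -> c (t + h) = c' (t + h)) ->
  has_vel c t v -> has_vel c' t v.
Proof.
move=> d0 E h e /h [d' [d'0 H]]; exists (Num.min d d'); split.
  by rewrite lt_min d0.
move=> u; rewrite le_min => /andP[u1 /H].
have := E 0; rewrite normr0 addr0 => <-; last exact: ltW.
by rewrite E.
Qed.

Lemma is_derive_le (f : R -> R) t df :
  (forall e : R, 0 < e -> exists d : R, 0 < d /\ forall h : R, `|h| <= d ->
    `|f (t + h) - f t - h * df| <= e * `|h|) -> is_derive t (1 : R) f df.
Proof.
move=> H.
have C : (fun h : R => h^-1 *: (f (h *: (1 : R) + t) - f t)) @ 0^' --> df.
  apply/cvgrPdist_le => e /H [d [d0 hd]].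
  near=> h.
  have h0 : h != 0 by near: h; exact: nbhs_dnbhs_neq.
  have hh : `|h| <= d.
    near: h; apply: nbhs_dnbhs; apply/nbhs_ballP; exists d => //= h.
    by rewrite /ball /= sub0r normrN => /ltW.
  have := hd h hh; rewrite /= /GRing.scale /= mulr1 [h + t]addrC => h1.
  rewrite distrC.
  have -> : h^-1 * (f (t + h) - f t) - df = h^-1 * (f (t + h) - f t - h * df).
    by field.
  rewrite normrM normfV mulrC ler_pdivrMr ?normr_gt0 //.
split; first by apply/cvg_ex; exists df.
exact: cvg_lim C.
Unshelve. all: by end_near.
Qed.

Lemma has_vel_Re c t v : has_vel c t v ->
  is_derive t (1 : R) (fun u => complex.Re (c u)) (complex.Re v).
Proof.
move=> H; apply: is_derive_le => e /H [d [d0 hd]]; exists d; split=> // h /hd hh.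
have E (x y z : R[i]) : complex.Re (x - y - h%:C * z) =
    complex.Re x - complex.Re y - h * complex.Re z.
  by case: x y z => a b [a' b'] [a'' b''] /=; ring.
by rewrite -E; apply: le_trans (Re_le_cmod _) hh.
Qed.

Lemma has_vel_Im c t v : has_vel c t v ->
  is_derive t (1 : R) (fun u => complex.Im (c u)) (complex.Im v).
Proof.
move=> H; apply: is_derive_le => e /H [d [d0 hd]]; exists d; split=> // h /hd hh.
have E (x y z : R[i]) : complex.Im (x - y - h%:C * z) =
    complex.Im x - complex.Im y - h * complex.Im z.
  by case: x y z => a b [a' b'] [a'' b''] /=; ring.
by rewrite -E; apply: le_trans (Im_le_cmod _) hh.
Qed.

(** The real mean value theorem is applied to the real and the imaginary part separately, whence the
    factor 2. *)
Lemma mean_value_le (c : R -> R[i]) (v : R -> R[i]) (M : R) :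
  (forall t : R, 0 <= t <= 1 -> has_vel c t (v t)) ->
  (forall t : R, 0 <= t <= 1 -> cmod (v t) <= M) ->
  cmod (c 1 - c 0) <= M + M.
Proof.
move=> hc hM.
have key (f df : R -> R) : (forall t : R, 0 <= t <= 1 -> is_derive t (1 : R) f (df t)) ->
    (forall t : R, 0 <= t <= 1 -> `|df t| <= M) -> `|f 1 - f 0| <= M.
  move=> hf hdf.
  have [| |x] := @MVT_segment R f df 0 1 ler01.
  - by move=> x; rewrite in_itv /= => /andP[/ltW h0 /ltW h1]; apply: hf; rewrite h0.
  - apply: derivable_within_continuous => x; rewrite in_itv /= => hx.
    by have [] := hf x hx.
  rewrite in_itv /= => hx ->; rewrite subr0 mulr1; exact: hdf.
have hRe := key (fun u => complex.Re (c u)) (fun u => complex.Re (v u)).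
have hIm := key (fun u => complex.Im (c u)) (fun u => complex.Im (v u)).
apply: le_trans (cmod_le_ReIm _) _; apply: lerD.
  have -> : complex.Re (c 1 - c 0) = complex.Re (c 1) - complex.Re (c 0).
    by case: (c 1) (c 0) => a b [].
  apply: hRe => t ht; first exact: has_vel_Re (hc t ht).
  exact: le_trans (Re_le_cmod _) (hM t ht).
have -> : complex.Im (c 1 - c 0) = complex.Im (c 1) - complex.Im (c 0).
  by case: (c 1) (c 0) => a b [].
apply: hIm => t ht; first exact: has_vel_Im (hc t ht).
exact: le_trans (Im_le_cmod _) (hM t ht).
Qed.

End Velocity.

(** * The extension in the complexification *)

(** Turns the cost [N ^ N] of N Cauchy estimates with gaps of order [1 / N] into a factorial. The
    induction rests on [(1 + 1 / m) ^ m <= e]. *)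
Lemma expnn_fact (R : realType) N :
  (N%:R ^+ N : R) <= expR 1 ^+ N * (N`!)%:R.
Proof.
elim: N => [|N IH]; first by rewrite !expr0 fact0 mul1r.
case: N IH => [|N] IH.
  by rewrite !expr1 mulr1 ltW // expR_gt1.
set m := N.+1 in IH *.
have m0 : 0 < m%:R :> R by rewrite ltr0n.
have E1 : (m.+1%:R : R) ^+ m <= expR 1 * m%:R ^+ m.
  have -> : m.+1%:R = (1 + m%:R^-1) * m%:R :> R.
    by rewrite -natr1; field; rewrite gt_eqF.
  rewrite exprMn ler_wpM2r ?exprn_ge0 ?ler0n //.
  have := expR_ge1Dx (m%:R^-1 : R) => h.
  apply: (@le_trans _ _ (expR m%:R^-1 ^+ m)).
    by rewrite lerXn2r // ?nnegrE ?addr_ge0 ?invr_ge0 ?expR_ge0 ?ler0n.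
  by rewrite -expRM_natl mulfV ?gt_eqF.
rewrite exprS factS natrM [expR 1 ^+ _]exprS.
rewrite [leRHS](_ : _ = m.+1%:R * (expR 1 * (expR 1 ^+ m * (m`!)%:R))); last by ring.
rewrite ler_pM2l ?ltr0n //; apply: le_trans E1 _.
by rewrite ler_pM2l ?expR_gt0.
Qed.

Lemma ps_small (R : realType) (I : finType) (s : I -> R) f B (mu : R) :
  (forall i, 0 < s i) -> ps s f B -> f (fun=> 0) = 0 -> 0 < mu ->
  exists sg : R, 0 < sg /\ forall k : R, 0 < k -> k <= sg -> ps (fun=> k) f mu.
Proof.
move=> s0 hf f0 mu0; have sge i : 0 <= s i by exact: ltW.
have [q [hq Hq]] := ps_taylor1 s0 hf.
have [d [d0 hd]] := fin_pos_lb s0.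
pose S := \sum_j B / s j.
have S0 : 0 <= S by apply: sumr_ge0 => j _; exact: ps_ge0 (hq j).
exists (Num.min d (mu / (S + 1))); split.
  by rewrite lt_min d0 divr_gt0 // ltr_wpDl.
move=> k k0; rewrite le_min => /andP[kd kS].
have kge (i : I) : 0 <= k by exact: ltW.
have ks i : k <= s i by exact: le_trans kd (hd i).
apply: (ps_le kge (ps_bigsum kge (index_enum I) (fun j => ps_mul kge (ps_X kge j)
   (ps_radii kge ks (hq j))))).
  rewrite -mulr_sumr -/S.
  have : k * (S + 1) <= mu by rewrite -ler_pdivlMr // ltr_wpDl.
  clear kge; nra.
by move=> x hx; rewrite Hq ?f0 ?add0r // => j; apply: le_trans (hx j) (ks j).
Qed.

Lemma is_grad_exp (R : realType) (I : finType) (f : (I -> R[i]) -> R[i]) x a k :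
  is_grad f x a ->
  is_grad (fun y => f y ^+ k.+1) x (fun j => k.+1%:R * f x ^+ k * a j).
Proof.
move=> h; elim: k => [|k IH].
  by move: h; congr is_grad; apply/funext => j; rewrite expr0 !mul1r.
have := is_gradM h IH; congr is_grad; apply/funext => j.
by rewrite [k.+2%:R]mulrS exprS; ring.
Qed.

Section Key.
Variables (R : realType) (n : nat) (ib : bool -> 'I_n).
Local Notation I := ('I_n + 'I_n)%type.
Variables (rho phi : (I -> R[i]) -> R[i]) (d1 d2 Brho Bphi eps theta : R).
Variable c : bool -> 'I_n -> R[i].
Hypothesis ib_neq : ib true != ib false.
Hypotheses (d12 : d2 < d1) (theta_gt0 : 0 < theta) (theta_d2 : theta <= d2).
Hypotheses (eps_gt0 : 0 < eps) (eps_le1 : eps <= 1).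
Hypotheses (hrho : ps (fun=> d1) rho Brho) (hphi : ps (fun=> d1) phi Bphi).
Hypothesis rho0 : rho (fun=> 0) = 0.
Hypothesis hrel : forall j k x, pdisc (fun=> d2) x ->
  pd (inr j) phi x * pd (inr k) rho x = pd (inr k) phi x * pd (inr j) rho x.

(* The radii in [zeta] are shrunk by [eps] so that [d_zeta rho] is a small
   perturbation of linear coordinates in [z]; see [errt]. *)
Definition birad (sg : R) (i : I) : R :=
  match i with inl _ => sg | inr _ => eps * sg end.

(** The coefficients [c b] are meant to combine the entries of d_zeta rho into the single coordinate
    [z (ib b)]; this is the error of that approximation. *)
Definition errt b (x : I -> R[i]) :=
  \sum_l c b l * pd (inr l) rho x - x (inl (ib b)).

(** Required at every radius up to [theta], because each differentiation shrinks the polydisc before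
    the next division. The 8 is that of [ps_div]. *)
Hypothesis herr : forall b (sg : R), 0 < sg -> sg <= theta -> ps (birad sg) (errt b) (sg / 8).

Let rad_gt0 (sg : R) : 0 < sg -> forall i, 0 < birad sg i.
Proof. by move=> h [k|k] //=; rewrite mulr_gt0. Qed.

Let rad_ge0 (sg : R) : 0 < sg -> forall i, 0 <= birad sg i.
Proof. by move=> h i; rewrite ltW ?rad_gt0. Qed.

Let rad_lt (sg sg' : R) : sg' < sg -> forall i, birad sg' i < birad sg i.
Proof. by move=> h [k|k] //=; rewrite ltr_pM2l. Qed.

Let rad_le (sg sg' : R) : sg' <= sg -> forall i, birad sg' i <= birad sg i.
Proof. by move=> h [k|k] //=; rewrite ler_pM2l. Qed.

Let rad_d2 (sg : R) : 0 < sg -> sg <= theta -> forall i, birad sg i <= d2.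
Proof.
move=> s0 h i; have := theta_d2; have := eps_le1; case: i => k /=; first lra.
by move=> h1 h2; apply: le_trans _ (le_trans h h2); rewrite ler_piMl // ltW.
Qed.

Let pdisc_le (T : Type) (s s' : T -> R) x :
  (forall i, s' i <= s i) -> pdisc s' x -> pdisc s x.
Proof. by move=> h hx i; apply: le_trans (hx i) (h i). Qed.

Let d2_gt0 : 0 < d2. Proof. exact: lt_le_trans theta_gt0 theta_d2. Qed.

Let pdrho_ps l : ps (fun=> d2) (pd (inr l) rho) (Brho / (d1 - d2)).
Proof.
have h := d12; apply: (ps_pd (s := fun=> d1)) => //.
  by rewrite subr_gt0.
by rewrite addrC subrK.
Qed.

Let ps_rad_d2 (sg : R) f B : 0 < sg -> sg <= theta -> ps (fun=> d2) f B -> ps (birad sg) f B.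
Proof. by move=> h h'; apply: ps_radii; [exact: rad_ge0|exact: rad_d2]. Qed.

Let pd_rad (sg sg' : R) f B (i : I) : 0 < sg' -> sg' < sg -> ps (birad sg) f B ->
  ps (birad sg') (pd i f) (B / (eps * (sg - sg'))).
Proof.
move=> s0 ss; apply: ps_pd; [exact: rad_gt0|exact: rad_lt| |].
  by rewrite mulr_gt0 // subr_gt0.
have h1 := eps_le1; have h0 := eps_gt0; case: i => k /=; nra.
Qed.

Let csum := \sum_l cmod (c true l).

Let dq f q := forall l x, pdisc (birad (theta / 2)) x ->
  pd (inr l) f x = q x * pd (inr l) rho x.

Let uE b x : \sum_l c b l * pd (inr l) rho x = x (inl (ib b)) + errt b x.
Proof. by rewrite /errt addrC subrK. Qed.

Let err2 b (sg : R) : 0 < sg -> sg <= theta ->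
  ps (birad sg) (errt b) (birad sg (inl (ib b)) / 2).
Proof.
move=> s0 st; apply: (ps_le (rad_ge0 s0) (herr b s0 st)) => //=.
by rewrite ler_pM2l // lef_pV2 ?posrE // ler_nat.
Qed.

Let u_cancel (sg : R) f g B B' : 0 < sg -> sg <= theta ->
  ps (birad sg) f B -> ps (birad sg) g B' ->
  (forall x, pdisc (birad sg) x -> (\sum_l c true l * pd (inr l) rho x) * f x =
     (\sum_l c true l * pd (inr l) rho x) * g x) ->
  forall x, pdisc (birad sg) x -> f x = g x.
Proof.
move=> s0 st hf hg H x hx; apply/eqP; rewrite -subr_eq0; apply/eqP.
apply: (ps_unit_uniq (d := fun x => f x - g x) (rad_gt0 s0) (err2 true s0 st)
  (ps_sub (rad_ge0 s0) hf hg)) hx => {}x hx.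
by rewrite -uE mulrBr H // subrr.
Qed.

(* The zero set of [d_zeta rho] has codimension [n >= 2]: two of its entries are
   enough to exclude a pole. *)
Lemma step_div (sg : R) f A : 0 < sg -> sg <= theta ->
  (forall l, ps (birad sg) (pd (inr l) f) A) ->
  (forall j k x, pdisc (birad sg) x ->
    pd (inr j) f x * pd (inr k) rho x = pd (inr k) f x * pd (inr j) rho x) ->
  exists q, ps (birad sg) q (2 * (csum * A / sg)) /\
    forall l x, pdisc (birad sg) x -> pd (inr l) f x = q x * pd (inr l) rho x.
Proof.
move=> s0 st hf rel; have sge := rad_ge0 s0.
pose F b x := \sum_l c b l * pd (inr l) f x.
have hF b : ps (birad sg) (F b) ((\sum_l cmod (c b l)) * A).
  rewrite mulr_suml; apply: ps_bigsum => // l; exact: ps_scale.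
have relF b l x : pdisc (birad sg) x ->
    F b x * pd (inr l) rho x = pd (inr l) f x * \sum_k c b k * pd (inr k) rho x.
  move=> hx; rewrite mulr_suml mulr_sumr; apply: eq_bigr => k _.
  by rewrite -mulrA rel // mulrCA.
have ne : (inl (ib true) : I) != inl (ib false) by exact: ib_neq.
have [x hx|q [hq Hq]] := ps_div (rad_gt0 s0) ne (err2 true s0 st)
  (herr false s0 st) (hF true) (hF false).
  rewrite -!uE mulr_sumr [RHS]mulr_suml; apply: eq_bigr => l _.
  by rewrite mulrCA relF // mulrA.
exists q; split=> // l x hx.
(* The quotient of the combination serves every entry: multiplied by the divisor, both sides become
   [F true x * pd (inr l) rho x], and the divisor cancels. *)
apply: (u_cancel s0 st (hf l)
  (ps_mul sge hq (ps_rad_d2 s0 st (pdrho_ps l)))) hx => {}x hx.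
by rewrite mulrA uE -Hq // relF // uE mulrC.
Qed.

(** Purely qualitative: any radius strictly above [theta / 2] leaves room for one more step, so the
    whole sequence lives on the polydisc of size [theta / 2]. Growth is estimated separately. *)
Let good f := exists sg B, [/\ theta / 2 < sg, sg <= theta, ps (birad sg) f B &
  forall j k x, pdisc (birad sg) x ->
    pd (inr j) f x * pd (inr k) rho x = pd (inr k) f x * pd (inr j) rho x].

Let good_phi : good phi.
Proof.
have [h1 h2 h3] := And3 d12 theta_gt0 theta_d2.
exists theta, Bphi; split=> //; first lra.
  apply: (ps_radii (rad_ge0 theta_gt0) _ hphi) => i.
  by apply: le_trans (rad_d2 theta_gt0 _ i) _ => //; exact: ltW.
move=> j k x hx; apply: hrel; apply: pdisc_le hx => i.
exact: rad_d2.
Qed.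

Let good_step f : good f -> exists q, good q /\ dq f q.
Proof.
have t0 := theta_gt0.
move=> [sg [B [tsg sgt hf rel]]].
(* One gap for the derivatives of [f], a second one for those of [q], both staying above
   [theta / 2]. *)
pose s1 := (sg + theta / 2) / 2; pose s2 := (s1 + theta / 2) / 2.
have [h1 h2] : theta / 2 < s1 /\ s1 < sg by rewrite /s1; split; lra.
have [h3 h4] : theta / 2 < s2 /\ s2 < s1 by rewrite /s2; split; lra.
have s10 : 0 < s1 by lra.
have s1t : s1 <= theta by lra.
have s20 : 0 < s2 by lra.
have s2t : s2 <= theta by lra.
have [j k x hx|q [hq Hq]] := step_div (f := f) s10 s1t (fun l => pd_rad (inr l) s10 h2 hf).
  by apply: rel; apply: pdisc_le hx; apply: rad_le; exact: ltW.
exists q; split; last first.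
  by move=> l x hx; apply: Hq; apply: pdisc_le hx; apply: rad_le; exact: ltW.
exists s2; exists (2 * (csum * (B / (eps * (sg - s1))) / s1)); split=> //.
  by apply: (ps_radii (rad_ge0 s20) _ hq); apply: rad_le; exact: ltW.
move=> j k x hx.
have hs := rad_lt h4.
have hs2 := rad_lt h2.
have gq : is_grad q x (grad q x) by exact: ps_grad hs hq hx.
have grho l : is_grad (pd (inr l) rho) x (grad (pd (inr l) rho) x).
  exact: ps_grad hs (ps_rad_d2 s10 s1t (pdrho_ps l)) hx.
have E m l : pd (inr m) (pd (inr l) f) x =
   pd (inr m) q x * pd (inr l) rho x + q x * pd (inr m) (pd (inr l) rho) x.
  transitivity (pd (inr m) (fun y => q y * pd (inr l) rho y) x).
    apply: (eq_pd (inr m) hs) hx => [|y hy]; last exact: Hq.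
    by exists (B / (eps * (sg - s1))); exact: pd_rad.
  by rewrite /pd (gradE (is_gradM gq (grho l))).
have hx1 : pdisc (birad s1) x by apply: pdisc_le hx => i; exact: ltW.
have C1 := pd_comm (inr j) (inr k) (rad_gt0 s10) hs2 hf hx1.
have hrho' : ps (birad sg) rho Brho.
  apply: (ps_radii _ _ hrho) => [i|i]; first by apply: rad_ge0; lra.
  apply: le_trans (rad_d2 _ sgt i) (ltW d12); lra.
have C2 := pd_comm (inr j) (inr k) (rad_gt0 s10) hs2 hrho' hx1.
(* The mixed derivatives of [f] are symmetric, and so are those of [rho]. Removing the common term
   [q] times the second derivative of [rho] leaves the proportionality for the gradient of [q]. *)
move: C1; rewrite !E C2 => /addIr; exact.
Qed.

Let iter_seq : exists f : nat -> (I -> R[i]) -> R[i],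
  [/\ f 0%N = phi, forall k, good (f k) & forall k, dq (f k) (f k.+1)].
Proof.
have /choice[T hT] f : exists q, good f -> good q /\ dq f q.
  have [gf|ngf] := pselect (good f); last by exists f.
  by have [q hq] := good_step gf; exists q.
pose f := fix f k := if k is k'.+1 then T (f k') else phi.
have gf k : good (f k) by elim: k => [|k /hT []] //; exact: good_phi.
by exists f; split=> // k; exact: (proj2 (hT _ (gf k))).
Qed.

Let good_half f : good f -> exists B, ps (birad (theta / 2)) f B.
Proof.
have t0 := theta_gt0.
move=> [sg [B [h1 _ hf _]]]; exists B; apply: (ps_radii _ _ hf).
  by apply: rad_ge0; rewrite divr_gt0.
by apply: rad_le; exact: ltW.
Qed.

(** The division is redone at the prescribed radii; its quotient coincides with [q] by cancellation
    and hands over its bound. The factor [eps] comes from the shrunken [zeta] radii, and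
    [theta / 4 <= sg'] replaces [1 / sg'] by a constant. *)
Let estimate f q (sg sg' B : R) : good q -> dq f q -> theta / 4 <= sg' -> sg' < sg ->
  sg <= theta / 2 -> ps (birad sg) f B ->
  ps (birad sg') q (8 * csum / (theta * eps) / (sg - sg') * B).
Proof.
have t0 := theta_gt0; have e0 := eps_gt0.
move=> gq hdq h1 h2 h3 hf.
have s0 : 0 < sg' by lra.
have st : sg' <= theta by lra.
have hsub : forall i, birad sg' i <= birad (theta / 2) i by apply: rad_le; lra.
have B0 : 0 <= B by apply: ps_ge0 hf; apply: rad_ge0; lra.
have hpd l := pd_rad (inr l) s0 h2 hf.
have [j k x hx|q' [hq' Hq']] := step_div (f := f) s0 st hpd.
  by rewrite !hdq //; [ring|exact: pdisc_le hx..].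
have [B' hq] := good_half gq.
have {}hq : ps (birad sg') q B' by exact: (ps_radii (rad_ge0 s0) hsub hq).
have E x : pdisc (birad sg') x -> q x = q' x.
  apply: (u_cancel s0 st hq hq') => {}x hx.
  rewrite !mulr_suml; apply: eq_bigr => l _.
  have hx' := pdisc_le hsub hx.
  by have := Hq' l x hx; rewrite hdq // => h; rewrite -!mulrA ![_ * q _]mulrC ![_ * q' _]mulrC h.
apply: (ps_le (rad_ge0 s0) hq') => //.
have cs0 : 0 <= csum by apply: sumr_ge0 => l _; exact: cmod_ge0.
have X0 : 0 <= 2 * csum * (B / (eps * (sg - sg'))).
  by rewrite !mulr_ge0 // invr_ge0 mulr_ge0 ?subr_ge0 ?ltW.
have -> : 2 * (csum * (B / (eps * (sg - sg'))) / sg') =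
   2 * csum * (B / (eps * (sg - sg'))) * sg'^-1 by ring.
have -> : 8 * csum / (theta * eps) / (sg - sg') * B =
   2 * csum * (B / (eps * (sg - sg'))) * (theta / 4)^-1.
  by field; rewrite !gt_eqF ?subr_gt0 // ltW.
rewrite ler_wpM2l // lef_pV2 // posrE; lra.
Qed.

Let factV k : cmod ((k`!)%:R^-1 : R[i]) = (k`!)%:R^-1.
Proof. by rewrite cmodV cmod_nat. Qed.

Let coef_bound f : f 0%N = phi -> (forall k, good (f k)) ->
  (forall k, dq (f k) (f k.+1)) ->
  exists A : R, 0 < A /\ forall N,
    ps (birad (theta / 4)) (f N) (Bphi * (A ^+ N * (N`!)%:R)).
Proof.
have [h12 t0 td2] := And3 d12 theta_gt0 theta_d2.
have e0 := eps_gt0; have e1 := eps_le1.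
move=> f0 gf df.
pose K := 8 * csum / (theta * eps); pose L := 4 * K / theta.
have cs0 : 0 <= csum by apply: sumr_ge0 => l _; exact: cmod_ge0.
have L0 : 0 <= L by rewrite !mulr_ge0 ?invr_ge0 ?mulr_ge0 // ltW.
have Bp0 : 0 <= Bphi.
  by apply: ps_ge0 hphi => _; apply: ltW; apply: le_lt_trans h12; exact: ltW.
have half_lt : theta / 2 <= theta by lra.
have h0 : ps (birad (theta / 2)) (f 0%N) Bphi.
  rewrite f0; apply: (ps_radii _ _ hphi) => [|i]; first by apply: rad_ge0; lra.
  have := rad_d2 (sg := theta / 2) _ half_lt i; lra.
have hb N : ps (birad (theta / 4)) (f N) (Bphi * (L * N%:R) ^+ N).
  case: N => [|N].
    rewrite expr0 mulr1; apply: (ps_radii _ _ h0); first by apply: rad_ge0; lra.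
    by apply: rad_le; lra.
  set m := N.+1; have m0 : 0 < m%:R :> R by rewrite ltr0n.
  (* [m] equal gaps lead from radius [theta / 2] down to [theta / 4], each division multiplying the
     bound by [K / st = L * m]. *)
  pose st := theta / (4 * m%:R).
  have st0 : 0 < st by rewrite divr_gt0 // mulr_gt0.
  have stm : st * m%:R = theta / 4 by rewrite /st; field; rewrite gt_eqF.
  have H j : (j <= m)%N ->
      ps (birad (theta / 2 - j%:R * st)) (f j) (Bphi * (L * m%:R) ^+ j).
    elim: j => [|j IH] jm; first by rewrite mul0r subr0 expr0 mulr1.
    have := estimate (gf j.+1) (df j) _ _ _ (IH (ltnW jm)).
    have jm1 : (j.+1%:R : R) <= m%:R by rewrite ler_nat.
    have j1 : (j.+1%:R : R) = j%:R + 1 by rewrite -natr1.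
    have jj : 0 <= (j%:R : R) by [].
    have E : j.+1%:R * st = j%:R * st + st by rewrite j1 mulrDl mul1r.
    have jst0 : 0 <= j%:R * st by rewrite mulr_ge0 // ltW.
    have jst : j.+1%:R * st <= theta / 4 by rewrite -stm mulrC ler_wpM2l // ltW.
    move=> /(_ (theta / 2 - j.+1%:R * st)).
    move=> H; have {}H := H ltac:(lra) ltac:(lra) ltac:(lra).
    have -> : Bphi * (L * m%:R) ^+ j.+1 =
        K / (theta / 2 - j%:R * st - (theta / 2 - j.+1%:R * st)) *
        (Bphi * (L * m%:R) ^+ j); last exact: H.
    have -> : theta / 2 - j%:R * st - (theta / 2 - j.+1%:R * st) = st.
      by rewrite E; ring.
    rewrite exprS /L; set P := _ ^+ j; rewrite /st.
    by field; rewrite !gt_eqF.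
  have := H m (leqnn _); rewrite [m%:R * st]mulrC stm.
  by have -> : theta / 2 - theta / 4 = theta / 4 by field.
(* [expnn_fact] turns [(L * N) ^ N] into [(L * e) ^ N * N!]; the added 1 makes the constant
   positive. *)
exists (L * expR 1 + 1); split; first by rewrite ltr_wpDl // mulr_ge0 ?expR_ge0.
move=> N; apply: (ps_le _ (hb N)) => //; first by apply: rad_ge0; lra.
rewrite ler_wpM2l // exprMn.
apply: le_trans (ler_wpM2l (exprn_ge0 N L0) (expnn_fact R N)) _.
have LE0 : 0 <= L * expR 1 by rewrite (mulr_ge0 L0) // expR_ge0.
by rewrite mulrA -exprMn ler_wpM2r // lerXn2r ?nnegrE ?LE0 ?lerDl // addr_ge0.
Qed.

(** [w] is held fixed while [x] moves. It will be the value of [rho] at the endpoint of a path,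
    where all terms but the first vanish. *)
Let taylor (f : nat -> (I -> R[i]) -> R[i]) (w : R[i]) N (x : I -> R[i]) : R[i] :=
  \sum_(k < N) (k`!)%:R^-1 * (f k x * (w - rho x) ^+ k).

(* The [zeta]-derivatives of the Taylor polynomial telescope. *)
Let taylor_grad (f : nat -> (I -> R[i]) -> R[i]) w N x :
  (forall k, good (f k)) -> (forall k, dq (f k) (f k.+1)) ->
  pdisc (birad (theta / 4)) x ->
  exists G, is_grad (taylor f w N.+1) x G /\ forall l,
    G (inr l) = (N`!)%:R^-1 * (f N.+1 x * pd (inr l) rho x * (w - rho x) ^+ N).
Proof.
have [h12 t0 td2] := And3 d12 theta_gt0 theta_d2.
move=> gf df hx.
have t42 : theta / 4 < theta / 2 by lra.
have hx2 : pdisc (birad (theta / 2)) x.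
  by apply: pdisc_le hx => i; apply: ltW; exact: rad_lt.
have gr : is_grad rho x (grad rho x).
  apply: (ps_grad (s := fun=> d1) _ hrho hx2) => i.
  by apply: le_lt_trans h12; apply: rad_d2; lra.
have gk k : is_grad (f k) x (grad (f k) x).
  by have [B hB] := good_half (gf k); exact: ps_grad (rad_lt t42) hB hx.
have gp : is_grad (fun y => w - rho y) x (fun j => - grad rho x j).
  have := is_gradD (is_grad_cst w x) (is_gradZ (-1) gr).
  congr is_grad; apply/funext => y; first by rewrite mulN1r.
  by rewrite add0r mulN1r.
elim: N => [|N [G [hG EG]]].
  exists (fun j => (0`!)%:R^-1 * grad (f 0%N) x j); split.
    have := is_gradZ ((0`!)%:R^-1) (gk 0%N); congr is_grad.
    by apply/funext => y; rewrite /taylor big_ord1 /= expr0 mulr1.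
  by move=> l; rewrite expr0 mulr1 -df.
have := is_gradD hG (is_gradZ ((N.+1)`!)%:R^-1 (is_gradM (gk N.+1) (is_grad_exp N gp))).
set G' := (fun j : I => _) => hG'; exists G'; split.
  suff -> : taylor f w N.+2 = (fun y => taylor f w N.+1 y +
      (N.+1)`!%:R^-1 * (f N.+1 y * (w - rho y) ^+ N.+1)) by [].
  by apply/funext => y; rewrite /taylor big_ord_recr.
move=> l; rewrite /G' EG -[grad (f N.+1) x (inr l)]/(pd (inr l) (f N.+1) x) df //.
rewrite factS natrM -[grad rho x (inr l)]/(pd (inr l) rho x) exprS.
have n0 : (N.+1%:R : R[i]) != 0 by rewrite pnatr_eq0.
have f0 : ((N`!)%:R : R[i]) != 0 by rewrite pnatr_eq0 -lt0n fact_gt0.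
move: (N.+1%:R : R[i]) ((N`!)%:R : R[i]) n0 f0 => m F m0 F0.
by field; rewrite m0 F0.
Qed.

Definition optv (z : 'I_n -> R[i]) (w : R[i]) (o : option 'I_n) : R[i] :=
  if o is Some k then z k else w.

Theorem key_extension : exists (kap B : R) Phi, [/\ 0 < kap,
  ps (fun _ : option 'I_n => kap) Phi B &
  forall x, pdisc (fun=> kap) x -> cmod (rho x) <= kap ->
    phi x = Phi (optv (fun k => x (inl k)) (rho x))].
Proof.
have [h12 t0 td2] := And3 d12 theta_gt0 theta_d2.
have e0 := eps_gt0; have e1 := eps_le1; have d20 := d2_gt0.
have [f [f0 gf df]] := iter_seq.
have [A [A0 hA]] := coef_bound f0 gf df.
have Bp0 : 0 <= Bphi by apply: ps_ge0 hphi => _; lra.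
(* Both [w] and [rho (z, 0)] will be at most [mu], so powers of [A * (2 * mu) = 1 / 4] appear.
   Besides convergence of [Phi], the 4 must absorb the factor [N.+1] in the derivative of the
   truncated sum. *)
pose mu := (8 * A)^-1; have mu0 : 0 < mu by rewrite invr_gt0 mulr_gt0.
have [sg [sg0 hsg]] := ps_small (s := fun=> d1) (fun=> lt_trans d20 h12) hrho rho0 mu0.
pose kap := Num.min (Num.min sg mu) (eps * (theta / 4)).
have kap0 : 0 < kap by rewrite !lt_min sg0 mu0 mulr_gt0 // divr_gt0.
have kmu : kap <= mu by rewrite !ge_min lexx orbT.
have krho : ps (fun=> kap) rho mu by apply: hsg; rewrite // !ge_min lexx.
have ket : kap <= eps * (theta / 4) by rewrite !ge_min lexx orbT.
have kt : kap <= theta / 4 by apply: le_trans ket _; rewrite ler_piMl //; lra.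
have krad i : kap <= birad (theta / 4) i by case: i.
pose z0 (y : option 'I_n -> R[i]) (i : I) : R[i] :=
  match i with inl k => y (Some k) | inr _ => 0 end.
pose T k y : R[i] := (k`!)%:R^-1 * (f k (z0 y) * (y None - rho (z0 y)) ^+ k).
have kge (S : Type) (i : S) : 0 <= kap by exact: ltW.
have hz0 g C : ps (fun=> kap) g C -> ps (fun=> kap) (fun y => g (z0 y)) C.
  move=> hg; apply: (ps_comp (h := z0) (kge _) (kge _) hg) => -[k|k] /=.
    exact: (ps_X (kge _) (Some k)).
  by apply: (ps_cstW (kge _)); rewrite cmod0 ltW.
have hT k : ps (fun=> kap) (T k) (Bphi * 2^-1 ^+ k).
  have hp : ps (fun _ : option 'I_n => kap) (fun y => y None - rho (z0 y)) (2 * mu).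
    apply: (ps_le (kge _) (ps_sub (kge _) (ps_X (kge _) None) (hz0 _ _ krho))) => //.
    by rewrite mulrDl mul1r lerD.
  have hf := hz0 _ _ (ps_radii (kge _) krad (hA k)).
  apply: (ps_le (kge _) (ps_scale (kge _) _ (ps_mul (kge _) hf (ps_exp (kge _) k hp)))) => //.
  have F0 : 0 < (k`!)%:R :> R by rewrite ltr0n fact_gt0.
  rewrite factV.
  have -> : (k`!)%:R^-1 * (Bphi * (A ^+ k * (k`!)%:R) * (2 * mu) ^+ k) =
     Bphi * (A * (2 * mu)) ^+ k.
    by rewrite [(A * _) ^+ k]exprMn; field; rewrite gt_eqF.
  have -> : A * (2 * mu) = 4^-1 by rewrite /mu; field; rewrite gt_eqF.
  by rewrite ler_wpM2l // lerXn2r ?nnegrE ?invr_ge0 // lef_pV2 ?posrE // ler_nat.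
have [N|Phi [hPhi HPhi]] := ps_series (b := 2 * Bphi) hT.
  exact: sum_half_le.
exists kap, (2 * Bphi), Phi; split=> // x hx hr.
pose w := rho x; pose y := optv (fun k => x (inl k)) w.
have hy : pdisc (fun=> kap) y by move=> o; case: o => [k|] /=; [exact: hx|].
apply/esym; apply: (clim_unique (clim_shift 1 (HPhi y hy))).
(* The path from [(z, 0)], where the Taylor sum is a partial sum of [Phi], to [x], where it equals
   [phi x] because [w = rho x]. *)
pose X (t : R) (i : I) : R[i] :=
  match i with inl k => x (inl k) | inr k => t%:C * x (inr k) end.
have X1 : X 1 = x by apply/funext => -[k|k] //=; rewrite mul1r.
have X0 : X 0 = z0 y by apply/funext => -[k|k] //=; rewrite mul0r.
have hX t : 0 <= t <= 1 -> pdisc (fun=> kap) (X t).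
  move=> /andP[ta tb] i; case: i => k /=; first exact: hx.
  rewrite cmodM cmodR ger0_norm //; apply: le_trans (hx (inr k)).
  by rewrite ler_piMl // cmod_ge0.
pose D := Brho / (d1 - d2).
have D0 : 0 <= D.
  rewrite divr_ge0 ?subr_ge0 ?(ltW h12) //.
  by apply: ps_ge0 hrho => _; lra.
pose Cst := n%:R * (kap * (Bphi * A * D)).
have BAD : 0 <= Bphi * A * D := mulr_ge0 (mulr_ge0 Bp0 (ltW A0)) D0.
have BA N : 0 <= Bphi * (A ^+ N * (N`!)%:R).
  by apply: mulr_ge0 => //; apply: mulr_ge0 => //; apply: exprn_ge0; exact: ltW.
have mu2 : 0 <= 2 * mu by apply: mulr_ge0 => //; exact: ltW.
(* Along the path only the top term of the derivative survives. The ratio of factorials leaves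
   [N.+1 * 4 ^ (- N) <= 2 ^ (- N)]. *)
have bound N : cmod (\sum_(k < 1 + N) T k y - phi x) <=
    (Cst + Cst) * 2^-1 ^+ N.
  have -> : \sum_(k < 1 + N) T k y = taylor f w N.+1 (X 0).
    by rewrite X0 /taylor /T; apply: eq_bigr => k _.
  have -> : phi x = taylor f w N.+1 (X 1).
    rewrite X1 /taylor big_ord_recl big1 ?addr0 => [|k _].
      by rewrite fact0 invr1 mul1r expr0 mulr1 f0.
    by rewrite /w subrr expr0n /= !mulr0.
  rewrite cmodB mulrDl.
  pose V (i : I) := match i with inl _ => 0 | inr k => x (inr k) end.
  apply: (@mean_value_le R (fun t => taylor f w N.+1 (X t))
     (fun t => \sum_j V j * grad (taylor f w N.+1) (X t) j)) => t ht.
    have [G [hG _]] := taylor_grad w N gf df (pdisc_le krad (hX t ht)).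
    apply: has_vel_grad; first by rewrite (gradE hG).
    move=> j; case: j => k /=; first exact: has_vel_cst.
    by have := has_vel_affine 0 (x (inr k)) t; congr has_vel; apply/funext => u; rewrite add0r.
  have [G [hG EG]] := taylor_grad w N gf df (pdisc_le krad (hX t ht)).
  rewrite (gradE hG) big_sumType /= big1 ?add0r; last by move=> k _; rewrite mul0r.
  apply: le_trans (cmod_sum _ _ _) _.
  apply: (@le_trans _ _ (\sum_(k < n) kap * (Bphi * A * D) * 2^-1 ^+ N)).
    apply: ler_sum => k _; rewrite EG !cmodM factV -[leRHS]mulrA.
    apply: ler_pM => //; first exact: cmod_ge0.
      by rewrite !mulr_ge0 ?invr_ge0 ?cmod_ge0.
    have b1 := ps_bound (hA N.+1) (pdisc_le krad (hX t ht)).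
    have b2 : cmod (pd (inr k) rho (X t)) <= D.
      apply: (ps_bound (pdrho_ps k)); apply: pdisc_le (hX t ht) => i.
      by apply: le_trans (krad i) _; apply: rad_d2; lra.
    have b3 : cmod (w - rho (X t)) <= 2 * mu.
      rewrite mulrDl mul1r; apply: cmod_le_sub; first exact: le_trans hr kmu.
      exact: (ps_bound krho (hX t ht)).
    rewrite cmodX.
    apply: (@le_trans _ _ ((N`!)%:R^-1 * (Bphi * (A ^+ N.+1 * ((N.+1)`!)%:R) * D * (2 * mu) ^+ N))).
      rewrite ler_wpM2l ?invr_ge0 //; apply: ler_pM.
      - by apply: mulr_ge0; exact: cmod_ge0.
      - by apply: exprn_ge0; exact: cmod_ge0.
      - by apply: ler_pM; rewrite ?cmod_ge0.
      - by rewrite lerXn2r ?nnegrE ?cmod_ge0.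
    have F0 : 0 < (N`!)%:R :> R by rewrite ltr0n fact_gt0.
    have E4 : A * (2 * mu) = 4^-1 by rewrite /mu; field; rewrite gt_eqF.
    have -> : (N`!)%:R^-1 * (Bphi * (A ^+ N.+1 * ((N.+1)`!)%:R) * D * (2 * mu) ^+ N) =
       Bphi * A * D * (N.+1%:R * (A * (2 * mu)) ^+ N).
      by rewrite factS natrM exprS [(A * _) ^+ N]exprMn; field; rewrite gt_eqF.
    rewrite E4; apply: (ler_wpM2l BAD).
    have -> : (4^-1 : R) = 2^-1 * 2^-1 by field.
    rewrite exprMn mulrA ler_piMl ?exprn_ge0 ?invr_ge0 //.
    rewrite exprVn ler_pdivrMr ?exprn_gt0 // mul1r -natrX ler_nat.
    exact: ltn_expl.
  by rewrite sumr_const card_ord -[leLHS]mulr_natl /Cst mulrA.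
apply: (@clim_le _ _ _ _ bound).
rewrite -(mulr0 (Cst + Cst)); apply: cvgM; first exact: cvg_cst.
by apply: cvg_expr; rewrite gtr0_norm // invf_lt1 // ltr1n.
Qed.

End Key.

(** * Second-order part of the graph *)

Section Quadratic.
Variable R : realType.

Lemma pow_sep (a b : R[i]) (K d : R) : 0 < d ->
  (forall t : R, 0 < t -> t <= d -> cmod (t%:C * a + (t ^+ 2)%:C * b) <= K * t ^+ 3) ->
  a = 0 /\ b = 0.
Proof.
move=> d0 H.
have K0 : 0 <= K.
  have := le_trans (cmod_ge0 _) (H d d0 (lexx _)).
  by rewrite pmulr_lge0 // exprn_gt0.
have lim (c : R[i]) (M : R) : 0 <= M ->
    (forall t : R, 0 < t -> t <= d -> cmod c <= M * t) -> c = 0.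
  move=> M0 h; apply: cmod_le0 => e e0.
  pose t := Num.min d (e / (M + 1)).
  have t0 : 0 < t by rewrite lt_min d0 divr_gt0 // ltr_wpDl.
  have td : t <= d by rewrite ge_min lexx.
  have te : t * (M + 1) <= e by rewrite -ler_pdivlMr ?ltr_wpDl // ge_min lexx orbT.
  have := h t t0 td; nra.
have E (t : R) : (t ^+ 2)%:C = t%:C * t%:C :> R[i] by rewrite expr2 rmorphM.
have a0 : a = 0.
  apply: (lim _ (K * d + cmod b)) => [|t t0 td].
    by rewrite addr_ge0 ?cmod_ge0 // mulr_ge0 // ltW.
  have h := H t t0 td.
  have : cmod (t%:C * a) <= K * t ^+ 3 + t ^+ 2 * cmod b.
    have -> : t%:C * a = (t%:C * a + (t ^+ 2)%:C * b) - (t ^+ 2)%:C * b by ring.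
    apply: cmod_le_sub h _.
    by rewrite cmodM cmodR ger0_norm // exprn_ge0 // ltW.
  rewrite cmodM cmodR gtr0_norm //.
  have -> : K * t ^+ 3 + t ^+ 2 * cmod b = t * ((K * t + cmod b) * t) by ring.
  rewrite ler_pM2l // => /le_trans; apply.
  by apply: ler_wpM2r; rewrite ?(ltW t0) // lerD2r ler_wpM2l.
split=> //; apply: (lim _ K K0) => t t0 td.
have := H t t0 td; rewrite a0 mulr0 add0r cmodM cmodR gtr0_norm ?exprn_gt0 //.
have -> : K * t ^+ 3 = t ^+ 2 * (K * t) by ring.
by rewrite ler_pM2l // exprn_gt0.
Qed.

(** Polarisation: vanishing on the diagonal makes the form antisymmetric; replacing [w] by ['i * w]
    makes it symmetric as well. *)
Lemma sesqui0 n (A : 'I_n -> 'I_n -> R[i]) :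
  (forall z : 'I_n -> R[i], \sum_k \sum_l z k * A k l * (z l)^* = 0) ->
  forall k l, A k l = 0.
Proof.
move=> H k l.
pose S (z w : 'I_n -> R[i]) := \sum_k \sum_l z k * A k l * (w l)^*.
have SDl z z' w : S (fun k => z k + z' k) w = S z w + S z' w.
  rewrite /S -big_split; apply: eq_bigr => i _ /=.
  by rewrite -big_split; apply: eq_bigr => j _ /=; ring.
have SDr z w w' : S z (fun k => w k + w' k) = S z w + S z w'.
  rewrite /S -big_split; apply: eq_bigr => i _ /=.
  by rewrite -big_split; apply: eq_bigr => j _ /=; rewrite cconjD mulrDr.
have SZl c z w : S (fun k => c * z k) w = c * S z w.
  rewrite /S mulr_sumr; apply: eq_bigr => i _ /=.
  by rewrite mulr_sumr; apply: eq_bigr => j _ /=; ring.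
have SZr c z w : S z (fun k => c * w k) = c^* * S z w.
  rewrite /S mulr_sumr; apply: eq_bigr => i _ /=.
  by rewrite mulr_sumr; apply: eq_bigr => j _ /=; rewrite cconjM mulrCA.
have P z w : S z w + S w z = 0.
  have := H (fun k => z k + w k); rewrite -/(S _ _) SDl !SDr.
  by rewrite (H z : S z z = 0) (H w : S w w = 0) add0r addr0.
have ci := cconji R.
have P0 z w : S z w = 0.
  have h1 := P z w; have := P z (fun k => 'i * w k).
  rewrite SZl SZr ci => h2.
  have i0 := i_neq0 R.
  have h3 : S w z = S z w.
    by apply: (mulfI i0); apply/eqP; rewrite -subr_eq0; apply/eqP; rewrite -h2; ring.
  move: h1; rewrite h3 -mulr2n -mulr_natr => /eqP.
  by rewrite mulf_eq0 pnatr_eq0 orbF => /eqP.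
have := P0 (unitv k 1) (unitv l 1); rewrite /S.
rewrite (bigD1 k) //= (bigD1 l) //= /unitv !eqxx !big1 ?addr0 => [|j|j].
- by rewrite mul1r rmorph1 mulr1.
- move=> /negPf ->; apply: big1 => i _; by rewrite !mul0r.
- by move=> /negPf ->; rewrite rmorph0 mulr0.
Qed.

Lemma ps_taylor3 (I : finType) (d : R) f B : 0 < d -> ps (fun _ : I => d) f B ->
  exists (a : I -> R[i]) (b : I -> I -> R[i]) cub (K : R),
  [/\ forall x, pdisc (fun=> d) x -> f x = f (fun=> 0) + \sum_j x j * a j
        + \sum_j \sum_k x j * x k * b j k + cub x, 0 <= K &
      forall s : R, 0 < s -> s <= d -> ps (fun=> s) cub (K * s ^+ 3)].
Proof.
move=> d0 hf.
have [q [hq Hq]] := ps_taylor1 (fun=> d0) hf.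
have /choice[q2 hq2] j := ps_taylor1 (fun=> d0) (hq j).
have /choice[q3 hq3] jk := ps_taylor1 (fun=> d0) (proj1 (hq2 jk.1) jk.2).
exists (fun j => q j (fun=> 0)), (fun j k => q2 j k (fun=> 0)).
exists (fun x => \sum_j \sum_k \sum_l x j * x k * x l * q3 (j, k) l x).
exists (\sum_(j : I) \sum_(k : I) \sum_(l : I) B / d / d / d).
have B0 : 0 <= B by apply: ps_ge0 hf => _; exact: ltW.
split.
- move=> x hx; rewrite {1}Hq // -!addrA; congr (_ + _); rewrite -!big_split.
  apply: eq_bigr => j _ /=; rewrite (proj2 (hq2 j)) // mulrDr; congr (_ + _).
  rewrite mulr_sumr -big_split; apply: eq_bigr => k _ /=.
  rewrite (proj2 (hq3 (j, k))) // !mulrDr mulrA; congr (_ + _).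
  by rewrite !mulr_sumr; apply: eq_bigr => l _; ring.
- by do 3!(apply: sumr_ge0 => ? _); rewrite !divr_ge0 // ltW.
- move=> s s0 sd; have sge (i : I) : 0 <= s by exact: ltW.
  have sd' (i : I) : s <= d by [].
  rewrite mulr_suml; apply: (ps_bigsum sge) => j.
  rewrite mulr_suml; apply: (ps_bigsum sge) => k.
  rewrite mulr_suml; apply: (ps_bigsum sge) => l.
  apply: (ps_le sge (ps_mul sge (ps_mul sge (ps_mul sge (ps_X sge j) (ps_X sge k))
    (ps_X sge l)) (ps_radii sge sd' (proj1 (hq3 (j, k)) l)))) => //.
  by rewrite le_eqVlt; apply/orP; left; apply/eqP; ring.
Qed.

End Quadratic.

Lemma double_eq0 (R : realType) (x : R[i]) : x + x = 0 -> x = 0.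
Proof.
rewrite -mulr2n -mulr_natr => /eqP.
by rewrite mulf_eq0 pnatr_eq0 orbF => /eqP.
Qed.

Lemma real_lin0 (R : realType) n (a : 'I_n + 'I_n -> R[i]) :
  (forall z, \sum_j rpt z j * a j = 0) -> forall j, a j = 0.
Proof.
move=> H.
suff E k : a (inl k) = 0 /\ a (inr k) = 0 by case=> k; have [] := E k.
have linE c : c * a (inl k) + c^* * a (inr k) = 0.
  rewrite -(H (unitv k c)) big_sumType /= sum_unitv; congr (_ + _).
  rewrite -(sum_unitv k c^* (fun k => a (inr k))); apply: eq_bigr => j _.
  by rewrite /unitv; case: eqP => // _; rewrite rmorph0.
have := linE 1; have := linE 'i; rewrite rmorph1 !mul1r cconji mulNr -mulrBr => /eqP.
rewrite mulf_eq0 (negPf (i_neq0 R)) /= subr_eq0 => /eqP E h.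
have a0 : a (inr k) = 0 by apply: double_eq0; rewrite -{1}E.
by rewrite E.
Qed.

Section ComplexExtension.
Variables (R : realType) (n : nat).
Local Notation I := ('I_n + 'I_n)%type.

Definition qform (A B C : 'M[R[i]]_n) (z : 'I_n -> R[i]) : R[i] :=
  \sum_k \sum_l z k * A k l * (z l)^* + \sum_k \sum_l z k * B k l * z l
  + (\sum_k \sum_l z k * C k l * z l)^*.

(* The mixed terms are isolated by comparing the values at [z] and ['i z]. *)
Lemma quad_coef (rho : (I -> R[i]) -> R[i]) (d K m0 : R) a b cub (K3 : R)
    (A B C : 'M[R[i]]_n) :
  0 < d -> 0 < m0 -> 0 <= K3 ->
  (forall x, pdisc (fun=> d) x -> rho x = \sum_j x j * a j
        + \sum_j \sum_k x j * x k * b j k + cub x) ->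
  (forall s : R, 0 < s -> s <= d -> ps (fun=> s) cub (K3 * s ^+ 3)) ->
  (forall z (m : R), 0 <= m -> m <= m0 -> (forall k, cmod (z k) <= m) ->
    cmod (rho (rpt z) - qform A B C z) <= K * m ^+ 3) ->
  (forall k, a (inr k) = 0) /\
  (forall k l, b (inl k) (inr l) + b (inr l) (inl k) = A k l).
Proof.
move=> d0 m00 K30 Hr Hc HQ.
pose lin z := \sum_j rpt z j * a j.
pose quad z := \sum_j \sum_k rpt z j * rpt z k * b j k.
have rptZ (t : R) z : rpt (fun k => t%:C * z k) = (fun j => t%:C * rpt z j).
  by apply/funext => -[k|k] //; rewrite /rpt cconjM cconjR.
(* Scaling [z] by a small real [t] separates the degrees, since linear part and quadratic
   discrepancy together are of order [t ^ 3]. *)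
have sep z : lin z = 0 /\ quad z = qform A B C z.
  pose m1 := \sum_k cmod (z k) + 1.
  have m10 : 0 < m1 by rewrite ltr_wpDl // sumr_ge0 // => k _; exact: cmod_ge0.
  have zm k : cmod (z k) <= m1.
    rewrite (@le_trans _ _ (\sum_k cmod (z k))) ?lerDl //.
    by rewrite (bigD1 k) //= lerDl sumr_ge0 // => j _; exact: cmod_ge0.
  pose dd := Num.min d m0 / m1.
  have dd0 : 0 < dd by rewrite divr_gt0 // lt_min d0.
  suff Hsep (t : R) : 0 < t -> t <= dd ->
      cmod (t%:C * lin z + (t ^+ 2)%:C * (quad z - qform A B C z)) <=
      (K * m1 ^+ 3 + K3 * m1 ^+ 3) * t ^+ 3.
    have [h1 h2] := pow_sep dd0 Hsep.
    by split=> //; apply/eqP; rewrite -subr_eq0 h2.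
  move=> t0; rewrite ler_pdivlMr // le_min => /andP[td tm].
  have tge : 0 <= t by exact: ltW.
  have tz k : cmod (t%:C * z k) <= t * m1.
    by rewrite cmodM cmodR ger0_norm // ler_wpM2l.
  have tm0 : 0 < t * m1 by rewrite mulr_gt0.
  have hp : pdisc (fun=> t * m1) (rpt (fun k => t%:C * z k)).
    by move=> j; case: j => k /=; rewrite ?cmod_conj.
  have hpd : pdisc (fun=> d) (rpt (fun k => t%:C * z k)).
    by move=> j; apply: le_trans (hp j) td.
  have e1 := HQ _ _ (ltW tm0) tm tz.
  have e2 := ps_bound (Hc _ tm0 td) hp.
  have Eq : qform A B C (fun k => t%:C * z k) = (t ^+ 2)%:C * qform A B C z.
    have cR := @cconjR R t.
    have E2 : (t ^+ 2)%:C = t%:C * t%:C :> R[i] by rewrite expr2 rmorphM.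
    rewrite /qform E2 !mulrDr; congr (_ + _ + _).
    - rewrite mulr_sumr; apply: eq_bigr => k _; rewrite mulr_sumr.
      by apply: eq_bigr => l _; rewrite cconjM cR; ring.
    - rewrite mulr_sumr; apply: eq_bigr => k _; rewrite mulr_sumr.
      by apply: eq_bigr => l _; ring.
    - have -> : t%:C * t%:C = (t%:C * t%:C)^* :> R[i] by rewrite cconjM cR.
      rewrite -cconjM; congr (_^*).
      rewrite mulr_sumr; apply: eq_bigr => k _.
      by rewrite mulr_sumr; apply: eq_bigr => l _; ring.
  have El : \sum_j rpt (fun k => t%:C * z k) j * a j = t%:C * lin z.
    by rewrite rptZ mulr_sumr; apply: eq_bigr => j _; ring.
  have Eb : \sum_j \sum_k rpt (fun k => t%:C * z k) j * rpt (fun k => t%:C * z k) k * b j k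
      = (t ^+ 2)%:C * quad z.
    rewrite rptZ expr2 rmorphM mulr_sumr; apply: eq_bigr => j _.
    by rewrite mulr_sumr; apply: eq_bigr => k _; ring.
  have E3 : (K * m1 ^+ 3 + K3 * m1 ^+ 3) * t ^+ 3 =
      K * (t * m1) ^+ 3 + K3 * (t * m1) ^+ 3 by ring.
  rewrite E3.
  have -> : t%:C * lin z + (t ^+ 2)%:C * (quad z - qform A B C z) =
     (rho (rpt (fun k => t%:C * z k)) - qform A B C (fun k => t%:C * z k))
     - cub (rpt (fun k => t%:C * z k)).
    by rewrite Hr // El Eb Eq; ring.
  exact: cmod_le_sub.
have ci := cconji R.
have i0 := i_neq0 R.
have ii := mulii R.
have two0 := @double_eq0 R.
split=> [k|]; first by apply: real_lin0 => z; exact: proj1 (sep z).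
pose A' k l := b (inl k) (inr l) + b (inr l) (inl k) - A k l.
suff H : forall k l, A' k l = 0.
  by move=> k l; apply/eqP; rewrite -subr_eq0; apply/eqP; exact: H.
apply: sesqui0 => z.
pose H1 (z : 'I_n -> R[i]) := \sum_k \sum_l z k * z l * b (inl k) (inl l)
   - \sum_k \sum_l z k * B k l * z l.
pose H2 (z : 'I_n -> R[i]) := \sum_k \sum_l (z k)^* * (z l)^* * b (inr k) (inr l)
   - (\sum_k \sum_l z k * C k l * z l)^*.
pose S (z : 'I_n -> R[i]) := \sum_k \sum_l z k * A' k l * (z l)^*.
have SE w : quad w - qform A B C w = S w + H1 w + H2 w.
  have -> : quad w = \sum_k \sum_l w k * w l * b (inl k) (inl l)
     + \sum_k \sum_l w k * (b (inl k) (inr l) + b (inr l) (inl k)) * (w l)^*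
     + \sum_k \sum_l (w k)^* * (w l)^* * b (inr k) (inr l).
    rewrite /quad big_sumType /=.
    rewrite (eq_bigr _ (fun k _ => big_sumType _ _ _)) /= big_split /=.
    have -> : \sum_(k < n) \sum_j (w k)^* * rpt w j * b (inr k) j =
        \sum_(k < n) \sum_(l < n) (w k)^* * w l * b (inr k) (inl l)
      + \sum_(k < n) \sum_(l < n) (w k)^* * (w l)^* * b (inr k) (inr l).
      by rewrite -big_split; apply: eq_bigr => k _; rewrite big_sumType.
    rewrite !addrA; congr (_ + _); rewrite -!addrA; congr (_ + _).
    rewrite [X in _ + X]exchange_big -big_split; apply: eq_bigr => k _ /=.
    by rewrite -big_split; apply: eq_bigr => l _ /=; ring.
  rewrite /qform /S /A' /H1 /H2.
  have -> : \sum_k \sum_l w k * (b (inl k) (inr l) + b (inr l) (inl k) - A k l) * (w l)^* =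
     \sum_k \sum_l w k * (b (inl k) (inr l) + b (inr l) (inl k)) * (w l)^*
     - \sum_k \sum_l w k * A k l * (w l)^*.
    rewrite -sumrB; apply: eq_bigr => k _; rewrite -sumrB.
    by apply: eq_bigr => l _; ring.
  by ring.
have h1 := SE z; have h2 := SE (fun k => 'i * z k).
have sgn (F : 'I_n -> 'I_n -> R[i]) (G : 'I_n -> 'I_n -> R[i]) (c : R[i]) :
   (forall k l, F k l = c * G k l) ->
   \sum_k \sum_l F k l = c * \sum_k \sum_l G k l.
  move=> h; rewrite mulr_sumr; apply: eq_bigr => k _; rewrite mulr_sumr.
  exact: eq_bigr.
have Si : S (fun k => 'i * z k) = S z.
  rewrite /S -[RHS]mul1r; apply: sgn => k l; rewrite cconjM ci.
  transitivity (- ('i * 'i) * (z k * A' k l * (z l)^*)); first by ring.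
  by rewrite ii opprK.
have H1i : H1 (fun k => 'i * z k) = - H1 z.
  rewrite /H1 -[RHS]mulN1r mulrBr; congr (_ - _); apply: sgn => k l; rewrite -ii; ring.
have H2i : H2 (fun k => 'i * z k) = - H2 z.
  rewrite /H2 -[RHS]mulN1r mulrBr; congr (_ - _).
    by apply: sgn => k l; rewrite !cconjM ci -ii; ring.
  rewrite (sgn _ (fun k l => z k * C k l * z l) (-1)); last first.
    by move=> k l; rewrite -ii; ring.
  by rewrite rmorphM rmorphN1.
apply: two0; rewrite -/(S z).
move: h1 h2; rewrite Si H1i H2i !(proj2 (sep _)) !subrr => e1 e2.
transitivity ((S z + H1 z + H2 z) + (S z - H1 z - H2 z)); first by ring.
by rewrite -e1 -e2 addr0.
Qed.

Lemma grad_taylor3 (I : finType) (d s : R) f B (a : I -> R[i]) b cub (K : R) x i :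
  s < d -> ps (fun=> d) f B ->
  (forall x, pdisc (fun=> d) x -> f x = \sum_j x j * a j
        + \sum_j \sum_k x j * x k * b j k + cub x) ->
  ps (fun=> d) cub K -> pdisc (fun=> s) x ->
  pd i f x = a i + \sum_k x k * (b i k + b k i) + pd i cub x.
Proof.
move=> sd hf Hf hc hx.
have hc' := ps_grad (fun=> sd) hc hx.
have uC (j : I) : unitv j 1 i = unitv i 1 j :> R[i] by rewrite /unitv eq_sym.
have g1 : is_grad (fun y => \sum_j y j * a j) x
    (fun i => \sum_j (unitv j 1 i * a j + x j * 0)).
  by apply: is_grad_sum => j; exact: is_gradM (is_grad_X j x) (is_grad_cst _ x).
have g2 : is_grad (fun y => \sum_j \sum_k y j * y k * b j k) x
    (fun i => \sum_j \sum_k ((unitv j 1 i * x k + x j * unitv k 1 i) * b j k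
        + x j * x k * 0)).
  apply: is_grad_sum => j; apply: is_grad_sum => k.
  exact: is_gradM (is_gradM (is_grad_X j x) (is_grad_X k x)) (is_grad_cst _ x).
rewrite (@eq_pd R I (fun=> d) (fun=> s) f (fun y => \sum_j y j * a j
        + \sum_j \sum_k y j * y k * b j k + cub y)) //; last by exists B.
rewrite {1}/pd (gradE (is_gradD (is_gradD g1 g2) hc')); congr (_ + _ + _).
  rewrite -[RHS]mul1r -(sum_unitv i 1 a); apply: eq_bigr => j _.
  by rewrite mulr0 addr0 uC.
transitivity (\sum_j unitv i 1 j * (\sum_k x k * b j k)
   + \sum_k unitv i 1 k * (\sum_j x j * b j k)).
  under [X in _ = _ + X]eq_bigr do rewrite mulr_sumr.
  rewrite [X in _ = _ + X]exchange_big -big_split; apply: eq_bigr => j _ /=.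
  rewrite mulr_sumr -big_split; apply: eq_bigr => k _ /=.
  by rewrite !uC; ring.
rewrite !sum_unitv !mul1r -big_split; apply: eq_bigr => k _ /=.
by rewrite mulrDr.
Qed.

Theorem complex_extension (ib : bool -> 'I_n) (rho phi : (I -> R[i]) -> R[i])
    (d1 d2 Brho Bphi K m0 : R) (A B C : 'M[R[i]]_n) :
  ib true != ib false -> 0 < d2 -> d2 < d1 ->
  ps (fun=> d1) rho Brho -> ps (fun=> d1) phi Bphi -> rho (fun=> 0) = 0 ->
  (forall j k x, pdisc (fun=> d2) x ->
    pd (inr j) phi x * pd (inr k) rho x = pd (inr k) phi x * pd (inr j) rho x) ->
  A \in unitmx -> 0 < m0 ->
  (forall z (m : R), 0 <= m -> m <= m0 -> (forall k, cmod (z k) <= m) ->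
    cmod (rho (rpt z) - qform A B C z) <= K * m ^+ 3) ->
  exists (kap B : R) Phi, [/\ 0 < kap,
    ps (fun _ : option 'I_n => kap) Phi B &
    forall x, pdisc (fun=> kap) x -> cmod (rho x) <= kap ->
      phi x = Phi (optv (fun k => x (inl k)) (rho x))].
Proof.
move=> ibn d20 d21 hr hp r0 hrel Au m00 HQ.
have d10 : 0 < d1 by lra.
have [a [b [cub [K3 [Hr K30 Hc]]]]] := ps_taylor3 d10 hr.
have {}Hr x : pdisc (fun=> d1) x -> rho x = \sum_j x j * a j
        + \sum_j \sum_k x j * x k * b j k + cub x.
  by move=> /Hr ->; rewrite r0 add0r.
have [a0 bA] := quad_coef d10 m00 K30 Hr Hc HQ.
(* The part of [pd (inr l) rho] linear in [z] is [\sum_k z k * A k l], so this column of the inverse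
   of [A] extracts [z (ib u)]. *)
pose c (u : bool) l := invmx A l (ib u).
pose g k l := b (inr k) (inr l) + b (inr l) (inr k).
pose G u := \sum_l cmod (c u l) * \sum_k cmod (g k l).
pose S u := \sum_l cmod (c u l).
have G0 u : 0 <= G u.
  apply: sumr_ge0 => l _; rewrite mulr_ge0 ?cmod_ge0 //.
  by apply: sumr_ge0 => k _; exact: cmod_ge0.
have S0 u : 0 <= S u by apply: sumr_ge0 => l _; exact: cmod_ge0.
pose GG := G true + G false; pose SS := S true + S false.
have GGu u : G u <= GG by rewrite /GG; case: u; rewrite ?lerDl ?lerDr.
have SSu u : S u <= SS by rewrite /SS; case: u; rewrite ?lerDl ?lerDr.
have GG0 : 0 <= GG by exact: le_trans (G0 true) (GGu true).
have SS0 : 0 <= SS by exact: le_trans (S0 true) (SSu true).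
(* The part linear in [zeta], with coefficients [g], need not be small on a polydisc with equal
   radii. With radius [eps * sg] in [zeta] it contributes at most [sg / 16]. *)
pose eps := Num.min 1 (1 / 16 / (GG + 1)).
have eps0 : 0 < eps by rewrite lt_min ltr01 !divr_gt0 // ltr_wpDl.
have eps1 : eps <= 1 by rewrite ge_min lexx.
have epsG : eps * GG <= 1 / 16.
  have : eps * (GG + 1) <= 1 / 16.
    by rewrite -ler_pdivlMr ?ltr_wpDl // ge_min lexx orbT.
  nra.
have KS0 : 0 <= K3 * SS by rewrite mulr_ge0.
(* A Cauchy estimate from radius [2 * sg] bounds the derivatives of the cubic remainder by
   [8 * K3 * sg ^ 2]; the 128 makes their contribution the other [sg / 16], and [d1 / 4] leaves room
   for the doubled radius. *)
pose theta := Num.min (Num.min d2 (d1 / 4)) (1 / 128 / (K3 * SS + 1)).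
have theta0 : 0 < theta by rewrite !lt_min d20 !divr_gt0 // ltr_wpDl.
have td2 : theta <= d2 by rewrite !ge_min lexx.
have td1 : theta <= d1 / 4 by rewrite !ge_min lexx orbT.
have tK : theta * (K3 * SS) <= 1 / 128.
  have : theta * (K3 * SS + 1) <= 1 / 128.
    by rewrite -ler_pdivlMr ?ltr_wpDl // ge_min lexx orbT.
  nra.
apply: (@key_extension R n ib rho phi d1 d2 Brho Bphi eps theta c) => //.
move=> u sg sg0 sgt.
have rge (i : I) : 0 <= birad eps sg i by case: i => k /=; rewrite ?mulr_ge0 ?ltW.
have rle (i : I) : birad eps sg i <= sg.
  by case: i => k //=; rewrite ler_piMl // ltW.
have hpc l : ps (birad eps sg) (pd (inr l) cub) (K3 * (2 * sg) ^+ 3 / sg).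
  apply: (@ps_radii R I (fun=> sg) (birad eps sg) _ _ rge rle).
  apply: (ps_pd (s := fun=> 2 * sg)) => // [i| |]; try lra.
  by apply: Hc; [rewrite mulr_gt0|lra].
have hz l : ps (birad eps sg) (fun x => \sum_k g k l * x (inr k))
    (\sum_k cmod (g k l) * (eps * sg)).
  by apply: (ps_bigsum rge) => k; exact: ps_scale (ps_X rge (inr k)).
have hF := ps_add rge
  (ps_bigsum rge (index_enum 'I_n) (fun l => ps_scale rge (c u l) (hz l)))
  (ps_bigsum rge (index_enum 'I_n) (fun l => ps_scale rge (c u l) (hpc l))).
apply: (ps_le rge hF) => [|x hx].
  have -> : \sum_l cmod (c u l) * (\sum_k cmod (g k l) * (eps * sg)) =
      sg * (eps * G u).
    rewrite /G mulr_sumr mulr_sumr; apply: eq_bigr => l _.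
    by rewrite -mulr_suml; ring.
  rewrite -mulr_suml -/(S u).
  have -> : S u * (K3 * (2 * sg) ^+ 3 / sg) = sg * (8 * (sg * (K3 * S u))).
    by field; rewrite gt_eqF.
  rewrite -mulrDr; apply: ler_wpM2l; first exact: ltW.
  have h1 : eps * G u <= eps * GG by rewrite ler_wpM2l // ltW.
  have h2 : K3 * S u <= K3 * SS by rewrite ler_wpM2l.
  have h3 : 0 <= K3 * S u by rewrite mulr_ge0.
  have h4 : sg * (K3 * S u) <= theta * (K3 * SS).
    by apply: ler_pM => //; exact: ltW.
  lra.
have hxs : pdisc (fun=> sg) x by move=> i; exact: le_trans (hx i) (rle i).
have sd1 : sg < d1 by lra.
rewrite /errt.
have E l : pd (inr l) rho x = \sum_k x (inl k) * A k l
    + \sum_k g k l * x (inr k) + pd (inr l) cub x.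
  rewrite (grad_taylor3 (inr l) sd1 hr Hr (Hc _ d10 (lexx _)) hxs) a0 add0r.
  rewrite big_sumType /=; congr (_ + _ + _); apply: eq_bigr => k _.
    by rewrite -bA; congr (_ * _); exact: addrC.
  by rewrite /g mulrC; congr (_ * _); exact: addrC.
under eq_bigr do rewrite E !mulrDr.
rewrite !big_split /=.
have -> : \sum_l c u l * (\sum_k x (inl k) * A k l) = x (inl (ib u)).
  transitivity (\sum_k x (inl k) * (A *m invmx A) k (ib u)).
    under eq_bigr do rewrite mulr_sumr.
    rewrite exchange_big; apply: eq_bigr => k _ /=.
    by rewrite mxE mulr_sumr; apply: eq_bigr => l _; rewrite /c; ring.
  rewrite mulmxV // (bigD1 (ib u)) //= mxE eqxx mulr1 big1 ?addr0 // => k /negPf h.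
  by rewrite mxE h mulr0.
by ring.
Qed.

End ComplexExtension.

(** * Real coordinates *)

Lemma differentiable_of_bound (K : numFieldType) (V W : normedModType K)
    (f : V -> W) (df : {linear V -> W}) (x : V) : continuous df ->
  (forall e : K, 0 < e -> \forall h \near (0 : V),
    `|f (h + x) - f x - df h| <= e * `|h|) -> differentiable f x.
Proof.
move=> dc H.
have ex : f \o shift x = cst (f x) + df +o_ 0 id.
  apply/eqaddoP => e e0; near=> h.
  have -> : (f \o shift x - (cst (f x) + df)) h = f (h + x) - f x - df h.
    by rewrite !fctE /= opprD addrA.
  by near: h; exact: H.
by apply/diff_locallyP; rewrite (diff_unique dc ex).
Unshelve. all: by end_near.
Qed.

(** * Neighbourhoods and differentiability on complex row vectors *)

Section RowVectors.
Variables (R : realType) (n : nat).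
Implicit Types (x p h : 'rV[R[i]]_n).

(** Radii of balls in ['rV[R[i]]_n] are elements of [R[i]]; positivity forces them to be real, which
    brings neighbourhoods back to [cmod]. *)
Lemma pos_complex (e : R[i]) : 0 < e -> exists2 r : R, 0 < r & e = r%:C.
Proof.
move=> e0; exists (complex.Re e).
  by move: e0; rewrite ltcE => /andP[].
by rewrite RRe_real // gtr0_real.
Qed.

Lemma ball_rvP x (e : R) y : 0 < e ->
  ball x e%:C y <-> forall j, cmod (y 0 j - x 0 j) < e.
Proof.
move=> e0.
have bE (a b : R[i]) : ball a e%:C b <-> cmod (b - a) < e.
  by rewrite -ltcR cmodE distrC; split.
split=> [[_ H] j|H]; first by apply/bE; exact: H.
split; first by rewrite ltcR.
by move=> i j; rewrite ord1; apply/bE.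
Qed.

Lemma near_rvP x (P : 'rV[R[i]]_n -> Prop) :
  (\forall y \near x, P y) <->
  exists e : R, 0 < e /\
    forall y : 'rV[R[i]]_n, (forall j, cmod (y 0 j - x 0 j) < e) -> P y.
Proof.
split.
  move=> /nbhs_ballP[e /= /pos_complex[r r0 ->] H].
  by exists r; split=> // y hy; apply: H; apply/ball_rvP.
move=> [e [e0 H]]; apply/nbhs_ballP; exists e%:C; first by rewrite /= ltcR.
by move=> y /ball_rvP => /(_ e0); exact: H.
Qed.

Lemma rv_norm_le h (m : R) : 0 <= m -> (forall j, cmod (h 0 j) <= m) ->
  `|h| <= m%:C.
Proof.
move=> m0 H; have [h0|h0] := eqVneq (mx_norm h) 0.
  by rewrite /Num.Def.normr /= h0 lecR.
have [[i j] /= E] := mx_norm_neq0 h0.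
by rewrite /Num.Def.normr /= E ord1 -cmodE lecR.
Qed.

Lemma rv_norm_real h : `|h| = (complex.Re `|h|)%:C.
Proof. by rewrite RRe_real // normr_real. Qed.

Lemma rv_norm_ge h j : cmod (h 0 j) <= complex.Re `|h|.
Proof.
have E := rv_norm_real h.
set m := complex.Re _ in E *.
have m0 : 0 <= m by rewrite -lecR -E normr_ge0.
apply/ler_addgt0Pr => e e0; apply: ltW.
have me : 0 < m + e by rewrite ltr_wpDl.
have := (ball_rvP 0 h me).1 _ j; rewrite mxE subr0; apply.
by rewrite mx_norm_ball /ball_ /= sub0r normrN E ltcR ltrDl.
Qed.

Lemma differentiable_rv (f : 'rV[R[i]]_n -> R[i]^o) x (a : 'I_n -> R[i]) (K d : R) :
  0 < d -> (forall h (m : R), 0 <= m -> m <= d -> (forall j, cmod (h 0 j) <= m) ->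
    cmod (f (h + x) - f x - \sum_j h 0 j * a j) <= K * m ^+ 2) ->
  differentiable f x.
Proof.
move=> d0 H.
pose df (h : 'rV[R[i]]_n) : R[i]^o := \sum_j h 0 j * a j.
have dlin : linear df.
  move=> c u v; rewrite /df scaler_sumr -big_split; apply: eq_bigr => j _ /=.
  by rewrite !mxE mulrDl -mulrA.
pose dfM := GRing.isLinear.Build _ _ _ _ df dlin.
pose dfL : {linear 'rV[R[i]]_n -> R[i]^o} := HB.pack df dfM.
have S0 : 0 < \sum_j cmod (a j) + 1.
  by rewrite ltr_wpDl // sumr_ge0 // => j _; exact: cmod_ge0.
have dc : continuous dfL.
  move=> u; apply/(@cvgrPdist_le R[i] R[i]^o _ (nbhs u) (nbhs_filter u)).
  move=> /= e /pos_complex[r r0 ->].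
  apply/near_rvP; exists (r / (\sum_j cmod (a j) + 1)); split.
    by rewrite divr_gt0.
  move=> v hv; rewrite -cmodE lecR /df -sumrB.
  apply: le_trans (cmod_sum _ _ _) _.
  apply: (@le_trans _ _ (\sum_j r / (\sum_j cmod (a j) + 1) * cmod (a j))).
    apply: ler_sum => j _; rewrite -mulrBl cmodM ler_wpM2r ?cmod_ge0 //.
    by rewrite cmodB ltW.
  rewrite -mulr_sumr -mulrA; apply: ler_piMr; first exact: ltW.
  by rewrite ler_pdivrMl // mulr1 lerDl.
apply: (differentiable_of_bound dc) => /= e /pos_complex[r r0 ->].
  have K1 : 0 < `|K| + 1 by rewrite ltr_wpDl.
  apply/near_rvP; exists (Num.min d (r / (`|K| + 1))); split.
    by rewrite lt_min d0 divr_gt0.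
  move=> h hh; rewrite rv_norm_real -cmodE -rmorphM lecR.
  set m := complex.Re _.
  have hm j : cmod (h 0 j) <= m by exact: rv_norm_ge.
  have m0 : 0 <= m by rewrite -lecR -rv_norm_real normr_ge0.
  have mE : m <= Num.min d (r / (`|K| + 1)).
    rewrite -lecR -rv_norm_real; apply: rv_norm_le => [|j].
      by rewrite le_min !ltW ?divr_gt0.
    by have := hh j; rewrite mxE subr0 => /ltW.
  move: mE; rewrite le_min => /andP[md mr].
  have := H h m m0 md hm.
  move=> /le_trans; apply.
  have : m * (`|K| + 1) <= r by rewrite -ler_pdivlMr.
  have := ler_norm K; rewrite expr2 mulrA; nra.
Qed.

End RowVectors.

Section Realify.
Variables (R : realType) (n : nat).

Definition cplx (v : 'rV[R]_(n + n)) : 'rV[R[i]]_n :=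
  \row_j (v 0 (lshift n j) +i* v 0 (rshift n j)).

Lemma realifyK : cancel (@realify R n) cplx.
Proof.
move=> z; apply/rowP => j; rewrite /realify /cplx mxE row_mxEl row_mxEr !mxE.
by case: (z 0 j).
Qed.

Lemma cplxK : cancel cplx (@realify R n).
Proof.
move=> v; rewrite /realify -[RHS]hsubmxK; congr row_mx; apply/rowP => j.
  by rewrite !mxE.
by rewrite !mxE.
Qed.

Lemma realifyD : {morph @realify R n : x y / x + y}.
Proof.
move=> x y; rewrite /realify add_row_mx; congr row_mx; apply/rowP => j;
  by rewrite !mxE; case: (x 0 j) (y 0 j) => ? ? [].
Qed.

Lemma realify_J (z : 'rV[R[i]]_n) : realify z *m Jmx R n = realify ('i *: z).
Proof.
rewrite /realify /Jmx mul_row_block !mulmx0 mulmx1 mulmxN mulmx1 add0r addr0.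
by congr row_mx; apply/rowP => j; rewrite !mxE /=; case: (z 0 j) => a b /=; ring.
Qed.

Lemma is_deriveE (f : R -> R) (t df : R) : is_derive t (1 : R) f df ->
  forall e : R, 0 < e -> exists d : R, 0 < d /\ forall h : R, `|h| <= d ->
    `|f (t + h) - f t - h * df| <= e * `|h|.
Proof.
move=> [dv <-] e e0.
move: dv => /cvgrPdist_le /(_ _ e0) /nbhs_ballP[d /= d0 H].
exists (d / 2); split=> [|h hd]; first by rewrite divr_gt0.
have [->|h0] := eqVneq h 0; first by rewrite addr0 subrr mul0r subrr normr0 mulr0.
have := H h; rewrite /ball /= sub0r normrN => /(_ _ h0).
have hd' : `|h| < d by apply: le_lt_trans hd _; rewrite ltr_pdivrMr // ltr_pMr // ltr1n.
move=> /(_ hd'); rewrite /GRing.scale /= mulr1 [h + t]addrC -/('D_1 f t).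
set D := 'D_1 f t => h1.
have -> : f (t + h) - f t - h * D = (h^-1 * (f (t + h) - f t) - D) * h.
  by field.
by rewrite normrM ler_wpM2r // distrC.
Qed.

Lemma is_derive_realifyP (g : R -> 'rV[R[i]]_n) (v : 'rV[R]_(n + n)) :
  is_derive (0 : R) (1 : R) (fun t => realify (g t)) v <->
  forall j, has_vel (fun t => g t 0 j) 0 (cplx v 0 j).
Proof.
have El t j : realify (g t) 0 (lshift n j) = complex.Re (g t 0 j).
  by rewrite /realify row_mxEl mxE.
have Er t j : realify (g t) 0 (rshift n j) = complex.Im (g t 0 j).
  by rewrite /realify row_mxEr mxE.
split=> [H j|H].
  have [dv vE] := H.
  have hcomp k : is_derive (0 : R) (1 : R) (fun t => realify (g t) 0 k) (v 0 k).
    apply: DeriveDef; first exact: (derivable_mxP _ _ _).1.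
    by rewrite -vE (derive_mx dv) mxE.
  have h1 := hcomp (lshift n j); have h2 := hcomp (rshift n j).
  have {}h1 : is_derive (0 : R) (1 : R) (fun t => complex.Re (g t 0 j)) (v 0 (lshift n j)).
    by move: h1; congr is_derive; apply/funext => t; rewrite El.
  have {}h2 : is_derive (0 : R) (1 : R) (fun t => complex.Im (g t 0 j)) (v 0 (rshift n j)).
    by move: h2; congr is_derive; apply/funext => t; rewrite Er.
  move=> e e0; have e2 : 0 < e / 2 by rewrite divr_gt0.
  have [d1 [d10 H1]] := is_deriveE h1 e2; have [d2 [d20 H2]] := is_deriveE h2 e2.
  exists (Num.min d1 d2); split; first by rewrite lt_min d10.
  move=> h; rewrite le_min => /andP[/H1 k1 /H2 k2].
  apply: le_trans (cmod_le_ReIm _) _.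
  have ER (x y : R[i]) (a b : R) : complex.Re (x - y - h%:C * (a +i* b)) =
    complex.Re x - complex.Re y - h * a by case: x y => ? ? [? ?] /=; ring.
  have EI (x y : R[i]) (a b : R) : complex.Im (x - y - h%:C * (a +i* b)) =
    complex.Im x - complex.Im y - h * b by case: x y => ? ? [? ?] /=; ring.
  by rewrite mxE ER EI (splitr e) mulrDl lerD.
have hcomp k : is_derive (0 : R) (1 : R) (fun t => realify (g t) 0 k) (v 0 k).
  case: (split_ordP k) => j ->.
    have := has_vel_Re (H j); rewrite mxE /=.
    by congr is_derive; apply/funext => t; rewrite El.
  have := has_vel_Im (H j); rewrite mxE /=.
  by congr is_derive; apply/funext => t; rewrite Er.
have dv : derivable (fun t => realify (g t)) (0 : R) 1.
  by apply/derivable_mxP => i j; rewrite ord1; have [] := hcomp j.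
apply: DeriveDef => //; rewrite (derive_mx dv); apply/rowP => k; rewrite mxE.
by have [_ ->] := hcomp k.
Qed.

Lemma has_vel_uniq (c : R -> R[i]) t v v' : has_vel c t v -> has_vel c t v' -> v = v'.
Proof.
move=> h h'; apply/eqP; rewrite -subr_eq0; apply/eqP; apply: cmod_le0 => e e0.
have e2 : 0 < e / 2 by rewrite divr_gt0.
have [d [d0 H]] := h _ e2; have [d' [d'0 H']] := h' _ e2.
pose u := Num.min d d'; have u0 : 0 < u by rewrite lt_min d0.
have uE : `|u| = u by rewrite gtr0_norm.
have k1 := H u; have k2 := H' u; rewrite uE in k1 k2.
have {}k1 := k1 ltac:(by rewrite ge_min lexx).
have {}k2 := k2 ltac:(by rewrite ge_min lexx orbT).
have := cmod_le_sub k2 k1.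
set F := c (t + u) - c t.
have -> : F - u%:C * v' - (F - u%:C * v) = u%:C * (v - v') by ring.
by rewrite cmodM cmodR uE -mulrDl -splitr mulrC ler_pM2r.
Qed.

End Realify.

(** * Complexification of real-analytic functions *)

Section Complexify.
Variable R : realType.

Lemma ps_bigprod (I J : Type) (s : I -> R) (F : J -> (I -> R[i]) -> R[i])
    (B : J -> R) (r : seq J) : (forall i, 0 <= s i) -> (forall j, ps s (F j) (B j)) ->
  ps s (fun x => \prod_(j <- r) F j x) (\prod_(j <- r) B j).
Proof.
move=> s0 h; elim: r => [|j r IH].
  rewrite big_nil; apply: (ps_le s0 (ps_cst s 1)) => [|x _].
    by rewrite cmod1.
  by rewrite big_nil.
rewrite big_cons; apply: (ps_le s0 (ps_mul s0 (h j) IH)) => // x _.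
by rewrite big_cons.
Qed.

(** [has_sum] runs over finite sets of multi-indices, [ps_sum] over initial segments of [nat]. The
    sets of codes below [N] link the two, being eventually larger than any finite set. *)
Fixpoint penum (K : countType) (N : nat) : {fset K} :=
  if N is N'.+1 then
    if pickle_inv N' is Some k then (k |` penum K N')%fset else penum K N'
  else fset0.

Lemma in_penum (K : countType) N (k : K) : (k \in penum K N) = (choice.pickle k < N)%N.
Proof.
elim: N => [|N IH] //=; rewrite ltnS leq_eqVlt -IH.
have := @pickle_invK K N; case E : (pickle_inv N) => [k'|] /= H.
  rewrite in_fset1U -H; congr (_ || _); apply/eqP/eqP => [-> //|].
  exact: (pcan_inj pickleK_inv).
case: eqP => // h; by rewrite -h pickleK_inv in E.
Qed.

Lemma penum_sum (K : countType) (V : nmodType) (F : K -> V) N :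
  \sum_(k <- penum K N) F k =
  \sum_(j < N) (if pickle_inv j is Some k then F k else 0).
Proof.
elim: N => [|N IH]; first by rewrite big_seq_fset0 big_ord0.
rewrite big_ord_recr /= -IH.
have := @pickle_invK K N; case: (pickle_inv N) => [k|] /= H; last by rewrite addr0.
rewrite big_fsetU1 /= 1?addrC // in_penum -H ltnn //.
Qed.

(** Two finite sums containing [A] differ by at most 2, so finite sums away from [A] are at most 2
    in modulus. Applied to the nonnegative and to the negative terms, this gives the 4. *)
Lemma has_sum_bounded (K : choiceType) (f : K -> R) l : has_sum f l ->
  exists B, forall S : {fset K}, \sum_(k <- S) `|f k| <= B.
Proof.
move=> /(_ _ ltr01)[A HA].
exists (\sum_(k <- A) `|f k| + 4) => S.
have part (P : pred K) : `|\sum_(k <- S | (k \notin A) && P k) f k| <= 2.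
  pose T := [fset k in S | (k \notin A) && P k]%fset.
  have h1 := HA A (fsubset_refl A).
  have h2 := HA (A `|` T)%fset (fsubsetUl A T).
  have E : \sum_(k <- (A `|` T)%fset) f k = \sum_(k <- A) f k + \sum_(k <- T) f k.
    rewrite (big_fsetID _ (mem A)); congr (_ + _); apply: eq_fbigl => k;
      by rewrite !inE /=; case: (k \in A); rewrite ?andbF ?andbT.
  rewrite big_fset_condE -/T.
  have -> : \sum_(k <- T) f k =
     (\sum_(k <- (A `|` T)%fset) f k - l) - (\sum_(k <- A) f k - l).
    by rewrite E; ring.
  apply: le_trans (ler_normB _ _) _; lra.
have hD : \sum_(k <- S | k \notin A) `|f k| <= 4.
  rewrite (bigID (fun k => 0 <= f k)) /=.
  have -> : \sum_(k <- S | (k \notin A) && (0 <= f k)) `|f k| =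
      \sum_(k <- S | (k \notin A) && (0 <= f k)) f k.
    by apply: eq_bigr => k /andP[_]; exact: ger0_norm.
  have -> : \sum_(k <- S | (k \notin A) && ~~ (0 <= f k)) `|f k| =
      - \sum_(k <- S | (k \notin A) && ~~ (0 <= f k)) f k.
    by rewrite -sumrN; apply: eq_bigr => k /andP[_]; rewrite -ltNge; exact: ltr0_norm.
  have := part (fun k => 0 <= f k); have := part (fun k => ~~ (0 <= f k)).
  rewrite !ler_norml => /andP[h1 h2] /andP[h3 h4]; lra.
rewrite (bigID (fun k => k \in A)) /=; apply: lerD => //.
rewrite [leRHS](bigID (fun k => k \in S)) /=.
rewrite (@eq_fbigl_cond _ _ _ _ S A _ (fun k => k \in S)) => [|k].
  by rewrite lerDl sumr_ge0.
by rewrite !inE /= andbC.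
Qed.

Lemma analytic_complexify m (f : 'rV[R]_m -> R) (a : 'rV[R]_m) : analytic_at f a ->
  exists (F : ('I_m -> R[i]) -> R[i]) (B r : R), [/\ 0 < r, ps (fun=> r) F B &
    forall x : 'rV[R]_m, (forall i, `|x 0 i - a 0 i| <= r) ->
      F (fun i => (x 0 i - a 0 i)%:C) = (f x)%:C].
Proof.
move=> [c [r0 [r00 Hf]]].
pose r := r0 / 2; have r_gt0 : 0 < r by rewrite divr_gt0.
have rr0 : r < r0 by rewrite /r; lra.
have r_ge (i : 'I_m) : 0 <= r by exact: ltW.
pose K := {ffun 'I_m -> nat}.
(* At the corner [a + r] of the polydisc the monomials equal the weights of [ps], so summability at
   this one real point bounds the coefficient norm. *)
have [B HB] : exists B, forall S : {fset K},
    \sum_(k <- S) `|c k * \prod_(i < m) r ^+ k i| <= B.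
  apply: (@has_sum_bounded K _ (f (\row_i (a 0 i + r)))).
  have := Hf (\row_i (a 0 i + r)) _.
  have -> : (fun k : K => c k * \prod_(i < m) ((\row_i (a 0 i + r)) 0 i - a 0 i) ^+ k i)
     = (fun k : K => c k * \prod_(i < m) r ^+ k i).
    by apply/funext => k; congr (_ * _); apply: eq_bigr => i _; rewrite mxE addrC addKr.
  by apply=> i; rewrite mxE addrC addKr gtr0_norm.
pose mon (k : K) (x : 'I_m -> R[i]) : R[i] := (c k)%:C * \prod_(i < m) x i ^+ k i.
pose F j x := if pickle_inv j is Some k then mon k x else 0.
pose b j := if pickle_inv j is Some k then `|c k * \prod_(i < m) r ^+ k i| else 0.
have hF j : ps (fun=> r) (F j) (b j).
  rewrite /F /b; case: (pickle_inv j) => [k|]; last first.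
    by apply: ps_cstW => //; rewrite cmod0.
  have p0 : 0 <= \prod_(i < m) r ^+ k i.
    by apply: prodr_ge0 => i _; apply: exprn_ge0; exact: ltW.
  rewrite normrM -cmodR (ger0_norm p0).
  apply: (ps_scale r_ge); apply: (@ps_bigprod _ _ _ (fun i x => x i ^+ k i)
    (fun i => r ^+ k i) _ r_ge) => i.
  exact: (ps_exp r_ge _ (ps_X r_ge i)).
have [N|G [hG HG]] := ps_series (b := B) hF.
  by rewrite -(penum_sum (fun k : K => `|c k * \prod_(i < m) r ^+ k i|)).
exists G, B, r; split=> // x hx.
pose y i := (x 0 i - a 0 i)%:C : R[i].
have hy : pdisc (fun=> r) y by move=> i; rewrite cmodR.
apply: (clim_unique (HG y hy)) => e e0.
have [A HA] := Hf x (fun i => le_lt_trans (hx i) rr0) e e0.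
pose N := (\max_(k <- A) (choice.pickle k).+1)%N.
exists N => M NM.
have sub : (A `<=` penum K M)%fset.
  apply/fsubsetP => k kA; rewrite in_penum; apply: leq_trans NM.
  by rewrite /N (big_rem k) //= leq_maxl.
have := HA _ sub.
have -> : \sum_(j < M) F j y = (\sum_(k <- penum K M)
    c k * \prod_(i < m) (x 0 i - a 0 i) ^+ k i)%:C.
  rewrite penum_sum rmorph_sum; apply: eq_bigr => j _ /=; rewrite /F.
  case: (pickle_inv j) => [k|] //; rewrite /mon rmorphM rmorph_prod; congr (_ * _).
  by apply: eq_bigr => i _; rewrite rmorphXn.
by rewrite -rmorphB cmodR => /ltW.
Qed.

End Complexify.

(** * CR geometry of a graph *)

Lemma has_vel_small (R : realType) (c : R -> R[i]) t v (r : R) :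
  has_vel c t v -> cmod (c t) < r ->
  exists d : R, 0 < d /\ forall h : R, `|h| <= d -> cmod (c (t + h)) < r.
Proof.
move=> /(_ 1 ltr01)[d [d0 H]] hr.
have v1 : 0 < cmod v + 1 by rewrite ltr_wpDl ?cmod_ge0.
exists (Num.min d ((r - cmod (c t)) / 2 / (cmod v + 1))); split.
  by rewrite lt_min d0 !divr_gt0 // subr_gt0.
move=> h; rewrite le_min => /andP[/H h1]; rewrite ler_pdivlMr // => h2.
have -> : c (t + h) = c t + h%:C * v + (c (t + h) - c t - h%:C * v) by ring.
apply: le_lt_trans (cmod_le_add (cmodD _ _) h1) _.
by rewrite cmodM cmodR; lra.
Qed.

Lemma near0P (R : realType) (P : R -> Prop) : (\forall t \near (0 : R), P t) <->
  exists d : R, 0 < d /\ forall t : R, `|t| <= d -> P t.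
Proof.
split.
  move=> /nbhs_ballP[d /= d0 H]; exists (d / 2); split; first by rewrite divr_gt0.
  move=> t ht; apply: H; rewrite /ball /= sub0r normrN.
  by apply: le_lt_trans ht _; rewrite ltr_pdivrMr // ltr_pMr // ltr1n.
move=> [d [d0 H]]; apply/nbhs_ballP; exists d => // t.
by rewrite /ball /= sub0r normrN => /ltW; exact: H.
Qed.

Lemma mulmx_bound (R : realType) m n (A : 'M[R[i]]_(m, n)) :
  exists C : R, 0 < C /\ forall (y : 'rV[R[i]]_m) (b : R), 0 <= b ->
    (forall i, cmod (y 0 i) <= b) -> forall j, cmod ((y *m A) 0 j) <= C * b.
Proof.
exists (\sum_i \sum_j cmod (A i j) + 1).
have S0 : 0 <= \sum_i \sum_j cmod (A i j).
  by apply: sumr_ge0 => i _; apply: sumr_ge0 => j _; exact: cmod_ge0.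
split=> [|y b b0 H j]; first by rewrite ltr_wpDl.
rewrite mxE; apply: le_trans (cmod_sum _ _ _) _.
apply: (@le_trans _ _ (\sum_i cmod (A i j) * b)).
  by apply: ler_sum => i _; rewrite cmodM mulrC ler_wpM2l ?cmod_ge0.
rewrite -mulr_suml ler_wpM2r // (@le_trans _ _ (\sum_i \sum_j cmod (A i j))) ?lerDl //.
apply: ler_sum => i _; rewrite (bigD1 j) //= lerDl.
by apply: sumr_ge0 => k _; exact: cmod_ge0.
Qed.

Section Graph.
Variables (R : realType) (n : nat).
Local Notation I := ('I_n + 'I_n)%type.
Variables (M : set 'rV[R[i]]_n.+1) (p : 'rV[R[i]]_n.+1) (U : 'M[R[i]]_n.+1).
Local Notation V := (invmx U).

Definition yc (x : 'rV[R[i]]_n.+1) : 'rV[R[i]]_n.+1 := (x - p) *m U.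
Definition zc x : 'I_n -> R[i] := fun k => yc x 0 (lift ord_max k).
Definition wc x : R[i] := yc x 0 ord_max.
Definition rzw (z : 'I_n -> R[i]) (w : R[i]) : 'rV[R[i]]_n.+1 :=
  \row_j optv z w (unlift ord_max j).
Definition xp z w : 'rV[R[i]]_n.+1 := p + rzw z w *m V.

Lemma rzw_lift z w k : rzw z w 0 (lift ord_max k) = z k.
Proof. by rewrite mxE liftK. Qed.

Lemma rzw_max z w : rzw z w 0 ord_max = w.
Proof. by rewrite mxE unlift_none. Qed.

Lemma rowP_max (x y : 'rV[R[i]]_n.+1) :
  (forall k, x 0 (lift ord_max k) = y 0 (lift ord_max k)) ->
  x 0 ord_max = y 0 ord_max -> x = y.
Proof.
by move=> h1 h2; apply/rowP => j; case: (unliftP ord_max j) => [k ->|->].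
Qed.

Lemma forall_max (P : 'I_n.+1 -> Prop) :
  (forall k, P (lift ord_max k)) -> P ord_max -> forall j, P j.
Proof. by move=> h1 h2 j; case: (unliftP ord_max j) => [k ->|->]. Qed.

Hypothesis Uu : U \in unitmx.

Lemma yc_xp z w : yc (xp z w) = rzw z w.
Proof. by rewrite /yc /xp addrC addKr mulmxKV. Qed.

Lemma zc_xp z w : zc (xp z w) = z.
Proof. by apply/funext => k; rewrite /zc yc_xp rzw_lift. Qed.

Lemma wc_xp z w : wc (xp z w) = w.
Proof. by rewrite /wc yc_xp rzw_max. Qed.

Lemma xp_yc x : xp (zc x) (wc x) = x.
Proof.
rewrite /xp; have -> : rzw (zc x) (wc x) = yc x.
  by apply: rowP_max => [k|]; rewrite ?rzw_lift ?rzw_max.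
by rewrite /yc mulmxK // addrC subrK.
Qed.

Lemma yc_cont : exists C : R, 0 < C /\
  forall (x x' : 'rV[R[i]]_n.+1) (m : R), 0 <= m ->
  (forall j, cmod (x 0 j - x' 0 j) <= m) ->
  forall j, cmod (yc x 0 j - yc x' 0 j) <= C * m.
Proof.
have [C [C0 HC]] := mulmx_bound U; exists C; split=> // x x' m m0 H j.
have E : (x - p) *m U = (x - x') *m U + (x' - p) *m U.
  by rewrite -mulmxDl addrA subrK.
rewrite /yc E [X in X - _]mxE addrK; apply: HC => // i.
by rewrite !mxE.
Qed.

Variables (rho phic : (I -> R[i]) -> R[i]) (phi : 'rV[R[i]]_n.+1 -> R[i]).
Variables (dl d Brho Bphi : R).
Hypotheses (d_gt0 : 0 < d) (ddl : d < dl).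
Hypotheses (hrho : ps (fun=> dl) rho Brho) (hphi : ps (fun=> dl) phic Bphi).
Hypothesis rho_small : ps (fun=> d) rho (dl / 2).
Hypothesis graphP : forall x, (forall j, cmod (yc x 0 j) <= dl) ->
  (M x <-> wc x = rho (rpt (zc x))).
Hypothesis phiP : forall x, (forall j, cmod (yc x 0 j) <= dl) -> M x ->
  phi x = phic (rpt (zc x)).

Let small (z : 'I_n -> R[i]) := forall k, cmod (z k) < d.

Definition gpt z := xp z (rho (rpt z)).

Let rpt_small z : small z -> pdisc (fun=> d) (rpt z).
Proof. by move=> h [k|k] /=; rewrite ?cmod_conj ltW. Qed.

Let grho z : small z -> is_grad rho (rpt z) (grad rho (rpt z)).
Proof. by move=> /rpt_small; apply: ps_grad hrho. Qed.

Let gphi z : small z -> is_grad phic (rpt z) (grad phic (rpt z)).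
Proof. by move=> /rpt_small; apply: ps_grad hphi. Qed.

Let yc_gpt z : small z -> forall j, cmod (yc (gpt z) 0 j) <= dl.
Proof.
have [h0 h1] := conj d_gt0 ddl.
move=> hz; rewrite /gpt yc_xp; apply: forall_max => [k|].
  by rewrite rzw_lift; have := hz k; lra.
by rewrite rzw_max; have := ps_bound rho_small (rpt_small hz); lra.
Qed.

Lemma gpt_in z : small z -> M (gpt z).
Proof.
move=> hz; apply/graphP; first exact: yc_gpt.
by rewrite /gpt wc_xp zc_xp.
Qed.

Definition dpt (z v : 'I_n -> R[i]) := \sum_j rpt v j * grad rho (rpt z) j.
Definition tvec z v := rzw v (dpt z v).
(** The antiholomorphic part of the differential of the graph function in direction [v]; its
    vanishing singles out the complex tangent directions. *)
Definition duz (z v : 'I_n -> R[i]) := \sum_k (v k)^* * pd (inr k) rho (rpt z).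

Lemma yc_vel (g : R -> 'rV[R[i]]_n.+1) vec :
  is_derive (0 : R) (1 : R) (fun t => realify (g t)) vec ->
  forall j, has_vel (fun t => yc (g t) 0 j) 0 ((cplx vec *m U) 0 j).
Proof.
move=> /is_derive_realifyP hg j.
rewrite mxE; have := has_vel_sum (index_enum _) (c := fun i t => U i j * (- p 0 i + g t 0 i))
  (v := fun i => U i j * (0 + cplx vec 0 i)) (t := 0) _.
set P := (X in X -> _); move=> H.
have {}H := H (fun i => has_velM _ (has_velD (has_vel_cst _ _) (hg i))).
move: H; congr has_vel.
  apply/funext => t; rewrite /yc mxE; apply: eq_bigr => i _.
  by rewrite !mxE addrC mulrC.
by apply: eq_bigr => i _; rewrite add0r mulrC.
Qed.

Let rpt_vel (z : R -> 'I_n -> R[i]) (v : 'I_n -> R[i]) :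
  (forall k, has_vel (z ^~ k) 0 (v k)) ->
  forall j, has_vel (fun t => rpt (z t) j) 0 (rpt v j).
Proof. by move=> h [k|k] /=; [exact: h|apply: has_vel_conj; exact: h]. Qed.

(** [curve_in] admits arbitrary curves. Near time 0 they stay in the domain of the graph equation,
    and uniqueness of derivatives then forces the [w] component of the velocity. *)
Lemma curve_vel z vec g : small z -> curve_in M (gpt z) vec g ->
  exists v, [/\ vec = realify (tvec z v *m V),
    forall k, has_vel (fun t => zc (g t) k) 0 (v k), zc (g 0) = z &
    exists e : R, 0 < e /\ forall t : R, `|t| <= e ->
      M (g t) /\ forall j, cmod (yc (g t) 0 j) <= dl].
Proof.
have [h0 h1] := conj d_gt0 ddl.
move=> hz [g0 gM gv].
have hy := yc_vel gv.
pose Y := cplx vec *m U; pose v k := Y 0 (lift ord_max k).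
have z0 : zc (g 0) = z by rewrite g0 /gpt zc_xp.
have lt j : cmod (yc (g 0) 0 j) < dl.
  rewrite g0; move: j; rewrite /gpt yc_xp; apply: forall_max => [k|].
    by rewrite rzw_lift; have := hz k; lra.
  by rewrite rzw_max; have := ps_bound rho_small (rpt_small hz); lra.
have /choice[e he] j := has_vel_small (hy j) (lt j).
have [e1 [e10 he1]] := fin_pos_lb (fun j => proj1 (he j)).
have [e2 [e20 he2]] := (near0P _).1 gM.
have hnear (t : R) : `|t| <= Num.min e1 e2 ->
    M (g t) /\ forall j, cmod (yc (g t) 0 j) <= dl.
  rewrite le_min => /andP[t1 t2]; split; first exact: he2.
  move=> j; have := proj2 (he j) t (le_trans t1 (he1 j)).
  by rewrite add0r => /ltW.
have e0 : 0 < Num.min e1 e2 by rewrite lt_min e10.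
have hv k : has_vel (fun t => zc (g t) k) 0 (v k) by exact: hy.
exists v; split=> //; last by exists (Num.min e1 e2).
have hw1 := hy ord_max.
have hw2 : has_vel (fun t => rho (rpt (zc (g t)))) 0 (dpt z v).
  apply: (has_vel_grad (y := fun t => rpt (zc (g t)))); last exact: rpt_vel.
  by rewrite z0; exact: grho.
have hw3 : has_vel (fun t => yc (g t) 0 ord_max) 0 (dpt z v).
  apply: (has_vel_near e0) hw2 => h hh; rewrite add0r.
  by have [Mg yg] := hnear h hh; rewrite -((graphP yg).1 Mg).
have YE : Y = tvec z v.
  apply: rowP_max => [k|]; first by rewrite rzw_lift.
  by rewrite rzw_max (has_vel_uniq hw1 hw3).
by rewrite -YE /Y mulmxK // cplxK.
Qed.

Lemma tangentP z vec : small z ->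
  tangent M (gpt z) vec <-> exists v, vec = realify (tvec z v *m V).
Proof.
have [h0 h1] := conj d_gt0 ddl.
move=> hz; split.
  by move=> [g /(curve_vel hz)[v [-> _ _ _]]]; exists v.
move=> [v ->].
pose zt (t : R) k := z k + t%:C * v k.
exists (fun t => gpt (zt t)).
have zt0 : zt 0 = z by apply/funext => k; rewrite /zt mul0r addr0.
have hzt k : has_vel (zt ^~ k) 0 (v k) by exact: has_vel_affine.
split; first by rewrite zt0.
  apply/near0P.
  have lt k : cmod (zt 0 k) < d by rewrite zt0.
  have /choice[e he] k := has_vel_small (hzt k) (lt k).
  have [e1 [e10 he1]] := fin_pos_lb (fun j => proj1 (he j)).
  exists e1; split=> // t ht; apply: gpt_in => k.
  by have := proj2 (he k) t (le_trans ht (he1 k)); rewrite add0r.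
apply/is_derive_realifyP => j; rewrite realifyK.
have hr i : has_vel (fun t => rzw (zt t) (rho (rpt (zt t))) 0 i) 0 (tvec z v 0 i).
  move: i; apply: forall_max => [k|].
    rewrite rzw_lift; have := hzt k.
    by congr has_vel; apply/funext => t; rewrite rzw_lift.
  rewrite rzw_max.
  have hw2 : has_vel (fun t => rho (rpt (zt t))) 0 (dpt z v).
    apply: (has_vel_grad (y := fun t => rpt (zt t))); last exact: rpt_vel.
    by rewrite zt0; exact: grho.
  by move: hw2; congr has_vel; apply/funext => t; rewrite rzw_max.
have := has_velD (has_vel_cst (p 0 j) 0)
  (has_vel_sum (index_enum _) (fun i => has_velM (V i j) (hr i))).
congr has_vel.
  apply/funext => t; rewrite /gpt /xp !mxE; congr (_ + _).
  by apply: eq_bigr => i _; rewrite mulrC.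
by rewrite add0r mxE; apply: eq_bigr => i _; rewrite mulrC.
Qed.

Lemma dptE z v : dpt z v = \sum_k v k * pd (inl k) rho (rpt z) + duz z v.
Proof. by rewrite /dpt big_sumType. Qed.

Lemma duzZ z c v : duz z (fun k => c * v k) = c^* * duz z v.
Proof.
by rewrite /duz mulr_sumr; apply: eq_bigr => k _; rewrite cconjM mulrA.
Qed.

Lemma dptZ z c v : dpt z (fun k => c * v k) = c * dpt z v + (c^* - c) * duz z v.
Proof.
rewrite !dptE duzZ; set S := \sum_k (c * v k) * _.
have -> : S = c * \sum_k v k * pd (inl k) rho (rpt z).
  by rewrite mulr_sumr; apply: eq_bigr => k _; rewrite mulrA.
ring.
Qed.

Lemma tvecZ z c v : duz z v = 0 -> tvec z (fun k => c * v k) = c *: tvec z v.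
Proof.
move=> h; rewrite /tvec; apply: rowP_max => [k|].
  by rewrite rzw_lift [RHS]mxE rzw_lift.
by rewrite rzw_max [RHS]mxE rzw_max dptZ h mulr0 addr0.
Qed.

(** If [tvec z v] is ['i] times [tvec z v'], the first entries give [v = 'i * v'], and the last one
    leaves the defect [- 2 * 'i * duz z v'], which must vanish. *)
Lemma ctangentP z vec : small z -> ctangent M (gpt z) vec <->
  exists v, vec = realify (tvec z v *m V) /\ duz z v = 0.
Proof.
move=> hz; split.
  move=> [/(tangentP _ hz)[v vE] [u /(tangentP _ hz)[v' ->]]].
  rewrite realify_J vE => /(can_inj (@realifyK R n.+1)).
  rewrite scalemxAl => /(can_inj (mulmxKV Uu)) E.
  exists v; split=> //.
  have vi : v = (fun k => 'i * v' k).
    apply/funext => k; have := congr1 (fun r : 'rV_n.+1 => r 0 (lift ord_max k)) E.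
    by rewrite /tvec /= [X in X = _ -> _]mxE !rzw_lift => ->.
  have := congr1 (fun r : 'rV_n.+1 => r 0 ord_max) E.
  rewrite /tvec /= [X in X = _ -> _]mxE !rzw_max vi duzZ dptZ cconji => /eqP.
  rewrite -subr_eq0 opprD addrA subrr add0r oppr_eq0 mulf_eq0 => /orP[|/eqP ->]; last by rewrite mulr0.
  rewrite -opprD oppr_eq0 -mulr2n -mulr_natr mulf_eq0 pnatr_eq0 orbF.
  by rewrite (negPf (i_neq0 R)).
move=> [v [-> v0]]; split; first by apply/tangentP => //; exists v.
exists (realify (tvec z (fun k => - 'i * v k) *m V)).
  by apply/tangentP => //; exists (fun k => - 'i * v k).
rewrite realify_J tvecZ // scalemxAl scalerA mulrN mulii opprK scale1r //.
Qed.

Local Notation cj := (map_mx (fun c : R[i] => c^*)).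

Lemma Re_T01 (P : 'rV[R[i]]_n.+1) :
  map_mx (@complex.Re R) (row_mx (cj P) ('i *: cj P)) = realify P.
Proof.
rewrite map_row_mx; congr row_mx; apply/rowP => j; rewrite !mxE;
  by case: (P 0 j) => a b /=; ring.
Qed.

Lemma Im_T01 (P : 'rV[R[i]]_n.+1) :
  map_mx (@complex.Im R) (row_mx (cj P) ('i *: cj P)) = realify ('i *: P).
Proof.
rewrite map_row_mx; congr row_mx; apply/rowP => j; rewrite !mxE;
  by case: (P 0 j) => a b /=; ring.
Qed.

Lemma T01P z L : small z -> T01 M (gpt z) L <->
  exists v, duz z v = 0 /\
    L = row_mx (cj (tvec z v *m V)) ('i *: cj (tvec z v *m V)).
Proof.
move=> hz.
split.
  move=> [/(ctangentP _ hz)[v [vE v0]] _ LJ]; exists v; split=> //.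
  move: (tvec z v *m V) vE => P vE.
  have [X [Y LE]] : exists X Y, L = row_mx X Y.
    by exists (lsubmx L), (rsubmx L); rewrite hsubmxK.
  have YX : Y = 'i *: X.
    move: LJ; rewrite LE /Jmx mul_row_block !mulmx0 mulmx1 mulmxN mulmx1 add0r addr0.
    rewrite scale_row_mx => /eq_row_mx[h _].
    by rewrite -[Y]opprK h scaleNr opprK.
  rewrite LE YX; suff -> : X = cj P by [].
  move: vE; rewrite LE YX map_row_mx /realify => /eq_row_mx[h1 h2].
  apply/rowP => j.
  move: (congr1 (fun r : 'rV[R]_n.+1 => r 0 j) h1) (congr1 (fun r : 'rV[R]_n.+1 => r 0 j) h2).
  rewrite !mxE; case: (X 0 j) (P 0 j) => a b [a' b'] /= -> .
  by rewrite mul0r mul1r add0r => <-; apply/eqP; rewrite eq_complex /= opprK !eqxx.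
move=> [v [v0 ->]]; split.
- by rewrite Re_T01; apply/ctangentP => //; exists v.
- rewrite Im_T01; apply/ctangentP => //; exists (fun k => 'i * v k).
  by rewrite tvecZ // scalemxAl duzZ v0 mulr0.
- rewrite /Jmx mul_row_block !mulmx0 mulmx1 mulmxN mulmx1 add0r addr0 scale_row_mx.
  by rewrite scaleNr scalerA mulNr mulii opprK scale1r.
Qed.

(** In the conjugate coordinates [e] of [v] the condition [duz z v = 0] is linear, the kernel of a
    nonzero column; [La] embeds that kernel injectively onto the space in question. *)
Lemma T01_dim z k0 : small z -> pd (inr k0) rho (rpt z) != 0 ->
  has_dim (T01 M (gpt z)) n.-1.
Proof.
move=> hz u0.
pose uT : 'cV[R[i]]_n := \col_k pd (inr k) rho (rpt z).
have uT0 : uT != 0.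
  apply: contraNneq u0 => h.
  by have := congr1 (fun r : 'cV_n => r k0 0) h; rewrite !mxE => ->.
have rk : \rank (kermx uT) = n.-1.
  rewrite mxrank_ker; suff -> : \rank uT = 1%N by rewrite subn1.
  by apply/eqP; rewrite eqn_leq rank_leq_col lt0n mxrank_eq0.
pose E : 'M[R[i]]_(n, n.+1) := \matrix_(k, j)
  optv (fun k' => (k == k')%:R) (pd (inl k) rho (rpt z))^* (unlift ord_max j).
have eE (e : 'rV[R[i]]_n) : e *m uT = 0 ->
    duz z (fun k => (e 0 k)^*) = 0 /\ e *m E = cj (tvec z (fun k => (e 0 k)^*)).
  move=> he.
  have d0 : duz z (fun k => (e 0 k)^*) = 0.
    have := congr1 (fun r : 'rV_1 => r 0 0) he; rewrite !mxE => <-.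
    by apply: eq_bigr => k _; rewrite mxE conjCK.
  split=> //; apply: rowP_max => [k|]; rewrite mxE [RHS]mxE /tvec.
    rewrite rzw_lift conjCK (bigD1 k) //= mxE liftK /= eqxx mulr1 big1 ?addr0 //.
    by move=> j /negPf jk; rewrite mxE liftK /= jk mulr0.
  rewrite rzw_max dptE d0 addr0 rmorph_sum; apply: eq_bigr => k _.
  by rewrite mxE unlift_none; apply/esym; apply: etrans (cconjM _ _) _; rewrite conjCK.
pose X := E *m cj V.
pose La : 'M[R[i]]_(n, n.+1 + n.+1) := row_mx X ('i *: X).
have T01E L : T01 M (gpt z) L <-> exists e : 'rV_n, e *m uT = 0 /\ L = e *m La.
  split.
    move=> /(T01P _ hz)[v [v0 ->]]; exists (\row_k (v k)^*).
    have he : (\row_k (v k)^*) *m uT = 0.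
      apply/matrixP => i j; rewrite !ord1 !mxE -[RHS]v0.
      by apply: eq_bigr => k _; rewrite !mxE.
    have [_ eX] := eE _ he; split=> //.
    have vv : (fun k => ((\row_k (v k)^*) 0 k)^*) = v.
      by apply/funext => k; rewrite mxE conjCK.
    by rewrite /La mul_mx_row -scalemxAr /X mulmxA eX vv map_mxM.
  move=> [e [he ->]]; have [d0 eX] := eE _ he.
  apply/(T01P _ hz); exists (fun k => (e 0 k)^*); split=> //.
  by rewrite /La mul_mx_row -scalemxAr /X mulmxA eX map_mxM.
have Lfree : row_free La.
  apply: inj_row_free => e; rewrite /La mul_mx_row => /eqP.
  rewrite -row_mx0 => /eqP /eq_row_mx[h _].
  have eE0 : e *m E = 0.
    have := congr1 (mulmx^~ (cj U)) h; rewrite mul0mx /X -!mulmxA -map_mxM mulVmx //.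
    by rewrite map_mx1 mulmx1.
  apply/rowP => k; have := congr1 (fun r : 'rV_n.+1 => r 0 (lift ord_max k)) eE0.
  rewrite !mxE (bigD1 k) //= mxE liftK /= eqxx mulr1 big1 ?addr0 //.
  by move=> j /negPf jk; rewrite mxE liftK /= jk mulr0.
rewrite -rk; exists (row_base (kermx uT) *m La); split.
  by rewrite /row_free mxrankMfree // eq_row_base.
move=> L; rewrite T01E; split.
  move=> [e [he ->]]; have : (e <= kermx uT)%MS by apply/sub_kermxP.
  by rewrite -(eq_row_base (kermx uT)) => /submxP[D ->]; rewrite -mulmxA submxMl.
move=> /submxP[D ->]; exists (D *m row_base (kermx uT)); rewrite mulmxA; split=> //.
by apply/sub_kermxP; rewrite (submx_trans (submxMl _ _)) // eq_row_base.
Qed.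

Let pdrho_ps k : ps (fun=> d) (pd (inr k) rho) (Brho / (dl - d)).
Proof.
have [h0 h1] := conj d_gt0 ddl; apply: (ps_pd (s := fun=> dl)) => //.
  by rewrite subr_gt0.
by rewrite addrC subrK.
Qed.

Lemma gpt_CR z k0 : small z -> pd (inr k0) rho (rpt z) != 0 -> CR_at M (gpt z).
Proof.
have [h0 h1] := conj d_gt0 ddl.
move=> hz u0; split; first exact: gpt_in.
exists n.-1; apply/near_rvP.
have [s [s0 [sd hzs]]] : exists s : R, 0 < s /\ (s < d /\ forall k, cmod (z k) <= s).
  have [e [e0 he]] := @fin_pos_lb R 'I_n (fun k => d - cmod (z k))
    (fun k => ltac:(by rewrite subr_gt0)).
  exists (Num.max (d / 2) (d - e)); split; first by rewrite lt_max divr_gt0.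
  split; first by rewrite gt_max; apply/andP; split; lra.
  by move=> k; rewrite le_max; apply/orP; right; have := he k; lra.
have hzr : pdisc (fun=> s) (rpt z) by case=> k /=; rewrite ?cmod_conj.
have [L [e [e0 L0 HL]]] := is_grad_lip (ps_grad (fun=> sd) (pdrho_ps k0) hzr).
set u := pd (inr k0) rho (rpt z) in u0 HL.
have ug : 0 < cmod u by rewrite cmod_gt0.
have [C [C0 HC]] := yc_cont.
have L1 : 0 < L + 1 by rewrite ltr_wpDl.
(* A displacement of [m / 2] in the rotated coordinates keeps [z] within [d], stays where the graph
   equation holds, and moves the entry [u] by at most a quarter of its modulus, so it remains
   nonzero. *)
pose m := Num.min (Num.min e (d - s)) (Num.min (dl / 2) (cmod u / 2 / (L + 1))).
have m0 : 0 < m by rewrite !lt_min e0 subr_gt0 sd !divr_gt0 //; lra.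
have me : m <= e by rewrite !ge_min lexx.
have ms : m <= d - s by rewrite !ge_min lexx orbT.
have mdl : m <= dl / 2 by rewrite !ge_min lexx !orbT.
have mu : m * (L + 1) <= cmod u / 2 by rewrite -ler_pdivlMr // !ge_min lexx !orbT.
exists (m / 2 / C); split=> [|q hq Mq]; first by rewrite !divr_gt0.
have hy j : cmod (yc q 0 j - yc (gpt z) 0 j) <= m / 2.
  have E2 : C * (m / 2 / C) = m / 2 by field; rewrite gt_eqF.
  rewrite -E2; apply: HC; first by rewrite !divr_ge0 ?ltW.
  by move=> i; exact: ltW.
have hzq k : cmod (zc q k - z k) <= m / 2.
  by have := hy (lift ord_max k); rewrite /gpt yc_xp rzw_lift.
have sq : small (zc q).
  move=> k; have -> : zc q k = z k + (zc q k - z k) by ring.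
  apply: le_lt_trans (cmod_le_add (hzs k) (hzq k)) _; lra.
have yq j : cmod (yc q 0 j) <= dl.
  have hyz : cmod (yc (gpt z) 0 j) <= dl - m / 2.
    move: j; rewrite /gpt yc_xp; apply: forall_max => [k|].
      by rewrite rzw_lift; have := hzs k; lra.
    by rewrite rzw_max; have := ps_bound rho_small (rpt_small hz); lra.
  have -> : yc q 0 j = yc (gpt z) 0 j + (yc q 0 j - yc (gpt z) 0 j) by ring.
  have := cmod_le_add hyz (hy j); lra.
have qE : q = gpt (zc q) by rewrite /gpt -((graphP yq).1 Mq) xp_yc.
rewrite qE; apply: (T01_dim (k0 := k0) sq).
pose h (j : I) := rpt (zc q) j - rpt z j.
have hh j : cmod (h j) <= m / 2.
  by case: j => k; rewrite /h /= -?rmorphB ?cmod_conj.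
have := HL h (m / 2) _ _ hh.
have -> : (fun j => rpt z j + h j) = rpt (zc q).
  by apply/funext => j; rewrite /h addrC subrK.
move=> H; have {}H := H ltac:(lra) ltac:(lra).
apply/eqP => q0; rewrite q0 sub0r cmodN in H.
have : L * (m / 2) <= cmod u / 4 by nra.
lra.
Qed.

Hypothesis hCR : CR_function M phi.

Let dphi (z v : 'I_n -> R[i]) := \sum_k (v k)^* * pd (inr k) phic (rpt z).

Let tvec_inj z v v' : tvec z v = tvec z v' -> v = v'.
Proof.
move=> E; apply/funext => k.
by have := congr1 (fun r : 'rV_n.+1 => r 0 (lift ord_max k)) E; rewrite !rzw_lift.
Qed.

Let cderive_phi z v g : small z ->
  curve_in M (gpt z) (realify (tvec z v *m V)) g ->
  cderive (phi \o g) 0 = \sum_k v k * pd (inl k) phic (rpt z) + dphi z v.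
Proof.
move=> hz /(curve_vel hz)[v' [vE hv z0 [e [e0 he]]]].
move: vE => /(can_inj (@realifyK R n.+1)) /(can_inj (mulmxKV Uu)) /tvec_inj vv.
rewrite -vv in hv => {v' vv}.
have h1 : has_vel (fun t => phic (rpt (zc (g t)))) 0
    (\sum_j rpt v j * grad phic (rpt z) j).
  apply: (has_vel_grad (y := fun t => rpt (zc (g t)))); last exact: rpt_vel.
  by rewrite z0; exact: gphi.
have h2 : has_vel (phi \o g) 0 (\sum_j rpt v j * grad phic (rpt z) j).
  apply: (has_vel_near e0) h1 => h /he; rewrite add0r => -[Mg yg] /=.
  by rewrite -phiP.
rewrite big_sumType /= in h2; set S := (X in has_vel _ _ X) in h2.
rewrite /cderive !derive1E.
have [_ ->] := has_vel_Re h2; have [_ ->] := has_vel_Im h2.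
by rewrite -[RHS]/S; case: S {h2}.
Qed.

(** The real and imaginary parts of the (0,1) vector are the directions [v] and ['i * v]. With
    holomorphic part [A] and antiholomorphic part [B] of the derivative along [v], the CR equation
    reads [(A + B) + 'i * ('i * A - 'i * B) = 0], that is [2 * B = 0]. *)
Lemma dphi_eq0 z v k0 : small z -> pd (inr k0) rho (rpt z) != 0 ->
  duz z v = 0 -> dphi z v = 0.
Proof.
move=> hz u0 v0.
pose L := row_mx (cj (tvec z v *m V)) ('i *: cj (tvec z v *m V)).
have TL : T01 M (gpt z) L by apply/(T01P _ hz); exists v.
have [[g hg] [h hh]] : tangent M (gpt z) (map_mx (@complex.Re R) L) /\
    tangent M (gpt z) (map_mx (@complex.Im R) L) by case: TL => -[? _] [? _] _.
have := hCR (gpt_CR hz u0) TL hg hh.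
rewrite Re_T01 in hg; rewrite Im_T01 scalemxAl -tvecZ // in hh.
rewrite (cderive_phi hz hg) (cderive_phi hz hh).
have -> : dphi z (fun k => 'i * v k) = - 'i * dphi z v.
  rewrite /dphi mulr_sumr; apply: eq_bigr => k _.
  by rewrite cconjM cconji mulrA.
have -> : \sum_k 'i * v k * pd (inl k) phic (rpt z) =
    'i * \sum_k v k * pd (inl k) phic (rpt z).
  by rewrite mulr_sumr; apply: eq_bigr => k _; rewrite mulrA.
set A := \sum_k _; set B := dphi z v => E.
have : A + B + ('i * 'i) * (A - B) = 0 by rewrite -E; ring.
rewrite mulii => {}E; have : B *+ 2 = 0 by rewrite -E mulr2n; ring.
by move=> /eqP; rewrite -mulr_natr mulf_eq0 pnatr_eq0 orbF => /eqP.
Qed.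

Lemma rel_real z j k : small z ->
  pd (inr j) phic (rpt z) * pd (inr k) rho (rpt z) =
  pd (inr k) phic (rpt z) * pd (inr j) rho (rpt z).
Proof.
move=> hz; set uj := pd (inr j) rho _; set uk := pd (inr k) rho _.
have [u0|[k0 u0]] : (uk = 0 /\ uj = 0) \/ exists k0, pd (inr k0) rho (rpt z) != 0.
- have [k00|] := eqVneq uk 0; last by right; exists k.
  have [j00|] := eqVneq uj 0; last by right; exists j.
  by left.
- by rewrite !u0.1 !u0.2 !mulr0.
(* The direction tangent to the complex tangent space that has only the coordinates [j] and [k]; the
   CR equation along it is the desired 2 by 2 minor. *)
pose v l := (unitv j uk l - unitv k uj l)^*.
have sumv (F : 'I_n -> R[i]) : \sum_l (v l)^* * F l = uk * F j - uj * F k.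
  rewrite -(sum_unitv j uk F) -(sum_unitv k uj F) -sumrB; apply: eq_bigr => l _.
  by rewrite /v conjCK mulrBl.
have v0 : duz z v = 0 by rewrite /duz sumv -/uj -/uk mulrC subrr.
have := dphi_eq0 hz u0 v0; rewrite /dphi sumv => /eqP; rewrite subr_eq0 => /eqP E.
by rewrite mulrC E mulrC.
Qed.

End Graph.

(** * The complexified graph *)

Lemma grad0_taylor1 (R : realType) (I : finType) (d : R) f B :
  0 < d -> ps (fun _ : I => d) f B -> exists q : I -> (I -> R[i]) -> R[i],
  [/\ forall j, ps (fun=> d) (q j) (B / d),
      forall x, pdisc (fun=> d) x -> f x = f (fun=> 0) + \sum_j x j * q j x &
      is_grad f (fun=> 0) (fun j => q j (fun=> 0))].
Proof.
move=> d0 hf; have [q [hq Hq]] := ps_taylor1 (fun=> d0) hf.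
exists q; split=> //.
have d2 (i : I) : d / 2 < d by rewrite ltr_pdivrMr // ltr_pMr // ltr1n.
have z0 : pdisc (fun=> d / 2) (fun _ : I => 0 : R[i]).
  by move=> i; rewrite cmod0 divr_ge0 // ltW.
have gq j := ps_grad d2 (hq j) z0.
pose g (y : I -> R[i]) := f (fun=> 0) + \sum_k y k * q k y.
pose G (j : I) : R[i] := 0 + \sum_k (unitv k 1 j * q k (fun=> 0)
  + 0 * grad (q k) (fun=> 0) j).
have hG : is_grad g (fun=> 0) G := is_gradD (is_grad_cst (f (fun=> 0)) _) (is_grad_sum (index_enum I)
  (fun j => is_gradM (is_grad_X j (fun=> 0)) (gq j))).
have -> : (fun j => q j (fun=> 0)) = G.
  apply/funext => j; rewrite /G /= add0r -[LHS]mul1r.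
  rewrite -(sum_unitv j 1 (fun k => q k (fun=> 0))); apply: eq_bigr => k _.
  by rewrite mul0r addr0 /unitv eq_sym.
apply: (is_grad_near (d := d) d0 _ hG) => h hh; rewrite /g -Hq //.
by move=> j /=; rewrite add0r.
Qed.

Lemma ps_order2 (R : realType) (I : finType) (d : R) f B :
  0 < d -> ps (fun _ : I => d) f B -> f (fun=> 0) = 0 ->
  is_grad f (fun=> 0) (fun=> 0) ->
  exists K : R, 0 < K /\ forall s : R, 0 < s -> s <= d -> ps (fun=> s) f (K * s ^+ 2).
Proof.
move=> d0 hf f0 gf; have [q [hq Hq gq]] := grad0_taylor1 d0 hf.
have q0 j : q j (fun=> 0) = 0.
  by have /(congr1 (fun a => a j)) := is_grad_uniq gq gf.
have /choice[q2 hq2] j := ps_taylor1 (fun=> d0) (hq j).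
have B0 : 0 <= B by apply: ps_ge0 hf => _; exact: ltW.
have S0 : 0 <= \sum_(j : I) \sum_(k : I) B / d / d.
  by apply: sumr_ge0 => j _; apply: sumr_ge0 => k _; rewrite !divr_ge0 // ltW.
exists (\sum_(j : I) \sum_(k : I) B / d / d + 1); split; first by rewrite ltr_wpDl.
move=> s s0 sd; have sge (i : I) : 0 <= s by exact: ltW.
have sd' (i : I) : s <= d by [].
apply: (ps_le sge (ps_bigsum sge (index_enum I) (fun j => ps_bigsum sge (index_enum I)
  (fun k => ps_mul sge (ps_mul sge (ps_X sge j) (ps_X sge k))
    (ps_radii sge sd' (proj1 (hq2 j) k)))))).
  rewrite mulrDl mul1r; apply: ler_wpDr; first by rewrite exprn_ge0 // ltW.
  rewrite mulr_suml le_eqVlt; apply/orP; left; apply/eqP; apply: eq_bigr => j _.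
  by rewrite mulr_suml; apply: eq_bigr => k _; ring.
move=> x hx; have hxd : pdisc (fun=> d) x by move=> i; exact: le_trans (hx i) sd.
rewrite Hq // f0 add0r; apply: eq_bigr => j _.
rewrite (proj2 (hq2 j)) // q0 add0r mulr_sumr; apply: eq_bigr => k _.
by rewrite mulrA.
Qed.

Section RealCoordinates.
Variables (R : realType) (n : nat) (p : 'rV[R[i]]_n.+1) (U : 'M[R[i]]_n.+1).
Local Notation V := (invmx U).
Local Notation cj := (map_mx (fun c : R[i] => c^*)).
Local Notation J := (('I_n + 'I_n) + bool)%type.

(* [X] collects independent variables [z], [zeta], [w], [omega], the second and the
   fourth standing for the conjugates of [z] and [w]; [xi X] is the complexified
   displacement from [p] in real coordinates. *)
Definition cdisp (X : J -> R[i]) : 'rV[R[i]]_n.+1 :=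
  rzw (fun k => X (inl (inl k))) (X (inr true)) *m V.
Definition cdisp' (X : J -> R[i]) : 'rV[R[i]]_n.+1 :=
  rzw (fun k => X (inl (inr k))) (X (inr false)) *m cj V.
Definition xi (X : J -> R[i]) (l : 'I_(n.+1 + n.+1)) : R[i] :=
  match fintype.split l with
  | inl j => (cdisp X 0 j + cdisp' X 0 j) / 2
  | inr j => - 'i * (cdisp X 0 j - cdisp' X 0 j) / 2
  end.

Definition rjn (z : 'I_n -> R[i]) (w : R[i]) : J -> R[i] :=
  jn (rpt z) (fun b => if b then w else w^*).

Lemma xi_real z w l :
  xi (rjn z w) l = (realify (xp p U z w) 0 l - realify p 0 l)%:C.
Proof.
have D' : cdisp' (rjn z w) = cj (cdisp (rjn z w)).
  rewrite /cdisp map_mxM; congr (_ *m _); apply/rowP => j.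
  by rewrite !mxE; case: unlift.
have D j : xp p U z w 0 j = p 0 j + cdisp (rjn z w) 0 j by rewrite mxE.
rewrite /xi; move: (cdisp (rjn z w)) (cdisp' _) (xp p U z w) D D' => c c' x D ->.
case: (split_ordP l) => j ->.
  rewrite [X in _ + X]mxE /realify !row_mxEl !mxE D.
  case: (p 0 j) (c 0 j) => a b [a' b']; apply/eqP; rewrite eq_complex /=.
  by apply/andP; split; apply/eqP; field.
rewrite [X in _ - X]mxE /realify !row_mxEr !mxE D.
case: (p 0 j) (c 0 j) => a b [a' b']; apply/eqP; rewrite eq_complex /=.
by apply/andP; split; apply/eqP; field.
Qed.

Lemma ps_xi : exists C : R, 0 < C /\ forall s : R, 0 < s -> forall l,
  ps (fun=> s) (fun X => xi X l) (C * s).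
Proof.
pose S := \sum_i \sum_j cmod (V i j) + 1.
have S0 : 0 < S.
  by rewrite ltr_wpDl //; apply: sumr_ge0 => i _; apply: sumr_ge0 => j _; exact: cmod_ge0.
exists S; split=> // s s0 l; have sge (k : J) : 0 <= s by exact: ltW.
have hr (c : 'I_n -> J) (e : J) i : ps (fun=> s)
    (fun X : J -> R[i] => rzw (fun k => X (c k)) (X e) 0 i) s.
  move: i; apply: forall_max => [k|].
    by apply: (ps_le sge (ps_X sge (c k))) => // X _; rewrite rzw_lift.
  by apply: (ps_le sge (ps_X sge e)) => // X _; rewrite rzw_max.
have hS j : \sum_i cmod (V i j) * s <= S * s.
  rewrite -mulr_suml ler_wpM2r ?ltW // (@lt_le_trans _ _ (\sum_i \sum_j cmod (V i j) + 1)) //.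
  rewrite ltr_pwDr //; apply: ler_sum => i _; rewrite (bigD1 j) //= lerDl.
  by apply: sumr_ge0 => k _; exact: cmod_ge0.
have h1 j : ps (fun=> s) (fun X => cdisp X 0 j) (S * s).
  apply: (ps_le sge (ps_bigsum sge (index_enum _) (fun i => ps_scale sge (V i j)
    (hr (fun k => inl (inl k)) (inr true) i))) (hS j)) => X _.
  by rewrite mxE; apply: eq_bigr => i _; rewrite mulrC.
have h2 j : ps (fun=> s) (fun X => cdisp' X 0 j) (S * s).
  apply: (ps_le sge (ps_bigsum sge (index_enum _) (fun i => ps_scale sge (cj V i j)
    (hr (fun k => inl (inr k)) (inr false) i)))) => [|X _].
    by apply: le_trans (hS j); apply: ler_sum => i _; rewrite mxE cmod_conj.
  by rewrite mxE; apply: eq_bigr => i _; rewrite mulrC.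
have c2 : cmod (2 : R[i])^-1 = 2^-1 by rewrite cmodV cmod_nat.
rewrite /xi; case: (fintype.split l) => j.
  apply: (ps_le sge (ps_scale sge 2^-1 (ps_add sge (h1 j) (h2 j)))) => [|X _].
    by rewrite c2; clear sge; lra.
  by rewrite mulrC.
apply: (ps_le sge (ps_scale sge (- 'i / 2) (ps_sub sge (h1 j) (h2 j)))) => [|X _].
  by rewrite cmodM cmodN cmodi mul1r c2; clear sge; lra.
by ring.
Qed.

Lemma xi0 : xi (fun=> 0) = fun=> 0.
Proof.
have d0 (A : 'M[R[i]]_n.+1) : rzw (fun _ : 'I_n => 0) 0 *m A = 0.
  suff -> : rzw (fun _ : 'I_n => 0 : R[i]) 0 = 0 by rewrite mul0mx.
  by apply: rowP_max => [k|]; rewrite ?rzw_lift ?rzw_max mxE.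
apply/funext => l; rewrite /xi /cdisp /cdisp' !d0.
by case: (fintype.split l) => j; rewrite !mxE ?subrr ?addr0 ?mulr0 mul0r.
Qed.

Lemma rjnZ (t : R) z w :
  rjn (fun k => t%:C * z k) (t%:C * w) = (fun j => t%:C * rjn z w j).
Proof.
by apply/funext => -[[k|k]|[]] //=; rewrite /rjn /= cconjM cconjR.
Qed.

End RealCoordinates.

(** * Solving the two defining equations for w and its conjugate *)

Section ImplicitGraph.
Variables (R : realType) (n : nat).
Local Notation I := ('I_n + 'I_n)%type.
Local Notation J := (I + bool)%type.

Definition bord (b : bool) : 'I_2 := if b then 0 else 1.

Lemma bord_eq0 b : (bord b == 0) = b. Proof. by case: b. Qed.

(** The Jacobian of the two equations in the variables [w] and [omega]; column 0 is [w], in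
    accordance with [bord]. *)
Definition omega_mx (l : 'I_2 -> J -> R[i]) : 'M[R[i]]_2 :=
  \matrix_(i, j) l i (inr (j == 0)).

(** A simplified Newton map: subtracting the inverse Jacobian applied to the equations leaves no
    linear part, neither in [w], [omega] nor, by the assumption on [l], in [z], [zeta]. Its norm on
    radius [d] is then of order [d ^ 2], below [d / 8] for small [d], and the fixed point results
    apply. *)
Lemma complex_graph (Rf : 'I_2 -> (J -> R[i]) -> R[i]) (l : 'I_2 -> J -> R[i])
    (B : 'I_2 -> R) (s0 d0 : R) :
  0 < s0 -> 0 < d0 -> (forall i, ps (fun=> s0) (Rf i) (B i)) ->
  (forall i, Rf i (fun=> 0) = 0) -> (forall i, is_grad (Rf i) (fun=> 0) (l i)) ->
  (forall i j, l i (inl j) = 0) -> omega_mx l \in unitmx ->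
  exists (d : R) (g : bool -> (I -> R[i]) -> R[i]),
  [/\ 0 < d, d <= d0, forall b, ps (fun=> d / 2) (g b) (d / 4) &
    forall x (a : bool -> R[i]), pdisc (fun=> d / 2) x ->
      (forall b, cmod (a b) <= d / 4) -> (forall i, Rf i (jn x a) = 0) ->
      forall b, a b = g b x].
Proof.
move=> s00 d00 hR R0 gR l0 Lu.
have sge (k : J) : 0 <= s0 by exact: ltW.
pose T := invmx (omega_mx l).
pose N b X := X (inr b) + (-1) * \sum_i T (bord b) i * Rf i X.
have hN b : ps (fun=> s0) (N b) (s0 + cmod (-1 : R[i]) * \sum_i cmod (T (bord b) i) * B i).
  apply: (ps_add sge (ps_X sge (inr b))); apply: (ps_scale sge).
  by apply: (ps_bigsum sge) => i; exact: (ps_scale sge _ (hR i)).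
have N0 b : N b (fun=> 0) = 0.
  by rewrite /N add0r big1 ?mulr0 // => i _; rewrite R0 mulr0.
have gN b : is_grad (N b) (fun=> 0) (fun=> 0).
  have := is_gradD (is_grad_X (inr b) (fun=> 0)) (is_gradZ (-1)
    (is_grad_sum (index_enum 'I_2) (fun i => is_gradZ (T (bord b) i) (gR i)))).
  congr is_grad; apply/funext => -[j|c].
    by rewrite /unitv /= big1 ?mulr0 ?addr0 // => i _; rewrite l0 mulr0.
  have -> : \sum_i T (bord b) i * l i (inr c) = (T *m omega_mx l) (bord b) (bord c).
    by rewrite mxE; apply: eq_bigr => i _; rewrite mxE bord_eq0.
  rewrite mulVmx // mxE /unitv mulN1r.
  by case: b c => -[] /=; rewrite ?subrr ?subr0.
have /choice[K hK] b := ps_order2 s00 (hN b) (N0 b) (gN b).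
pose KK := K true + K false.
have Kpos b : 0 < K b by have [] := hK b.
have KKb b : K b <= KK.
  by rewrite /KK; case: b; [rewrite lerDl|rewrite lerDr]; exact: ltW.
have KK0 : 0 < KK by rewrite addr_gt0.
pose d := Num.min (Num.min s0 d0) (8 * KK)^-1.
have dpos : 0 < d by rewrite !lt_min s00 d00 invr_gt0 mulr_gt0.
have ds0 : d <= s0 by rewrite !ge_min lexx.
have dd0 : d <= d0 by rewrite !ge_min lexx orbT.
have dK : KK * d ^+ 2 <= d / 8.
  have : d * (8 * KK) <= 1.
    by rewrite -ler_pdivlMr ?mulr_gt0 // div1r ge_min lexx orbT.
  clear sge; nra.
have eta0 : 0 < KK * d ^+ 2 by rewrite mulr_gt0 // exprn_gt0.
have hNd b : ps (fun=> d) (N b) (KK * d ^+ 2).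
  apply: (@ps_le _ _ _ _ (N b) (N b) (K b * d ^+ 2)) => //.
  - by move=> k; exact: ltW.
  - exact: (proj2 (hK b)).
  - by rewrite ler_wpM2r // exprn_ge0 // ltW.
have [g [hg Hg]] := ps_fixpoint dpos eta0 dK hNd.
have g4 b : ps (fun=> d / 2) (g b) (d / 4).
  apply: (@ps_le _ _ _ _ (g b) (g b) (2 * (KK * d ^+ 2))) => //.
    by move=> k; rewrite divr_ge0 // ltW.
  clear sge; lra.
exists d, g; split=> // x a hx ha hR0 b.
suff E : a = g ^~ x by rewrite {1}E.
apply: (fixpoint_uniq dpos eta0 dK hNd hx ha) => [c|c|c].
- exact: ps_bound (g4 c) hx.
- by rewrite /N /= big1 ?mulr0 ?addr0 // => i _; rewrite hR0 mulr0.
- exact: Hg.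
Qed.

Variables (p : 'rV[R[i]]_n.+1) (U : 'M[R[i]]_n.+1).
Hypothesis Uu : U \in unitmx.

Lemma xp_cplx e (y := cplx e *m U) :
  xp p U (fun k => y 0 (lift ord_max k)) (y 0 ord_max) = p + cplx e.
Proof.
rewrite /xp; congr (_ + _).
have -> : rzw (fun k => y 0 (lift ord_max k)) (y 0 ord_max) = y.
  by apply: rowP_max => [k|]; rewrite ?rzw_lift ?rzw_max.
by rewrite /y mulmxK.
Qed.

Lemma derive_complexify (r : 'rV[R]_(n.+1 + n.+1) -> R) F (t : R) l e
    (y := cplx e *m U)
    (X := rjn (fun k => y 0 (lift ord_max k)) (y 0 ord_max)) : 0 < t ->
  (forall x : 'rV[R]_(n.+1 + n.+1), (forall i, `|x 0 i - realify p 0 i| <= t) ->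
    F (fun i => (x 0 i - realify p 0 i)%:C) = (r x)%:C) ->
  is_grad (fun X => F (xi U X)) (fun=> 0) l ->
  ('D_e r (realify p))%:C = \sum_k X k * l k.
Proof.
move=> t0 HF gF; set s := \sum_k X k * l k.
pose f (u : R) := r (realify p + u *: e).
have X0 : (fun k => (0 : R)%:C * X k) = fun=> 0 by apply/funext => k; rewrite mul0r.
have v1 : has_vel (fun u : R => F (xi U (fun k => u%:C * X k))) 0 s.
  have gF' : is_grad (fun X => F (xi U X)) (fun k => (0 : R)%:C * X k) l.
    by rewrite X0.
  apply: (@has_vel_grad R J _ (fun (u : R) k => u%:C * X k) 0 X l gF') => k.
  have := has_velM (X k) (has_vel_id (0 : R)); rewrite mulr1.
  by congr has_vel; apply/funext => u; rewrite mulrC.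
have E1 : 0 < 1 + \sum_i `|e 0 i| by rewrite ltr_pwDl // sumr_ge0.
have v2 : has_vel (fun u : R => (f u)%:C) 0 s.
  have dpos := divr_gt0 t0 E1.
  apply: (has_vel_near dpos _ v1) => h; rewrite add0r ler_pdivlMr // => hh; rewrite -rjnZ /f.
  have xE : realify (xp p U (fun k => h%:C * y 0 (lift ord_max k)) (h%:C * y 0 ord_max))
      = realify p + h *: e.
    have -> : xp p U (fun k => h%:C * y 0 (lift ord_max k)) (h%:C * y 0 ord_max) =
        p + cplx (h *: e).
      rewrite -xp_cplx; have yE : cplx (h *: e) *m U = h%:C *: y.
        rewrite /y scalemxAl; congr (_ *m _); apply/rowP => j; rewrite !mxE.
        by apply/eqP; rewrite eq_complex /=; apply/andP; split; apply/eqP; ring.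
      by rewrite yE; congr (xp p U _ _); [apply/funext => k|]; rewrite [RHS]mxE.
    by rewrite realifyD cplxK.
  have -> : xi U (rjn (fun k => h%:C * y 0 (lift ord_max k)) (h%:C * y 0 ord_max)) =
      (fun i => ((realify p + h *: e) 0 i - realify p 0 i)%:C).
    by apply/funext => i; rewrite (xi_real p) xE.
  apply: HF => i; rewrite [X in X - _]mxE [X in _ + X - _]mxE addrC addKr normrM.
  apply: le_trans _ hh; rewrite ler_wpM2l // (bigD1 i) //= addrCA lerDl.
  by rewrite addr_ge0 // sumr_ge0.
have dRe := has_vel_Re v2; have dIm := has_vel_Im v2.
(* The curve takes real values, so the imaginary part of its velocity is the derivative of a
   constant. *)
have sI : complex.Im s = 0.
  have [_ <-] := dIm; exact: derive_cst.
have -> : s = (complex.Re s)%:C by case: s sI {v1 v2 dRe dIm} => a b /= ->.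
congr (_%:C); have [_ <-] := dRe; rewrite /derive.
suff -> : (fun h : R => h^-1 *: ((r \o shift (realify p)) (h *: e) - r (realify p))) =
  (fun h : R => h^-1 *: (((fun u : R => complex.Re (f u)%:C) \o shift 0) (h *: (1 : R))
    - complex.Re (f 0)%:C)) by [].
apply/funext => h /=; rewrite /f addr0 scale0r addr0 [h *: (1 : R)]mulr1.
by rewrite [realify p + _]addrC.
Qed.

(** A vector killing the [w], [omega] block on the left kills both full gradients, since their other
    block is zero. It then kills the real Jacobian of the defining functions, whose rows are
    independent also over [R[i]]. *)
Lemma omega_unit (r : 'I_2 -> 'rV[R]_(n.+1 + n.+1) -> R) F (t : 'I_2 -> R)
    (l : 'I_2 -> J -> R[i]) :
  (forall i, 0 < t i) ->
  (forall i (x : 'rV[R]_(n.+1 + n.+1)), (forall j, `|x 0 j - realify p 0 j| <= t i) ->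
    F i (fun j => (x 0 j - realify p 0 j)%:C) = (r i x)%:C) ->
  (forall i, is_grad (fun X => F i (xi U X)) (fun=> 0) (l i)) ->
  (forall i j, l i (inl j) = 0) ->
  row_free (\matrix_(i < 2, j < n.+1 + n.+1) 'D_(delta_mx 0 j) (r i) (realify p)) ->
  omega_mx l \in unitmx.
Proof.
move=> t0 HF gF l0; set D := \matrix_(i, j) _ => Df.
rewrite -row_free_unit; apply: inj_row_free => c cL.
have cl k : \sum_i c 0 i * l i k = 0.
  case: k => [j|b]; first by apply: big1 => i _; rewrite l0 mulr0.
  have := congr1 (fun u : 'rV_2 => u 0 (bord b)) cL; rewrite !mxE => E; rewrite -[RHS]E.
  by apply: eq_bigr => i _; rewrite mxE bord_eq0.
have DE i j : map_mx (real_complex R) D i j =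
    ('D_(delta_mx 0 j) (r i) (realify p))%:C by rewrite !mxE.
have : c *m map_mx (real_complex R) D = 0.
  apply/rowP => j; rewrite mxE [RHS]mxE.
  transitivity (\sum_i c 0 i * (\sum_k
     rjn (fun k => (cplx (delta_mx 0 j) *m U) 0 (lift ord_max k))
       ((cplx (delta_mx 0 j) *m U) 0 ord_max) k * l i k)).
    apply: eq_bigr => i _; rewrite DE; congr (_ * _).
    exact: (derive_complexify (delta_mx 0 j) (t0 i) (HF i) (gF i)).
  under eq_bigr do rewrite mulr_sumr.
  rewrite exchange_big big1 // => k _ /=.
  under eq_bigr do rewrite mulrCA.
  by rewrite -mulr_sumr cl mulr0.
have Df' : row_free (map_mx (real_complex R) D) by rewrite row_free_map.
by move=> /(congr1 (mulmx^~ (pinvmx (map_mx (real_complex R) D)))); rewrite mul0mx mulmxKp.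
Qed.

(** [f] vanishes on a graph tangent to [w = 0]: there [w] is of second order, so the linear part of
    [f] in [z] and its conjugate is of second order too, hence zero. *)
Lemma linear_part0 (f : (J -> R[i]) -> R[i]) l (rh : ('I_n -> R[i]) -> R[i]) (K m0 : R) :
  0 < m0 -> 0 < K -> is_grad f (fun=> 0) l ->
  (forall z (m : R), 0 <= m -> m <= m0 -> (forall k, cmod (z k) <= m) ->
    f (rjn z (rh z)) = 0 /\ cmod (rh z) <= K * m ^+ 2) ->
  forall j, l (inl j) = 0.
Proof.
move=> m00 K0 [K' [d [d0 Hf]]] H; apply: real_lin0 => z.
pose m1 := \sum_k cmod (z k) + 1.
have m10 : 0 < m1 by rewrite ltr_wpDl // sumr_ge0 // => k _; exact: cmod_ge0.
have zm k : cmod (z k) <= m1.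
  rewrite (@le_trans _ _ (\sum_k cmod (z k))) ?lerDl //.
  by rewrite (bigD1 k) //= lerDl sumr_ge0 // => j _; exact: cmod_ge0.
set S := \sum_j _.
pose dd := Num.min (Num.min d m0) K^-1 / m1.
have dd0 : 0 < dd by rewrite divr_gt0 // !lt_min d0 m00 invr_gt0.
pose L := cmod (l (inr true)) + cmod (l (inr false)).
have f0 : f (fun=> 0) = 0.
  have [|] := H (fun=> 0) 0 (lexx _) (ltW m00); first by move=> k; rewrite cmod0.
  rewrite expr0n /= mulr0 => h1 h2.
  have r0 : rh (fun=> 0) = 0.
    by apply/eqP; rewrite -cmod_eq0 eq_le h2 cmod_ge0.
  move: h1; rewrite r0; congr (f _ = _); apply/funext => -[[k|k]|[]] //=.
    by rewrite /rjn /= rmorph0.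
  by rewrite /rjn /= rmorph0.
(* The estimate says that [t * S] is of order [t ^ 2]; multiplied by [t], it fits the quadratic slot
   of [pow_sep]. *)
have [] // := @pow_sep R 0 S (K' * m1 ^+ 2 + K * m1 ^+ 2 * L) dd dd0 _.
move=> t tp; rewrite ler_pdivlMr // !le_min => /andP[/andP[td tm] tK].
have tm1 : 0 < t * m1 by rewrite mulr_gt0.
have tz k : cmod (t%:C * z k) <= t * m1.
  by rewrite cmodM cmodR gtr0_norm // ler_wpM2l // ltW.
have [R0 wb] := H _ _ (ltW tm1) tm tz.
set w := rh _ in R0 wb; pose X := rjn (fun k => t%:C * z k) w.
have wb' : cmod w <= t * m1.
  apply: le_trans wb _; have : t * m1 * K <= 1 by rewrite -ler_pdivlMr // div1r.
  nra.
have hX k : cmod (X k) <= t * m1.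
  by case: k => [[k|k]|[]] //=; rewrite /X /rjn /= ?cmod_conj.
have := Hf X _ (ltW tm1) td hX.
have -> : (fun j => 0 + X j) = X by apply/funext => j; rewrite add0r.
rewrite f0 R0 subr0 sub0r cmodN => h1.
rewrite mulr0 add0r cmodM cmodR ger0_norm ?exprn_ge0 ?(ltW tp) //.
have -> : (K' * m1 ^+ 2 + K * m1 ^+ 2 * L) * t ^+ 3 =
  t * (K' * (t * m1) ^+ 2 + K * (t * m1) ^+ 2 * L) by ring.
rewrite expr2 -mulrA ler_pM2l //.
have -> : t * cmod S = cmod (t%:C * S) by rewrite cmodM cmodR gtr0_norm.
have -> : t%:C * S = (\sum_j X j * l j) - (w * l (inr true) + w^* * l (inr false)).
  rewrite [\sum_j X j * l j]big_sumType /= big_bool /=.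
  rewrite /X /rjn /= addrK mulr_sumr; apply: eq_bigr => -[k|k] _ /=; rewrite ?cconjM ?cconjR; ring.
apply: cmod_le_sub => //; rewrite /L mulrDr.
by apply: cmod_le_add; rewrite cmodM ?cmod_conj ler_wpM2r ?cmod_ge0.
Qed.

End ImplicitGraph.

(** * From the given submanifold to its complexified graph *)

Section GraphData.
Variables (R : realType) (n : nat).
Variables (M : set 'rV[R[i]]_n.+1) (p : 'rV[R[i]]_n.+1) (U : 'M[R[i]]_n.+1).
Local Notation V := (invmx U).
Local Notation J := (('I_n + 'I_n) + bool)%type.

Lemma qform_mx (A B C : 'M[R[i]]_n) (z : 'I_n -> R[i]) (v := \row_k z k) :
  (v *m A *m (v ^t*)%sesqui + v *m B *m v^T) 0 0 + ((v *m C *m v^T) 0 0)^* =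
  qform A B C z.
Proof.
rewrite mxE; congr (_ + _ + _^*); rewrite mxE; under eq_bigr do rewrite mxE big_distrl /=;
  rewrite exchange_big; apply: eq_bigr => k _; apply: eq_bigr => l _; by rewrite !mxE.
Qed.

Lemma qform_bound (A B C : 'M[R[i]]_n) : exists K : R, 0 < K /\
  forall z (m : R), 0 <= m -> (forall k, cmod (z k) <= m) ->
    cmod (qform A B C z) <= K * m ^+ 2.
Proof.
pose S (D : 'M[R[i]]_n) : R := \sum_k \sum_l cmod (D k l).
have S0 D : 0 <= S D by apply: sumr_ge0 => k _; apply: sumr_ge0 => l _; exact: cmod_ge0.
exists (S A + S B + S C + 1); split; first by rewrite ltr_wpDl // !addr_ge0.
move=> z m m0 hz.
have H (D : 'M[R[i]]_n) (y : 'I_n -> R[i]) : (forall k, cmod (y k) <= m) ->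
    cmod (\sum_k \sum_l z k * D k l * y l) <= S D * m ^+ 2.
  move=> hy; apply: le_trans (cmod_sum _ _ _) _; rewrite mulr_suml.
  apply: ler_sum => k _; apply: le_trans (cmod_sum _ _ _) _; rewrite mulr_suml.
  apply: ler_sum => l _; rewrite !cmodM mulrAC mulrC ler_wpM2l ?cmod_ge0 // expr2.
  by apply: ler_pM => //; exact: cmod_ge0.
rewrite !mulrDl mul1r; apply: ler_wpDr; first by rewrite exprn_ge0.
rewrite /qform; apply: cmod_le_add; last by rewrite cmod_conj; exact: H.
apply: cmod_le_add; last exact: H.
by apply: (H A (fun l => (z l)^*)) => k; rewrite cmod_conj.
Qed.

Hypothesis Uu : U \in unitmx.

Lemma xp0 : xp p U (fun=> 0) 0 = p.
Proof.
rewrite /xp; have -> : rzw (fun _ : 'I_n => 0) 0 = 0 :> 'rV[R[i]]_n.+1.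
  by apply: rowP_max => [k|]; rewrite ?rzw_lift ?rzw_max mxE.
by rewrite mul0mx addr0.
Qed.

Lemma given_by_graph (A B C : 'M[R[i]]_n) :
  given_by [set (x - p) *m U | x in M]
    (fun z => (z *m A *m (z ^t*)%sesqui + z *m B *m z^T) 0 0
              + ((z *m C *m z^T) 0 0)^*) ->
  exists (rh : ('I_n -> R[i]) -> R[i]) (K e : R), [/\ 0 < e, 0 < K,
    forall z w, (forall k, cmod (z k) < e) -> cmod w < e ->
      (M (xp p U z w) <-> w = rh z) &
    forall z (m : R), 0 <= m -> m < e -> (forall k, cmod (z k) <= m) ->
      cmod (rh z - qform A B C z) <= K * m ^+ 3].
Proof.
move=> [rho0 [/near_rvP[e1 [e10 H1]] [K /near_rvP[e2 [e20 H2]]]]].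
exists (fun z => rho0 (\row_k z k)), (`|K| + 1), (Num.min e1 e2).
split; first by rewrite lt_min e10.
- by rewrite ltr_wpDl.
- move=> z w hz hw.
  have hy j : cmod ((rzw z w : 'rV_n.+1) 0 j - (0 : 'rV_n.+1) 0 j) < e1.
    rewrite [X in _ - X]mxE subr0; move: j; apply: forall_max => [k|].
      by rewrite rzw_lift; have := hz k; rewrite lt_min => /andP[].
    by rewrite rzw_max; move: hw; rewrite lt_min => /andP[].
  have := H1 _ hy; rewrite /wpart rzw_max.
  have -> : zpart (rzw z w) = \row_k z k.
    by apply/rowP => k; rewrite /zpart [LHS]mxE rzw_lift mxE.
  have -> // : [set (x - p) *m U | x in M] (rzw z w) = M (xp p U z w).
  apply/propext; split=> [[x Mx E]|Mx]; last by exists (xp p U z w) => //; exact: yc_xp.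
  have zE : zc p U x = z by apply/funext => k; rewrite /zc /yc E rzw_lift.
  have wE : wc p U x = w by rewrite /wc /yc E rzw_max.
  by rewrite -zE -wE xp_yc.
- move=> z m m0; rewrite lt_min => /andP[m1 m2] hz.
  have hy j : cmod ((\row_k z k) 0 j - (0 : 'rV_n) 0 j) < e2.
    by rewrite !mxE subr0; exact: le_lt_trans (hz j) m2.
  have nm : `|(\row_k z k : 'rV[R[i]]_n)| <= m%:C.
    by apply: rv_norm_le => // j; rewrite mxE.
  have := H2 _ hy; rewrite qform_mx => h.
  rewrite -lecR cmodE; apply: le_trans h _.
  apply: (@le_trans _ _ ((`|K| + 1)%:C * `|(\row_k z k : 'rV[R[i]]_n)| ^+ 3)).
    by rewrite ler_wpM2r ?exprn_ge0 // lecR (le_trans (ler_norm K)) // lerDl.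
  rewrite rmorphM rmorphXn /= ler_wpM2l ?lecR ?addr_ge0 //.
  by rewrite lerXn2r ?nnegrE // lecR.
Qed.

Lemma analytic_pullback (r : 'rV[R]_(n.+1 + n.+1) -> R) : analytic_at r (realify p) ->
  exists F (B s t : R), [/\ 0 < s, 0 < t, ps (fun=> s) (fun X : J -> R[i] => F (xi U X)) B,
    forall x : 'rV[R]_(n.+1 + n.+1), (forall i, `|x 0 i - realify p 0 i| <= t) ->
      F (fun i => (x 0 i - realify p 0 i)%:C) = (r x)%:C &
    forall z w, (forall k, cmod (z k) <= s) -> cmod w <= s ->
      F (xi U (rjn z w)) = (r (realify (xp p U z w)))%:C].
Proof.
move=> /analytic_complexify[F [B [t [t0 hF HF]]]].
have [C [C0 hC]] := ps_xi U.
have s0 : 0 < t / C by rewrite divr_gt0.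
have CE : C * (t / C) = t by rewrite mulrC divfK // gt_eqF.
exists F, B, (t / C), t; split=> //.
- apply: ps_comp hF _ => [k|k|l]; [exact: ltW|exact: ltW|].
  by have := hC _ s0 l; rewrite CE.
- move=> z w hz hw.
  have E : xi U (rjn z w) =
      fun i => (realify (xp p U z w) 0 i - realify p 0 i)%:C.
    by apply/funext => i; rewrite (xi_real p).
  rewrite E; apply: HF => i; rewrite -cmodR -xi_real.
  by rewrite -CE; apply: (ps_bound (hC _ s0 i)) => -[[k|k]|[]] //=; rewrite /rjn /= cmod_conj.
Qed.

(** The function [rh] supplied by [given_by] has no regularity, but its quadratic size gives the
    vanishing linear part that [complex_graph] requires. The power series found there then equals
    [rh] at the real points by uniqueness, and inherits its cubic estimate. *)
Lemma graph_data (A B C : 'M[R[i]]_n) (phi : 'rV[R[i]]_n.+1 -> R[i]) :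
  submanifold (@analytic_at R (n.+1 + n.+1)) 2 M -> M p ->
  given_by [set (x - p) *m U | x in M]
    (fun z => (z *m A *m (z ^t*)%sesqui + z *m B *m z^T) 0 0
              + ((z *m C *m z^T) 0 0)^*) ->
  analytic_on M phi ->
  exists (rho phic : ('I_n + 'I_n -> R[i]) -> R[i]) (dl Brho Bphi K : R),
  [/\ 0 < dl /\ rho (fun=> 0) = 0, ps (fun=> dl) rho Brho /\ ps (fun=> dl) phic Bphi,
    forall x, (forall j, cmod (yc p U x 0 j) <= dl) ->
      (M x <-> wc p U x = rho (rpt (zc p U x))),
    forall x, (forall j, cmod (yc p U x 0 j) <= dl) -> M x ->
      phi x = phic (rpt (zc p U x)) &
    forall z (m : R), 0 <= m -> m <= dl -> (forall k, cmod (z k) <= m) ->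
      cmod (rho (rpt z) - qform A B C z) <= K * m ^+ 3].
Proof.
move=> hM Mp hG hphi.
have [r [rA rF /near_rvP[e1 [e10 Hr]]]] := hM p Mp.
have [gg [hh [gA hA /near_rvP[e2 [e20 Hphi]]]]] := hphi p Mp.
have [rh [K [e [e0 K0 Hrh Hq]]]] := given_by_graph hG.
have [F HF0] := choice (fun i => analytic_pullback (rA i)).
have [Bf HF1] := choice HF0; have [s HF2] := choice HF1.
have [t HF] := choice HF2; clear HF0 HF1 HF2.
have [Fg [Bg [sg [tg [sg0 _ hFg _ Hg]]]]] := analytic_pullback gA.
have [Fh [Bh [sh [th [sh0 _ hFh _ Hh]]]]] := analytic_pullback hA.
have [CV [CV0 HCV]] := mulmx_bound V.
have [Kq [Kq0 HKq]] := qform_bound A B C.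
have [s' [s'0 Hs']] : exists d : R, 0 < d /\ forall i, d <= s i.
  by apply: fin_pos_lb => i; have [] := HF i.
pose s0 := Num.min (Num.min s' (Num.min sg sh)) (Num.min (e / 2)
  (Num.min (e1 / 2 / CV) (e2 / 2 / CV))).
have s00 : 0 < s0 by rewrite !lt_min s'0 sg0 sh0 !divr_gt0.
have : s0 <= s0 by [].
rewrite {2}/s0 !le_min => /andP[/and3P[ss' ssg ssh] /and3P[sse sse1 sse2]].
clearbody s0; have {}sse : s0 < e by lra.
rewrite ler_pdivlMr // in sse1; rewrite ler_pdivlMr // in sse2.
have near z w : (forall k, cmod (z k) <= s0) -> cmod w <= s0 ->
    forall j, cmod (xp p U z w 0 j - p 0 j) <= s0 * CV.
  move=> hz hw j; rewrite /xp [X in X - _]mxE [X in X - _]addrC addrK mulrC.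
  apply: (HCV _ _ (ltW s00)) => {}j; move: j; apply: forall_max => [k|].
    by rewrite rzw_lift.
  by rewrite rzw_max.
pose K2 := K + Kq; have K20 : 0 < K2 by rewrite addr_gt0.
pose m1 := Num.min (Num.min 1 s0) (s0 / K2).
have m10 : 0 < m1 by rewrite !lt_min ltr01 s00 divr_gt0.
have : m1 <= m1 by [].
rewrite {2}/m1 !le_min => /andP[/andP[m11 m1s0] m1K]; clearbody m1.
have rh_le z (m : R) : 0 <= m -> m <= m1 -> (forall k, cmod (z k) <= m) ->
    cmod (rh z) <= K2 * m ^+ 2.
  move=> m0 mm1 hz; have ml1 := le_trans mm1 m11; have ms0 := le_trans mm1 m1s0.
  have h1 := Hq z m m0 (le_lt_trans ms0 sse) hz.
  have h2 := HKq z m m0 hz.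
  have -> : rh z = (rh z - qform A B C z) + qform A B C z by rewrite subrK.
  apply: (le_trans (cmod_le_add h1 h2)); rewrite mulrDl lerD2r ler_wpM2l ?(ltW K0) //.
  by rewrite exprS ler_piMl // exprn_ge0.
have rh_in z (m : R) : 0 <= m -> m <= m1 -> (forall k, cmod (z k) <= m) ->
    [/\ forall k, cmod (z k) <= s0, cmod (rh z) <= s0 & M (xp p U z (rh z))].
  move=> m0 mm1 hz; have h1 := rh_le z m m0 mm1 hz.
  have ml1 := le_trans mm1 m11; have ms0 := le_trans mm1 m1s0.
  have := le_trans mm1 m1K; rewrite ler_pdivlMr // => mK.
  have zs k : cmod (z k) <= s0 by exact: le_trans (hz k) ms0.
  have ws : cmod (rh z) <= s0.
    apply: le_trans h1 _; apply: le_trans _ mK; rewrite mulrC ler_wpM2r ?(ltW K20) //.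
    by rewrite expr2 ler_piMl.
  split=> //; apply/(Hrh z (rh z)) => // [k|]; exact: le_lt_trans sse.
pose Rf i X := F i (xi U X).
have hRf i : ps (fun=> s0) (Rf i) (Bf i).
  have [si0 _ h _ _] := HF i.
  by apply: ps_radii h => _; [exact: ltW|exact: le_trans (Hs' i)].
have Rf_rjn i z w : (forall k, cmod (z k) <= s0) -> cmod w <= s0 -> M (xp p U z w) ->
    Rf i (rjn z w) = 0.
  move=> hz hw Mx; have [_ _ _ _ h] := HF i.
  have si : s0 <= s i by exact: le_trans (Hs' i).
  rewrite /Rf h => [|k|]; [|exact: le_trans si|exact: le_trans si].
  rewrite ((Hr (xp p U z w) _).1 Mx i) // => j.
  by apply: le_lt_trans (near _ _ hz hw j) _; lra.
have Rf0 i : Rf i (fun=> 0) = 0.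
  have := @Rf_rjn i (fun=> 0) 0; rewrite xp0 => h.
  have -> : (fun=> 0) = rjn (fun _ : 'I_n => 0) 0 :> (J -> R[i]).
    by apply/funext => -[[k|k]|[]]; rewrite /rjn /= ?rmorph0.
  by apply: h => // [k|]; rewrite cmod0 ltW.
pose l i := grad (Rf i) (fun=> 0).
have gRf i : is_grad (Rf i) (fun=> 0) (l i).
  apply: (@ps_grad _ _ (fun=> s0) (fun=> 0)) (hRf i) _ => // k.
  by rewrite cmod0.
have l0 i j : l i (inl j) = 0.
  apply: (linear_part0 m10 K20 (gRf i)) => z m m0 mm1 hz.
  have [h1 h2 h3] := rh_in z m m0 mm1 hz.
  by split; [exact: Rf_rjn h1 h2 h3|exact: rh_le hz].
have lu : omega_mx l \in unitmx.
  apply: (omega_unit Uu _ _ gRf l0 rF) => [i|i x]; first by have [_ h _ _ _] := HF i; exact: h.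
  by have [_ _ _ h _] := HF i; exact: h.
have [d [g [d0 ds0 hg Hgu]]] := complex_graph s00 s00 hRf Rf0 gRf l0 lu.
(* Within this radius [rh z], being of second order, has modulus at most [d / 4], the range in which
   the solution is unique. *)
pose dl := Num.min (Num.min (d / 2) m1) (d / 4 / K2).
have dl0 : 0 < dl by rewrite !lt_min m10 !divr_gt0.
have : dl <= dl by [].
rewrite {2}/dl !le_min => /andP[/andP[dld dlm] dlK]; clearbody dl.
have dls0 : dl <= s0 by exact: le_trans m1s0.
have dle : dl < e by exact: le_lt_trans sse.
have rhE z (m : R) : 0 <= m -> m <= dl -> (forall k, cmod (z k) <= m) -> forall b : bool,
    (if b then rh z else (rh z)^*) = g b (rpt z).
  move=> m0 ml hz; have mm1 : m <= m1 by exact: le_trans dlm.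
  have [h1 h2 h3] := rh_in z m m0 mm1 hz.
  apply: (Hgu (rpt z) (fun b => if b then rh z else (rh z)^*)) => [k|b|i]; last exact: Rf_rjn h1 h2 h3.
    apply: (@le_trans _ _ m); last by lra.
    by case: k => k /=; rewrite ?cmod_conj.
  have -> : cmod (if b then rh z else (rh z)^*) = cmod (rh z).
    by case: b => //; rewrite cmod_conj.
  apply: le_trans (rh_le z m m0 mm1 hz) _.
  have : m <= d / 4 / K2 by exact: le_trans dlK.
  rewrite ler_pdivlMr //; apply: le_trans; rewrite mulrC ler_wpM2r ?(ltW K20) //.
  by rewrite expr2 ler_piMl // (le_trans mm1).
have dlge (k : 'I_n + 'I_n) : 0 <= dl by exact: ltW.
have hgd b : ps (fun=> dl) (g b) (d / 4) by apply: ps_radii (hg b).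
have hjn k : ps (fun=> dl) (fun x => jn x (g ^~ x) k) s0.
  case: k => [k|b] /=.
    by apply: (ps_le dlge (ps_X dlge k)) => //; clear dlge; lra.
  by apply: (ps_le dlge (hgd b)) => //; clear dlge; lra.
(* The complexified real and imaginary parts of [phi], evaluated at the solved values of [w] and
   [omega]; off the real points each of them may take complex values. *)
pose phic x := Fg (xi U (jn x (g ^~ x))) + 'i * Fh (xi U (jn x (g ^~ x))).
have pull G (BG s1 : R) : s0 <= s1 -> ps (fun=> s1) (fun X => G (xi U X)) BG ->
    ps (fun=> dl) (fun x => G (xi U (jn x (g ^~ x)))) BG.
  move=> s01 h; have h' : ps (fun=> s0) (fun X => G (xi U X)) BG.
    by apply: ps_radii h => // k; exact: ltW.
  by apply: (ps_comp (h := fun x => jn x (g ^~ x)) dlge _ h' hjn) => k; exact: ltW.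
have zcE x : (forall j, cmod (yc p U x 0 j) <= dl) -> forall k, cmod (zc p U x k) <= dl.
  by move=> h k; exact: h.
exists (g true), phic, dl, (d / 4), (Bg + cmod 'i * Bh), K; split.
- split=> //; have := @rhE (fun=> 0) 0 (lexx _) (ltW dl0).
  have -> : rpt (fun _ : 'I_n => 0) = (fun=> 0) :> ('I_n + 'I_n -> R[i]).
    by apply/funext => -[k|k] //=; rewrite rmorph0.
  move=> h; rewrite -(h _ true) => [|k]; last by rewrite cmod0.
  apply/eqP; rewrite -cmod_eq0 eq_le cmod_ge0 andbT.
  have := rh_le (fun=> 0) 0 (lexx _) (ltW m10).
  by rewrite expr0n mulr0; apply=> k; rewrite cmod0 lexx.
- split; first exact: hgd.
  apply: (ps_add dlge); first exact: pull hFg.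
  by apply: (ps_scale dlge); exact: pull hFh.
- move=> x hx; rewrite -[in M x](xp_yc p Uu x).
  rewrite -(rhE _ dl _ _ (zcE x hx) true) ?lexx ?(ltW dl0) //.
  apply: Hrh => [k|]; apply: le_lt_trans dle; exact: hx.
- move=> x hx Mx.
  have [zs ws Mx'] := rh_in (zc p U x) dl (ltW dl0) dlm (zcE x hx).
  have wE : wc p U x = rh (zc p U x).
      apply/(Hrh (zc p U x)); last by rewrite xp_yc.
      by move=> k; apply: le_lt_trans dle; exact: hx.
    by apply: le_lt_trans dle; exact: hx.
  have xE : xp p U (zc p U x) (rh (zc p U x)) = x by rewrite -wE xp_yc.
  have jE : jn (rpt (zc p U x)) (g ^~ (rpt (zc p U x))) = rjn (zc p U x) (rh (zc p U x)).
    rewrite /rjn; congr jn; apply/funext => b.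
    by rewrite -(rhE _ dl _ _ (zcE x hx)) ?lexx ?(ltW dl0).
  rewrite /phic jE Hg => [|k|]; [|exact: le_trans ssg|exact: le_trans ssg].
  rewrite Hh => [|k|]; [|exact: le_trans ssh|exact: le_trans ssh].
  rewrite xE Hphi // => [|j]; last first.
    by have := near _ _ zs ws j; rewrite xE => h; apply: le_lt_trans h _; clear dlge; lra.
  by apply/eqP; rewrite eq_complex /=; apply/andP; split; apply/eqP; ring.
- move=> z m m0 ml hz.
  rewrite -(rhE _ m m0 ml hz true); apply: Hq => //.
  exact: le_lt_trans dle.
Qed.

End GraphData.

Lemma differentiable_coords (R : realType) (n : nat) (p x : 'rV[R[i]]_n.+1)
    (U : 'M[R[i]]_n.+1) (f : (option 'I_n -> R[i]) -> R[i]) a :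
  is_grad f (optv (zc p U x) (wc p U x)) a ->
  differentiable (fun x => f (optv (zc p U x) (wc p U x)) : R[i]^o) x.
Proof.
move=> [K [d [d0 H]]]; have [C [C0 HC]] := mulmx_bound U.
pose oo (o : option 'I_n) := if o is Some k then lift ord_max k else ord_max : 'I_n.+1.
have oE y o : optv (zc p U y) (wc p U y) o = yc p U y 0 (oo o) by case: o.
apply: (@differentiable_rv _ _ _ _ (fun j => \sum_o U j (oo o) * a o) (K * C ^+ 2) (d / C)).
  by rewrite divr_gt0.
move=> h m m0; rewrite ler_pdivlMr // => md hm.
have Cm : 0 <= C * m by rewrite mulr_ge0 // ltW.
have := H (fun o => (h *m U) 0 (oo o)) (C * m) Cm _ (fun o => HC h m m0 hm (oo o)).
rewrite mulrC => /(_ md).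
have -> : (fun j => optv (zc p U x) (wc p U x) j + (h *m U) 0 (oo j)) =
    optv (zc p U (h + x)) (wc p U (h + x)).
  by apply/funext => o; rewrite !oE /yc -addrA [in RHS]mulmxDl [RHS]mxE addrC.
have -> : \sum_j (h *m U) 0 (oo j) * a j = \sum_j h 0 j * \sum_o U j (oo o) * a o.
  under eq_bigr do rewrite mxE mulr_suml.
  rewrite exchange_big; apply: eq_bigr => j _ /=; rewrite mulr_sumr.
  by apply: eq_bigr => o _; rewrite mulrA.
by rewrite [m * C]mulrC exprMn mulrA.
Qed.

Theorem theorem5p1 (R : realType) (n : nat) (M : set 'rV[R[i]]_n.+1)
    (p : 'rV[R[i]]_n.+1) (phi : 'rV[R[i]]_n.+1 -> R[i])
    (hn : (2 <= n)%N)
    (hM : submanifold (@analytic_at R (n.+1 + n.+1)) 2 M)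
    (hsing : CR_singular M p)
    (hA : A_nondegenerate M p)
    (hexc : ~ exceptional M p)
    (hmin : forall q, CR_at M q -> nonminimal 2 M q)
    (hphi : analytic_on M phi)
    (hCR : CR_function M phi) :
  exists (U : set 'rV[R[i]]_n.+1) (Phi : 'rV[R[i]]_n.+1 -> R[i]),
    [/\ open U, U p, holomorphic_on U Phi &
        forall x, (U `&` M) x -> Phi x = phi x].
Proof.
have [Mp _] := hsing.
have [U [A [B [C [/unitarymx_unit Uu Au hG]]]]] := hA.
have [rho [phic [dl [Brho [Bphi [K [[dl0 rho0] [hrho hphic] graphP phiP hQ]]]]]]] :=
  graph_data Uu hM Mp hG hphi.
have [sg [sg0 Hsg]] : exists sg : R, 0 < sg /\
    forall k : R, 0 < k -> k <= sg -> ps (fun=> k) rho (dl / 2).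
  by apply: (ps_small (fun=> dl0) hrho rho0); rewrite divr_gt0.
pose d := Num.min sg (dl / 2).
have d0 : 0 < d by rewrite lt_min sg0 divr_gt0.
have ddl : d < dl.
  have : d <= dl / 2 by rewrite ge_min lexx orbT.
  lra.
have rho_small : ps (fun=> d) rho (dl / 2) by apply: Hsg; rewrite // ge_min lexx.
clearbody d.
have hpd f Bf j : ps (fun=> dl) f Bf -> ps (fun _ : 'I_n + 'I_n => d) (pd j f) (Bf / (dl - d)).
  by move=> hf; apply: ps_pd hf; rewrite ?subr_gt0 // addrC subrK.
(* The relation is known at the points [rpt z] and extends to independent [zeta] by the identity
   theorem. This covers the open polydisc of radius [d / 2], which contains the closed one of radius
   [d / 4]. *)
have hrel j k x : pdisc (fun=> d / 4) x ->
    pd (inr j) phic x * pd (inr k) rho x = pd (inr k) phic x * pd (inr j) rho x.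
  move=> hx; apply/eqP; rewrite -subr_eq0; apply/eqP.
  have dge (i : 'I_n + 'I_n) : 0 <= d by exact: ltW.
  apply: (ps_conj_vanish (f := fun x => pd (inr j) phic x * pd (inr k) rho x -
    pd (inr k) phic x * pd (inr j) rho x) d0 _ _) => [|z hz|i].
  - have h1 l := hpd _ _ (inr l) hphic; have h2 l := hpd _ _ (inr l) hrho.
    exact: (ps_sub dge (ps_mul dge (h1 j) (h2 k)) (ps_mul dge (h1 k) (h2 j))).
  - apply/eqP; rewrite subr_eq0; apply/eqP.
    exact: (rel_real Uu d0 ddl hrho hphic rho_small graphP phiP hCR _ _ hz).
  - by apply: le_lt_trans (hx i) _; clear dge; lra.
(* Two distinct coordinates, provided by [2 <= n]: one to divide by, one to exclude a remainder. *)
pose ib (b : bool) : 'I_n := if b then Ordinal (ltnW hn) else Ordinal hn.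
have d40 : 0 < d / 4 by rewrite divr_gt0.
have d4l : d / 4 < dl by lra.
have [kap [BP [Phi [kap0 hPhi HPhi]]]] :=
  @complex_extension R n ib rho phic dl (d / 4) Brho Bphi K dl A B C isT d40 d4l
    hrho hphic rho0 hrel Au dl0 hQ.
have [c [c0 Hc]] := yc_cont p U.
(* [kap / 2] keeps the points strictly inside the polydisc of [Phi], where it is differentiable;
   [dl] is the range of the graph equation. *)
pose e := Num.min (kap / 2) dl / c.
have e0 : 0 < e by rewrite divr_gt0 // lt_min dl0 divr_gt0.
have near x : ball p e%:C x -> forall j, cmod (yc p U x 0 j) <= kap / 2 /\
    cmod (yc p U x 0 j) <= dl.
  move=> /(ball_rvP _ _ e0) hx j.
  have := Hc x p e (ltW e0) (fun j => ltW (hx j)) j.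
  have -> : yc p U p = 0 by rewrite /yc subrr mul0mx.
  rewrite [X in _ - X]mxE subr0 mulrC divfK ?gt_eqF // le_min.
  by move=> /andP.
exists (ball p e%:C), (fun x => Phi (optv (zc p U x) (wc p U x))); split.
- by apply: ball_open; rewrite ltcR.
- by apply: ballxx; rewrite ltcR.
- move=> x /near hx.
  have k2 (o : option 'I_n) : kap / 2 < kap by rewrite ltr_pdivrMr // ltr_pMr // ltr1n.
  apply: differentiable_coords; apply: (ps_grad k2 hPhi) => -[k|];
    [exact: (hx (lift ord_max k)).1|exact: (hx ord_max).1].
- move=> x [/near hx Mx].
  have hxl j : cmod (yc p U x 0 j) <= dl by have [] := hx j.
  have hxk j : cmod (yc p U x 0 j) <= kap by have [h _] := hx j; lra.
  have wE := (graphP x hxl).1 Mx.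
  have zk : pdisc (fun=> kap) (rpt (zc p U x)).
    by move=> -[k|k] /=; rewrite ?cmod_conj; exact: hxk.
  have wk : cmod (rho (rpt (zc p U x))) <= kap by rewrite -wE; exact: hxk.
  by rewrite (phiP x hxl Mx) (HPhi _ zk wk) -wE.
Qed.
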